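(* Assume that Dickson's conjecture holds. Let $\mathcal{V} = \{\varphi(n) : n \in \mathbb{Z}_{\geq 1}\}$ be the set of values of Euler's totient function $\varphi$. Then the upper Banach density of $\mathcal{V}$ equals $1/4$, that is, $\delta^*(\mathcal{V}) = 1/4$.
   Context: For a set (sequence) of integers $\mathcal{A}$, its (upper) Banach density is $$\delta^*(\mathcal{A}) = \lim_{H \rightarrow \infty} \limsup_{x \rightarrow \infty} \frac{1}{H} \operatorname{Card}(\mathcal{A} \cap (x, x+H]).$$ A prime number $p$ is a fixed prime divisor of a polynomial $G$ with integer coefficients if $p \mid G(t)$ for all $t \in \mathbb{Z}$. Dickson's conjecture is the following assertion: let $s$ be a positive integer and let $F_1, F_2, \ldots, F_s$ be $s$ linear (degree one) polynomials with integral coefficients and positive leading coefficient such that their product $F_1 F_2 \cdots F_s$ has no fixed prime divisor; then there exist infinitely many positive integers $t$ such that $F_1(t), F_2(t), \ldots, F_s(t)$ are all primes. *)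

(* Defs.v *)
From mathcomp Require Import all_boot all_order all_algebra.
From mathcomp Require Import finmap.
From mathcomp Require Import all_classical all_reals all_analysis.
Set Implicit Arguments.
Unset Strict Implicit.
Unset Printing Implicit Defensive.
Import Order.TTheory GRing.Theory Num.Theory.
Import numFieldNormedType.Exports.
Local Open Scope classical_set_scope.
Local Open Scope ring_scope.

(* Card (A `&` (x, x + H]) for real x and H; the intersection is always finite,
   so [fset_set] never takes its default value here. *)
Definition window_card (R : realType) (A : set int) (x H : R) : nat :=
  #|` fset_set (A `&` [set a : int | x < a%:~R <= x + H])|.

Definition window_limsup (R : realType) (A : set int) (H : R) : \bar R :=
  limf_esup (fun x : R => (H^-1 * (window_card A x H)%:R)%:E) +oo%R.

(* Convergence rather than an equality with [lim], so that the existence of the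
   limit defining the upper Banach density is asserted along with its value. *)
Definition has_upper_banach_density (R : realType) (A : set int) (d : R) : Prop :=
  window_limsup A H @[H --> +oo%R] --> d%:E.

Definition fixed_prime_divisor (p : nat) (G : {poly int}) : Prop :=
  prime p /\ forall t : int, (p%:Z %| G.[t])%Z.

Definition prime_int (z : int) : Prop := exists2 p : nat, prime p & z = p%:Z.

(* [size P = 2] means that P has degree exactly one. *)
Definition dickson_conjecture : Prop :=
  forall (s : nat) (F : 'I_s -> {poly int}),
    (0 < s)%N ->
    (forall i, size (F i) = 2%N) ->
    (forall i, 0 < lead_coef (F i)) ->
    ~ (exists p, fixed_prime_divisor p (\prod_(i < s) F i)) ->
    infinite_set [set t : nat | (0 < t)%N /\ forall i, prime_int (F i).[t%:Z]].

Definition totient_values : set int :=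
  [set (totient n)%:Z | n in [set n : nat | (0 < n)%N]].

(* Main.v *)
Require Import Defs.
From mathcomp Require Import all_boot all_order all_algebra.
From mathcomp Require Import all_solvable all_field.
From mathcomp Require Import perm.
From mathcomp Require Import ring lra zify.
From mathcomp Require boolp.
Set Implicit Arguments.
Unset Strict Implicit.
Unset Printing Implicit Defensive.
Import Order.TTheory GRing.Theory Num.Theory.
Local Open Scope ring_scope.

(** Why the density is 1/4.

Lower bound.  Dickson's conjecture gives, for every N, arbitrarily large X such
that 4 (X + 1), ..., 4 (X + N) are all totients, so some windows of length H far
out contain about H / 4 totients.  One writes 4 (X + j) = phi (c_j q_j) with a
fixed multiplier c_j, phi (c_j) = 2 o_j with o_j odd, and q_j a prime; as X runs
through a progression, q_j = 2 (X + j) / o_j + 1 is a linear form.  The c_j, each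
a prime or the square of a prime, are chosen one after another
([choose_multiplier], [choose_multipliers]) so that the product of the forms has
no fixed prime divisor ([totient_run]).

Upper bound.  The multiples of 4 contribute 1/4, so the other totients must have
upper Banach density 0.  A totient not divisible by 4 has the form p^a (p - 1)
([totient_not4]).  Far out, a prime p contributes at most one such number to a
window, so finitely many p can be discarded, but a is unbounded.  What bounds the
count is a sieve condition that depends on a only modulo a fixed L.  If q is a
prime with q - 1 | L, then m = p^a (p - 1) lies modulo q in the image of
g -> g^a (g - 1) on the nonzero residues.  Unless q - 1 divides a or a + 1, this
image misses at least about sqrt q residues ([missed_sqr]).  If q - 1 divides a
or a + 1 for one q, then m avoids the class -1, or the class 1, modulo every
small prime, provided q = 1 modulo a suitable W.  Summing over a modulo L shows
that the density is at most about 4 / b + L prod_(q in S) (1 - 1 / (4 sqrt q)),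
where b is arbitrarily large ([prime_power_totients_sparse]).

It remains to find, for every W, a set S of primes q = 1 modulo W whose q - 1
divide one L, so many that sum_(q in S) 1 / sqrt q is much larger than log L
([many_smooth_shifted_primes]).  For L a power of the factorial of z this asks
for more than z sqrt y primes q below y, up to powers of log y, whose q - 1 have
no prime factor above z, with z slightly smaller than sqrt y.  Consider the prime
factors l <= z of the numbers q - 1, weighted with log l.  On average over the
primes q <= y congruent to 1 modulo W, the total weight is close to log z, about
half of log y.  If q - 1 has a prime factor well above sqrt y, less than that
half is left for its other prime factors.  A sieve bound shows that few q - 1 have
a prime factor in the transition zone around sqrt y ([zone_size]).  So enough of
the q must have q - 1 free of prime factors above z ([smooth_primes_count]).

The average weight comes from a statement of Bombieri-Vinogradov type for prime
moduli and the residue class 1 ([prime_disc]).  A number with no prime factor up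
to w is a prime or a product p m with p its smallest prime factor.  Rough numbers
are equidistributed by Brun's pure sieve ([sieve_bound], [rough_local_disc]); the
products are cut into boxes on which p and m vary independently, and there the
large sieve applies ([large_sieve], [bilinear_dyadic], [composite_disc]).

Finally one needs scales y at which there are at least y / (log y)^(11/10) primes
congruent to 1 modulo W ([exists_dense_block]).  They exist because the sum of
the reciprocals of these primes does not tend to 0 on tails
([sum_inv_primes_ap]).  This is proved with the norm form of the cyclotomic ring
Z[x] / (Phi_W): a value of the norm is divisible by q only if its argument has a
common factor with Phi_W modulo q, such arguments are spaced apart, and few
values of the norm have no large prime factor. *)

(** * Brun's pure sieve over a list *)
Lemma count_cond_split (T : Type) (a b : pred T) (s : seq T) :
  count b s = (count (fun n => ~~ a n && b n) s + count b (filter a s))%N.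
Proof.
elim: s => //= n s ->; case: (a n) => /=; lia.
Qed.

(** Brun's pure sieve as an induction on the list of primes: the numbers free of
    p and of ps are those free of ps, minus those divisible by p and free of ps.
    Each use of the subtracted term lowers the depth r by one, and at depth 0 the
    trivial bound is used; the factors 1 + 2 / p collect the losses. *)
Lemma sieve_bound (R : realFieldType) (T : Type) (d : nat -> T -> bool)
    (ps : seq nat) (A : seq T) (x : R) (r : nat) :
  0 <= x -> all (fun p => 0 < p)%N ps ->
  (forall ds, subseq ds ps ->
     `|(count (fun n => all (d^~ n) ds) A)%:R - x / (\prod_(p <- ds) p)%:R| <= 1) ->
  `|(count (fun n => all (fun p => ~~ d p n) ps) A)%:R
      - x * \prod_(p <- ps) (1 - p%:R^-1)|
    <= x / 2 ^+ r * \prod_(p <- ps) (1 + 2 / p%:R) + (size ps).+1%:R ^+ r.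
Proof.
elim: ps A x r => [|p ps IH] A x r x0.
  move=> _ /(_ [::] isT); rewrite !big_nil !mulr1 /= invr1 mulr1 expr1n => h.
  rewrite count_predT in h *.
  apply: (le_trans h); rewrite lerDr divr_ge0 // exprn_ge0 //.
move=> /andP[p0 ps0] hA.
have pR : 0 < (p%:R : R) by rewrite ltr0n.
have pi1 : 1 <= (p%:R : R) by rewrite ler1n.
have ip1 : (p%:R : R)^-1 <= 1 by rewrite invf_le1.
have ip0 : 0 < (p%:R : R)^-1 by rewrite invr_gt0.
have P1 : 1 <= \prod_(q <- ps) (1 + 2 / q%:R : R).
  elim: {IH hA} ps {ps0} => [|q qs IHq]; first by rewrite big_nil.
  by rewrite big_cons mulr_ege1 // lerDl divr_ge0 // ler0n.
case: r => [|r].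
  have := hA [::] isT; rewrite big_nil /= mulr1n divr1 count_predT => hs.
  rewrite expr0 !big_cons.
  set S := count _ A; have SA : (S <= size A)%N by apply: count_size.
  have {}SA : (S%:R : R) <= (size A)%:R by rewrite ler_nat.
  set V := \prod_(q <- ps) (1 - _).
  have V01 : 0 <= V <= 1.
    rewrite /V; elim: {IH hA P1 S V SA} ps ps0 => [|q qs IHq]; first by rewrite big_nil ler01 lexx.
    rewrite /= => /andP[q0 qs0]; rewrite big_cons.
    have q1 : (q%:R : R)^-1 <= 1 by rewrite invf_le1 ?ltr0n // ler1n.
    have q1' : 0 <= (q%:R : R)^-1 by rewrite invr_ge0 ler0n.
    move: (IHq qs0) => /andP[h1 h2]; apply/andP; split; nra.
  have W01 : 0 <= (1 - p%:R^-1) * V <= 1.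
    by case/andP: V01 => h1 h2; apply/andP; split; nra.
  set W := (1 - _) * V in W01 *.
  have Q1 : 1 <= (1 + 2 / p%:R) * \prod_(q <- ps) (1 + 2 / q%:R : R).
    by rewrite mulr_ege1 // lerDl divr_ge0 // ler0n.
  set Q := _ * \prod_(q <- ps) (1 + _ / _) in Q1 *.
  have hS0 : 0 <= (S%:R : R) by rewrite ler0n.
  have hs' := ler_normlW hs.
  case/andP: W01 => W0 W1.
  have hxW : x * W <= x by rewrite ler_piMr.
  have hxW0 : 0 <= x * W by rewrite mulr_ge0.
  have hxQ : x <= x * Q by rewrite ler_peMr.
  rewrite ler_norml; apply/andP; split; lra.
have hA1 : forall ds, subseq ds ps ->
     `|(count (fun n => all (d^~ n) ds) A)%:R - x / (\prod_(p <- ds) p)%:R| <= 1.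
  move=> ds hds; apply: hA; exact: (subseq_trans hds (subseq_cons ps p)).
have hA2 : forall ds, subseq ds ps ->
     `|(count (fun n => all (d^~ n) ds) (filter (d p) A))%:R - x / p%:R / (\prod_(p <- ds) p)%:R| <= 1.
  move=> ds hds.
  have := hA (p :: ds); rewrite /= eqxx => /(_ hds).
  rewrite big_cons natrM invfM mulrA count_filter.
  congr (`| _%:R - _ | <= _); apply: eq_count => n /=; exact: andbC.
have h1 := IH A x r.+1 x0 ps0 hA1.
have h2 := IH (filter (d p) A) (x / p%:R) r (divr_ge0 x0 (ltW pR)) ps0 hA2.
have := count_cond_split (d p) (fun n => all (fun p => ~~ d p n) ps) A.
set c1 := count _ A in h1 *; set c2 := count _ (filter _ _) in h2 *.
set c3 := count _ A => hc.
have {}hc : (c3%:R : R) = c1%:R - c2%:R by rewrite hc natrD; ring.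
rewrite hc !big_cons.
set V := \prod_(q <- ps) (1 - _) in h1 h2 *.
set Q := \prod_(q <- ps) (1 + _) in P1 h1 h2 *.
have -> : c1%:R - c2%:R - x * ((1 - p%:R^-1) * V) = (c1%:R - x * V) - (c2%:R - x / p%:R * V) by ring.
apply: (le_trans (ler_normB _ _)); apply: (le_trans (lerD h1 h2)).
have e : x / 2 ^+ r.+1 * ((1 + 2 / p%:R) * Q) = x / 2 ^+ r.+1 * Q + x / p%:R / 2 ^+ r * Q.
  have hp : (p%:R : R) != 0 by rewrite gt_eqF.
  rewrite exprS invfM; set z := (2 ^+ r)^-1; by field.
rewrite e.
have : ((size ps).+1%:R : R) ^+ r.+1 + (size ps).+1%:R ^+ r <= (size ps).+2%:R ^+ r.+1.
  rewrite !exprS -[X in _ + X]mul1r -mulrDl natr1.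
  by apply: ler_pM; rewrite ?exprn_ge0 ?ler0n // lerXn2r ?nnegrE ?ler0n // ler_nat.
lra.
Qed.

Lemma count_modn_eq (X d a : nat) : (a < d)%N ->
  count (fun n => n %% d == a)%N (iota 0 X) = ((X + (d.-1 - a)) %/ d)%N.
Proof.
move=> ad; have d0 : (0 < d)%N by apply: leq_ltn_trans ad.
elim: X => [|X IH]; first by rewrite /= divn_small // add0n; lia.
rewrite -addn1 iotaD count_cat IH add0n /= addn0 addn1 addSn divnS // addnC.
congr (nat_of_bool _ + _)%N.
have -> : (X + (d.-1 - a)).+1 = (X + d - a)%N by lia.
rewrite -eqn_mod_dvd; last by lia.
by rewrite modnDr (modn_small ad).
Qed.

(** Coprimality makes the condition one residue class modulo d; this is the
    distribution hypothesis that the sieve needs for the linear form u n + v. *)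
Lemma count_AP (R : realFieldType) (X d u v : nat) : (0 < d)%N -> coprime u d ->
  `|(count (fun n => d %| u * n + v)%N (iota 0 X))%:R - X%:R / d%:R| <= 1 :> R.
Proof.
move=> d0 cud.
have [a ad ha] : exists2 a, (a < d)%N & forall n, (d %| u * n + v)%N = (n %% d == a)%N.
  case: (posnP u) cud => [-> cud | u0 cud].
    move: cud; rewrite /coprime gcd0n => /eqP ->; exists 0%N => // n.
    by rewrite dvd1n modn1.
  case: (egcdnP d u0) => u' k hk _.
  move: hk; rewrite (eqP cud) => hk.
  exists ((u' * (d - v %% d)) %% d)%N; first by rewrite ltn_mod.
  move=> n.
  have vd : (v %% d < d)%N by rewrite ltn_mod.
  have -> : (d %| u * n + v)%N = (u * n == d - v %% d %[mod d])%N.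
    rewrite -[RHS](eqn_modDr (v %% d)) subnK; last exact: ltnW.
    by rewrite modnDmr modnn.
  apply/eqP/eqP => h.
    rewrite -modnMmr -h modnMmr mulnA hk.
    by rewrite mulnDl mul1n mulnAC modnMDl.
  have -> : (u * n = u * (u' * (d - v %% d)) %[mod d])%N.
    by rewrite -modnMmr h modnMmr.
  by rewrite mulnA (mulnC u) hk mulnDl mul1n mulnAC modnMDl.
rewrite (eq_count ha) count_modn_eq //.
have dR : 0 < (d%:R : R) by rewrite ltr0n.
set c := (_ %/ _)%N.
have h1 : (c * d <= X + d)%N by apply: (leq_trans (leq_divM _ _)); lia.
have h2 : (X <= c * d + d)%N.
  have := ltn_ceil (X + (d.-1 - a)) d0; rewrite -/c mulSn; lia.
have {}h1 : (c%:R * d%:R : R) <= X%:R + d%:R by rewrite -natrM -natrD ler_nat.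
have {}h2 : (X%:R : R) <= c%:R * d%:R + d%:R by rewrite -natrM -natrD ler_nat.
rewrite ler_distl lerBlDr ler_pdivrMr // -[X in _ && X]lerBlDr ler_pdivlMr //.
apply/andP; split; lra.
Qed.

(** * Products over primes *)
Lemma ler_sum_sub (R : numDomainType) (T : eqType) (s1 s2 : seq T) (F : T -> R) :
  uniq s1 -> {subset s1 <= s2} -> (forall x, x \in s2 -> 0 <= F x) ->
  \sum_(x <- s1) F x <= \sum_(x <- s2) F x.
Proof.
elim: s1 s2 => [|x s1 IH] s2 /=.
  by move=> _ _ F0; rewrite big_nil big_seq sumr_ge0.
move=> /andP[xs1 u1] sub F0.
have xs2 : x \in s2 by apply: sub; rewrite inE eqxx.
rewrite big_cons (big_rem x xs2) lerD2l; apply: IH => // y hy.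
  have yx : y != x by apply: contraNneq xs1 => <-.
  have : y \in s2 by apply: sub; rewrite inE hy orbT.
  by rewrite (perm_mem (perm_to_rem xs2)) inE (negPf yx).
by apply: F0; exact: mem_rem hy.
Qed.

Definition primes_upto (w : nat) := [seq p <- iota 0 w.+1 | prime p].

Lemma mem_primes_upto w p : (p \in primes_upto w) = prime p && (p <= w)%N.
Proof. by rewrite mem_filter mem_iota add0n ltnS. Qed.

Lemma primes_upto_uniq w : uniq (primes_upto w).
Proof. exact/filter_uniq/iota_uniq. Qed.

Section Harmonic.
Variable R : realFieldType.

(** Euler's product for the numbers composed of ps, kept as an inequality to avoid
    infinite sums: multiplying the sum by 1 - 1 / p removes the multiples of p. *)
Lemma prod_1minus_smooth_sum (ps : seq nat) (N : nat) :
  all (fun p => 0 < p)%N ps ->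
  \prod_(p <- ps) (1 - p%:R^-1) *
    \sum_(n <- iota 1 N | all (mem ps) (primes n)) n%:R^-1 <= 1 :> R.
Proof.
elim: ps => [|p ps IH] /=.
  rewrite big_nil mul1r => _.
  apply: le_trans (_ : \sum_(n <- [:: 1%N]) (n%:R^-1 : R) <= _); last first.
    by rewrite big_seq1 invr1.
  rewrite -big_filter; apply: ler_sum_sub => [|n|n _]; last by rewrite invr_ge0 ler0n.
    exact/filter_uniq/iota_uniq.
  rewrite mem_filter mem_iota inE => /andP[h /andP[n1 _]].
  case: (ltngtP n 1) => // [|n2]; first by rewrite ltnNge n1.
  have : pdiv n \in primes n by rewrite mem_primes pdiv_prime // pdiv_dvd; lia.
  by case: (primes n) h.
move=> /andP[p0 ps0]; rewrite big_cons.
set S := \sum_(n <- _ | _) _.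
have pR : 0 < (p%:R : R) by rewrite ltr0n.
have {}IH := IH ps0; set V := \prod_(_ <- _) _ in IH *.
set S1 := \sum_(n <- _ | _) _ in IH.
suff h : S <= S1 + p%:R^-1 * S.
  have V0 : 0 <= V.
    rewrite /V big_seq; apply: prodr_ge0 => q qs.
    have q0 : (0 < q)%N by apply: (allP ps0).
    by rewrite subr_ge0 invf_le1 ?ltr0n // ler1n.
  apply: le_trans IH; rewrite mulrAC mulrC; apply: ler_wpM2l => //; lra.
rewrite {1}/S (bigID (fun n => p %| n)%N) /= addrC; apply: lerD.
  rewrite /S1 -big_filter -[leRHS]big_filter; apply: ler_sum_sub => [|n|n _].
  - exact/filter_uniq/iota_uniq.
  - rewrite !mem_filter => /andP[/andP[h pn] ->]; rewrite andbT.
    apply/allP => q qn; have := allP h q qn; rewrite inE => /orP[/eqP qp|//].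
    by move: qn; rewrite mem_primes qp (negPf pn) !andbF.
  - by rewrite invr_ge0 ler0n.
rewrite -big_filter; set s := filter _ _.
have es n : n \in s -> exists2 m, n = (p * m)%N & (0 < m <= N)%N && all (mem (p :: ps)) (primes m).
  rewrite mem_filter mem_iota => /andP[/andP[h /dvdnP[m e]] /andP[n1 nN]].
  exists m; first by rewrite mulnC.
  have m0 : (0 < m)%N by move: n1; rewrite e; case: (m).
  rewrite m0 /=; apply/andP; split; first by move: nN; rewrite e; nia.
  apply/allP => q qm; apply: (allP h); move: qm; rewrite !mem_primes e => /and3P[-> _ /dvdn_mulr->].
  by rewrite muln_gt0 m0 p0.
have -> : \sum_(n <- s) (n%:R^-1 : R) = p%:R^-1 * \sum_(m <- [seq (n %/ p)%N | n <- s]) m%:R^-1.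
  rewrite big_map mulr_sumr big_seq [RHS]big_seq; apply: eq_bigr => n /es [m -> _].
  by rewrite mulKn // natrM invfM.
apply: ler_wpM2l; first by rewrite invr_ge0 ltW.
rewrite /S -[leRHS]big_filter; apply: ler_sum_sub => [|m|n _]; last by rewrite invr_ge0 ler0n.
  rewrite map_inj_in_uniq ?filter_uniq ?iota_uniq // => a b /es[m -> _] /es[m' -> _].
  by rewrite !mulKn // => ->.
move=> /mapP[n /es[m' -> h] ->]; rewrite mulKn // mem_filter mem_iota add1n ltnS.
by case/andP: h => -> ->.
Qed.

Lemma harmonic_pow2 a : 1 + a%:R / 2 <= \sum_(n <- iota 1 (2 ^ a)) n%:R^-1 :> R.
Proof.
elim: a => [|a IH]; first by rewrite expn0 big_seq1 invr1 mul0r addr0.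
rewrite expnS mul2n -addnn iotaD big_cat /=.
have : \sum_(n <- iota (1 + 2 ^ a) (2 ^ a)) ((2 ^ a.+1)%:R^-1 : R) <=
       \sum_(n <- iota (1 + 2 ^ a) (2 ^ a)) n%:R^-1.
  rewrite big_seq [X in _ <= X]big_seq; apply: ler_sum => n.
  rewrite mem_iota => /andP[h1 h2]; rewrite lef_pV2 ?posrE ?ltr0n ?expn_gt0 //; last by lia.
  by rewrite ler_nat expnS; lia.
rewrite big_const_seq count_predT size_iota iter_addr_0 -[_ *+ _]mulr_natr => h.
have e : (2 ^ a.+1)%:R^-1 * (2 ^ a)%:R = 2^-1 :> R.
  rewrite expnS natrM invfM -mulrA mulVf ?mulr1 // pnatr_eq0 -lt0n expn_gt0 //.
move: h; rewrite e -[a.+1]addn1 natrD; lra.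
Qed.

(** The trivial bound 1 - 1 / p >= 1 / p, which suffices for the boundedly many
    primes dividing W. *)
Lemma prod_1minus_ge (ps : seq nat) : all (fun p => 1 < p)%N ps ->
  (\prod_(p <- ps) p)%:R^-1 <= \prod_(p <- ps) (1 - p%:R^-1) :> R.
Proof.
elim: ps => [|p ps IH] /=; first by rewrite !big_nil invr1.
move=> /andP[p1 h]; rewrite !big_cons natrM invfM; apply: ler_pM => //.
- by rewrite invr_ge0 ler0n.
- by rewrite invr_ge0 ler0n.
- have p2 : 2 <= (p%:R : R) by rewrite (ler_nat _ 2).
  have : (p%:R : R)^-1 <= 2^-1 by rewrite lef_pV2 // posrE; lra.
  lra.
- exact: IH.
Qed.

Lemma prod_primes_dvdn (ps : seq nat) n : uniq ps -> all prime ps ->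
  all (fun p => p %| n)%N ps -> (\prod_(p <- ps) p %| n)%N.
Proof.
elim: ps => [|p ps IH] /=; first by rewrite big_nil dvd1n.
move=> /andP[pps u] /andP[pp h] /andP[pn hn]; rewrite big_cons Gauss_dvd ?pn ?IH //.
rewrite prime_coprime // Euclid_dvd_prod // big_has; apply/hasPn => q qps.
rewrite dvdn_prime2 // ?(allP h) //; apply: contraNneq pps => -> //.
Qed.

(** Mertens' upper bound with a weak constant: the product over all primes up to
    2^a is at most the inverse of a harmonic sum, and dropping the primes that
    divide W costs at most a factor W. *)
Lemma prod_1minus_coprime_le (W a : nat) : (0 < W)%N -> (0 < a)%N ->
  \prod_(p <- primes_upto (2 ^ a) | ~~ (p %| W)%N) (1 - p%:R^-1) <= (2 * W)%:R / a%:R :> R.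
Proof.
move=> W0 a0.
have aR : 0 < (a%:R : R) by rewrite ltr0n.
set ps := primes_upto _.
have ps1 p : p \in ps -> (1 < p)%N by rewrite mem_primes_upto => /andP[/prime_gt1].
have H : \prod_(p <- ps) (1 - p%:R^-1) <= 2 / a%:R :> R.
  have ps0 : all (fun p => 0 < p)%N ps by apply/allP => p /ps1; lia.
  have := prod_1minus_smooth_sum (2 ^ a) ps0.
  set V := \prod_(_ <- _) _; set S := \sum_(_ <- _ | _) _ => h.
  have V0 : 0 <= V.
    rewrite /V big_seq; apply: prodr_ge0 => q /ps1 q1.
    by rewrite subr_ge0 invf_le1 ?ltr0n ?ler1n; lia.
  have : 1 + a%:R / 2 <= S.
    apply: (le_trans (harmonic_pow2 a)); rewrite /S -[leRHS]big_filter; apply: ler_sum_sub.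
    - exact: iota_uniq.
    - move=> n hn; rewrite mem_filter hn andbT; apply/allP => p; rewrite mem_primes => /and3P[pp n0 pn].
      rewrite inE mem_primes_upto pp /=; apply: (leq_trans (dvdn_leq n0 pn)).
      by move: hn; rewrite mem_iota; lia.
    - by move=> n _; rewrite invr_ge0 ler0n.
  move=> hS; rewrite ler_pdivlMr //; nra.
rewrite (bigID (fun p => ~~ (p %| W)%N)) /= in H.
set V := \prod_(_ <- _ | _) _ in H *.
have V0 : 0 <= V.
  rewrite /V big_seq_cond; apply: prodr_ge0 => q /andP[/ps1 q1 _].
  by rewrite subr_ge0 invf_le1 ?ltr0n ?ler1n; lia.
have : (W%:R : R)^-1 <= \prod_(p <- ps | ~~ ~~ (p %| W)%N) (1 - p%:R^-1).
  rewrite -big_filter; set qs := filter _ _.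
  have hq p : p \in qs -> prime p && (p %| W)%N.
    by rewrite mem_filter mem_primes_upto negbK => /andP[-> /andP[->]].
  apply: le_trans (prod_1minus_ge _); last by apply/allP => p /hq /andP[/prime_gt1].
  have hd : (\prod_(p <- qs) p %| W)%N.
    apply: prod_primes_dvdn; first exact/filter_uniq/primes_upto_uniq.
    - by apply/allP => p /hq /andP[].
    - by apply/allP => p /hq /andP[].
  rewrite lef_pV2 ?posrE ?ltr0n // ?ler_nat; [exact: dvdn_leq|exact: dvdn_gt0 hd].
set U := \prod_(_ <- _ | _) _ in H * => hU.
have WR : 0 < (W%:R : R) by rewrite ltr0n.
have : V * W%:R^-1 <= 2 / a%:R by apply: le_trans H; apply: ler_wpM2l.
rewrite ler_pdivrMr // natrM => h; apply: (le_trans h).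
by rewrite mulrAC.
Qed.

Lemma prod_1plus2_le (ps : seq nat) w : uniq ps -> all (fun p => 0 < p <= w)%N ps ->
  \prod_(p <- ps) (1 + 2 / p%:R) <= w.+1%:R ^+ 2 :> R.
Proof.
move=> u h.
have h1 : \prod_(p <- ps) (1 + p%:R^-1) <= w.+1%:R :> R.
  have -> : w.+1%:R = \prod_(n <- iota 1 w) (1 + n%:R^-1) :> R.
    elim: w {h} => [|w IH]; first by rewrite big_nil.
    rewrite -[in RHS](addn1 w) iotaD big_cat /= big_seq1 -IH add1n mulrDr mulfV ?pnatr_eq0 //.
    by rewrite mulr1 natr1.
  have gen : forall s1 s2 : seq nat, uniq s1 -> {subset s1 <= s2} ->
      \prod_(p <- s1) (1 + p%:R^-1) <= \prod_(p <- s2) (1 + p%:R^-1) :> R.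
    elim=> [|x s1 IH] s2 /=.
      move=> _ _; rewrite big_nil; elim: s2 => [|y s2 IH]; first by rewrite big_nil.
      by rewrite big_cons mulr_ege1 // lerDl invr_ge0 ler0n.
    move=> /andP[xs1 u1] sub.
    have xs2 : x \in s2 by apply: sub; rewrite inE eqxx.
    rewrite big_cons (big_rem x xs2) ler_wpM2l //; first by rewrite addr_ge0 ?invr_ge0 ?ler0n.
    apply: IH => // y hy.
    have yx : y != x by apply: contraNneq xs1 => <-.
    have : y \in s2 by apply: sub; rewrite inE hy orbT.
    by rewrite (perm_mem (perm_to_rem xs2)) inE (negPf yx).
  apply: gen => // p /(allP h); rewrite mem_iota; lia.
apply: le_trans (_ : (\prod_(p <- ps) (1 + p%:R^-1)) ^+ 2 <= _); last first.
  rewrite lerXn2r ?nnegrE ?ler0n //; apply: prodr_ge0 => p _.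
  by rewrite addr_ge0 ?invr_ge0 ?ler0n.
rewrite expr2 -big_split /=; apply: ler_prod => p _.
have p0 : 0 <= (p%:R : R)^-1 by rewrite invr_ge0 ler0n.
by apply/andP; split; nra.
Qed.

End Harmonic.

(** * A large sieve inequality by duality *)
(** The free weight l replaces the Cauchy-Schwarz inequality: it will be
    optimised only once, after all summations. *)
Lemma AGM2_weighted (C : numFieldType) (x y l : C) : 0 <= x -> 0 <= y -> 0 < l ->
  2 * (x * y) <= l * x ^+ 2 + y ^+ 2 / l.
Proof.
move=> x0 y0 l0.
have h : 0 <= (l * x - y) ^+ 2.
  by apply: real_exprn_even_ge0 => //; rewrite rpredB // ger0_real // mulr_ge0 // ltW.
rewrite -(ler_pM2l l0) -subr_ge0.
suff -> : l * (l * x ^+ 2 + y ^+ 2 / l) - l * (2 * (x * y)) = (l * x - y) ^+ 2 by [].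
by field; rewrite gt_eqF.
Qed.

(** The large sieve in dual form.  Writing the left side T as sum a_n t_n, it is
    enough to bound sum |t_n|^2 by B T.  The quadratic form is smoothed with a
    Fejer kernel: averaging over K shifts of the interval makes the kernel the
    square |D|^2 of a geometric sum, which is nonnegative, so that Schur's test on
    the rows of |D|^2 gives the bound. *)
Lemma dual_sieve (C : numClosedFieldType) (I : eqType) (X : seq I) (z : I -> C)
    (K N : nat) (B : C) (a : nat -> C) :
  (forall x, `|z x| = 1) -> (0 < N <= K)%N -> 0 < B ->
  (forall x, x \in X ->
     \sum_(y <- X) `|\sum_(0 <= j < N + K) (z x * (z y)^*) ^+ j| ^+ 2 <= K%:R * B) ->
  \sum_(x <- X) `|\sum_(0 <= n < N) a n * z x ^+ n| ^+ 2
    <= 2 * B * \sum_(0 <= n < N) `|a n| ^+ 2.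
Proof.
move=> z1 /andP[N0 NK] B0 row.
have K0 : 0 < (K%:R : C) by rewrite ltr0n (leq_trans N0).
pose S x := \sum_(0 <= n < N) a n * z x ^+ n.
pose b x := (S x)^*.
pose t n := \sum_(x <- X) b x * z x ^+ n.
pose D x y := \sum_(0 <= j < N + K) (z x * (z y)^*) ^+ j.
pose F j k := `|\sum_(x <- X) b x * z x ^+ j * (z x)^* ^+ k| ^+ 2.
set T := \sum_(x <- X) _.
have T0 : 0 <= T by apply: sumr_ge0 => x _; apply: exprn_ge0.
have zc x : z x * (z x)^* = 1 by rewrite -normCK z1 expr1n.
have TE : T = \sum_(0 <= n < N) a n * t n.
  rewrite /T (eq_bigr (fun x => \sum_(0 <= n < N) a n * z x ^+ n * b x)); last first.
    by move=> x _; rewrite normCK mulr_suml.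
  rewrite exchange_big /=; apply: eq_bigr => n _; rewrite mulr_sumr; apply: eq_bigr => x _.
  by rewrite -mulrA (mulrC (z x ^+ n)).
(* E counts every diagonal j - k = n with 0 <= n < N at least K times. *)
pose E := \sum_(0 <= k < N + K) \sum_(0 <= j < N + K) F j k.
have h1 : K%:R * \sum_(0 <= n < N) `|t n| ^+ 2 <= E.
  have F0 j k : 0 <= F j k by apply: exprn_ge0.
  rewrite /E [leRHS](big_cat_nat (n := K)) /= ?leq_addl //.
  apply: (@le_trans _ _ (\sum_(0 <= k < K) \sum_(0 <= j < N + K) F j k)); last first.
    by rewrite lerDl; apply: sumr_ge0 => k _; apply: sumr_ge0.
  rewrite -[X in X%:R * _]subn0 -mulr_natl -sumr_const_nat.
  rewrite mulr1 mulr_suml; apply: ler_sum_nat => k /andP[_ kK].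
  rewrite mul1r [leRHS](big_cat_nat (n := k)) //=; last by rewrite (leq_trans (ltnW kK)) // leq_addl.
  rewrite [X in _ <= _ + X](big_cat_nat (n := (N + k)%N)) ?leq_addl ?leq_add2l ?(ltnW kK) //=.
  have -> : \sum_(k <= i < N + k) F i k = \sum_(0 <= i < N) F (i + k)%N k.
    by rewrite -{1}[k]add0n big_addn addnK.
  apply: le_trans (_ : \sum_(0 <= i < N) F (i + k)%N k <= _); last first.
    by rewrite addrCA lerDl addr_ge0 //; apply: sumr_ge0.
  apply: ler_sum_nat => n _; rewrite /F /t.
  suff -> : \sum_(x <- X) b x * z x ^+ n = \sum_(x <- X) b x * z x ^+ (n + k) * (z x)^* ^+ k by [].
  by apply: eq_bigr => x _; rewrite exprD -!mulrA -exprMn zc expr1n mulr1.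
have h2 : E = \sum_(x <- X) \sum_(y <- X) b x * (b y)^* * `|D x y| ^+ 2.
  rewrite /E.
  transitivity (\sum_(0 <= k < N + K) \sum_(0 <= j < N + K) \sum_(x <- X) \sum_(y <- X)
      b x * (b y)^* * (z x * (z y)^*) ^+ j * ((z x)^* * z y) ^+ k).
    apply: eq_bigr => k _; apply: eq_bigr => j _; rewrite /F normCK rmorph_sum /= mulr_suml.
    apply: eq_bigr => x _; rewrite mulr_sumr; apply: eq_bigr => y _.
    rewrite !rmorphM /= !rmorphXn /= conjCK !exprMn; ring.
  under eq_bigr => k _ do rewrite exchange_big /=.
  rewrite exchange_big /=; apply: eq_bigr => x _.
  under eq_bigr => k _ do rewrite exchange_big /=.
  rewrite exchange_big /=; apply: eq_bigr => y _.
  rewrite normCK {1}/D rmorph_sum /= mulr_suml mulr_sumr exchange_big /=.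
  apply: eq_bigr => j _; rewrite mulr_sumr mulr_sumr; apply: eq_bigr => k _.
  by rewrite rmorphXn rmorphM /= conjCK mulrA.
have Dsym x y : `|D x y| = `|D y x|.
  rewrite -(norm_conjC (D x y)) /D rmorph_sum /=; congr `| _ |; apply: eq_bigr => j _.
  by rewrite rmorphXn rmorphM /= conjCK mulrC.
have h3 : E <= K%:R * B * T.
  have E0 : 0 <= E by apply: sumr_ge0 => k _; apply: sumr_ge0 => j _; apply: exprn_ge0.
  rewrite -(ger0_norm E0) h2.
  apply: (le_trans (ler_norm_sum _ _ _)).
  apply: (@le_trans _ _ (\sum_(x <- X) \sum_(y <- X)
       (`|b x| ^+ 2 / 2 * `|D x y| ^+ 2 + `|b y| ^+ 2 / 2 * `|D x y| ^+ 2))).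
    apply: ler_sum => x _; apply: (le_trans (ler_norm_sum _ _ _)).
    apply: ler_sum => y _; rewrite normrM normrM normrX normr_id (norm_conjC (b y)) -mulrDl.
    apply: ler_wpM2r; first exact: exprn_ge0.
    have := AGM2_weighted (normr_ge0 (b x)) (normr_ge0 (b y)) (ltr01 : 0 < 1 :> C).
    rewrite mul1r divr1 => h; rewrite -mulrDl ler_pdivlMr ?ltr0n // [leLHS]mulrC; exact: h.
  under eq_bigr => x _ do rewrite big_split /=.
  rewrite big_split /= [X in _ + X]exchange_big /=.
  have e2 : forall x, \sum_(y <- X) `|b x| ^+ 2 / 2 * `|D y x| ^+ 2 = \sum_(y <- X) `|b x| ^+ 2 / 2 * `|D x y| ^+ 2.
    by move=> x; apply: eq_bigr => y _; rewrite Dsym.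
  under [X in _ + X]eq_bigr => x _ do rewrite e2.
  rewrite -big_split /= /T mulr_sumr big_seq [leRHS]big_seq; apply: ler_sum => x xX.
  rewrite -mulr_sumr -mulrDl -splitr mulrC.
  have -> : `|b x| ^+ 2 = `|S x| ^+ 2 by rewrite norm_conjC.
  by apply: ler_wpM2r; [exact: exprn_ge0|exact: row].
have h4 : \sum_(0 <= n < N) `|t n| ^+ 2 <= B * T.
  by rewrite -(ler_pM2l K0) mulrA; exact: le_trans h1 h3.
have h5 : 2 * T <= 2 * B * \sum_(0 <= n < N) `|a n| ^+ 2 + T.
  rewrite -{1}(ger0_norm T0) TE.
  have B2 : 0 < 2 * B by rewrite mulr_gt0 ?ltr0n.
  apply: (@le_trans _ _ (\sum_(0 <= n < N) 2 * (`|a n| * `|t n|))).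
    rewrite -mulr_sumr ler_pM2l ?ltr0n //; apply: (le_trans (ler_norm_sum _ _ _)).
    by apply: ler_sum => n _; rewrite normrM.
  apply: (@le_trans _ _ (\sum_(0 <= n < N) (2 * B * `|a n| ^+ 2 + `|t n| ^+ 2 / (2 * B)))).
    by apply: ler_sum => n _; apply: AGM2_weighted.
  rewrite big_split /= -mulr_sumr lerD2l -mulr_suml -TE ler_pdivrMr //.
  apply: (le_trans h4); rewrite mulrC; apply: ler_wpM2l => //.
  by rewrite ler_peMl ?ler1n // ltW.
by move: h5; rewrite mulr2n mulrDl mul1r lerD2r.
Qed.

(** * Sums over roots of unity *)
Section RootsOfUnity.
Variable C : numClosedFieldType.
Implicit Types (z w : C) (n : nat).

Lemma geom_sum z n : (1 - z) * \sum_(0 <= k < n) z ^+ k = 1 - z ^+ n.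
Proof. by rewrite -[RHS]opprB subrX1 -mulNr opprB big_mkord. Qed.

Lemma geom_sum_norm z n : `|z| = 1 -> z != 1 ->
  `|\sum_(0 <= k < n) z ^+ k| ^+ 2 <= 4 * `|1 - z| ^- 2.
Proof.
move=> z1 zn1.
have h : 0 < `|1 - z| ^+ 2 by rewrite exprn_gt0 // normr_gt0 subr_eq0 eq_sym.
rewrite ler_pdivlMr // -exprMn mulrC -normrM geom_sum.
rewrite -[X in _ <= X](_ : 2 ^+ 2 = 4); last by rewrite -natrX.
rewrite lerXn2r ?nnegrE ?ler0n //.
by apply: (le_trans (ler_normB _ _)); rewrite normrX z1 expr1n normr1.
Qed.

Lemma prim_norm1 z n : n.-primitive_root z -> `|z| = 1.
Proof.
move=> hz; have n0 := prim_order_gt0 hz.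
apply/eqP; rewrite -(pexpr_eq1 n0) // -normrX.
by rewrite (prim_expr_order hz) normr1.
Qed.

Lemma norm1_mulC z : `|z| = 1 -> z * z^* = 1.
Proof. by move=> h; rewrite -normCK h expr1n. Qed.

Lemma prim_conj z n : n.-primitive_root z -> n.-primitive_root z^*.
Proof. by rewrite fmorph_primitive_root. Qed.

(** Orthogonality of the powers of a primitive n-th root of unity. *)
Lemma parseval z n (c : nat -> C) : n.-primitive_root z ->
  \sum_(0 <= a < n) `|\sum_(0 <= k < n) c k * z ^+ (a * k)| ^+ 2
    = n%:R * \sum_(0 <= k < n) `|c k| ^+ 2.
Proof.
move=> hz; have zz := norm1_mulC (prim_norm1 hz).
transitivity (\sum_(0 <= a < n) \sum_(0 <= k < n) \sum_(0 <= l < n)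
     c k * (c l)^* * (z ^+ k * (z^*) ^+ l) ^+ a).
  apply: eq_bigr => a _; rewrite normCK rmorph_sum /= mulr_suml; apply: eq_bigr => k _.
  rewrite mulr_sumr; apply: eq_bigr => l _; rewrite !rmorphM /= !rmorphXn /=.
  by rewrite exprMn -!exprM (mulnC k) (mulnC l) mulrACA.
rewrite exchange_big /= mulr_sumr; apply: eq_big_nat => k /andP[_ kn].
rewrite exchange_big /= (bigD1_seq k) ?iota_uniq ?mem_index_iota //=.
rewrite [X in _ + X]big1_seq ?addr0.
  rewrite -mulr_sumr -exprMn zz expr1n -normCK mulrC; congr (_ * _).
  under eq_bigr do rewrite expr1n.
  by rewrite sumr_const_nat subn0.
move=> l /andP[lk]; rewrite mem_index_iota => /andP[_ ln].
rewrite -mulr_sumr; set u := z ^+ k * _.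
have un1 : u != 1.
  apply: contra_neq lk => h.
  have /eqP : z ^+ k = z ^+ l.
    by rewrite -[LHS]mulr1 -(expr1n _ l) -zz exprMn mulrCA -/u h mulr1.
  by rewrite (eq_prim_root_expr hz) !modn_small // => /eqP.
have : (1 - u) * \sum_(0 <= a < n) u ^+ a = 0.
  rewrite geom_sum /u exprMn -!exprM (mulnC k) (mulnC l) !exprM.
  by rewrite (prim_expr_order hz) (prim_expr_order (prim_conj hz)) !expr1n mulr1 subrr.
by move/eqP; rewrite mulf_eq0 subr_eq0 eq_sym (negPf un1) /= => /eqP ->; rewrite mulr0.
Qed.

(** Parseval for the coefficients c k = k: the transform at a nonzero frequency
    is - n / (1 - z^h), so the sum of |1 - z^h|^-2 is read off algebraically,
    without any estimate of trigonometric functions. *)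
Lemma sum_inv_prim z n : n.-primitive_root z ->
  \sum_(1 <= h < n) `|1 - z ^+ h| ^- 2 <= n%:R ^+ 2.
Proof.
move=> hz; have n0 := prim_order_gt0 hz.
have nR : 0 < (n%:R : C) by rewrite ltr0n.
have := parseval (fun k => k%:R) hz.
rewrite big_ltn // => h.
have key a : (0 < a < n)%N ->
    `|\sum_(0 <= k < n) (k%:R : C) * z ^+ (a * k)| ^+ 2 = n%:R ^+ 2 * `|1 - z ^+ a| ^- 2.
  move=> /andP[a0 an].
  have zn : z ^+ a != 1.
    by rewrite -(prim_order_dvd hz) gtnNdvd.
  set u := z ^+ a in zn *.
  have un : u ^+ n = 1 by rewrite /u exprAC (prim_expr_order hz) expr1n.
  have e : (1 - u) * \sum_(0 <= k < n) (k%:R : C) * u ^+ k = - n%:R.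
    have gen m : (1 - u) * \sum_(0 <= k < m) (k%:R : C) * u ^+ k
       = \sum_(0 <= k < m) u ^+ k - 1 - (m%:R - 1) * u ^+ m.
      elim: m => [|m IH]; first by rewrite !big_geq // mulr0 expr0; ring.
      rewrite !big_nat_recr //= mulrDr IH exprS -natr1; ring.
    rewrite gen un mulr1.
    have : (1 - u) * \sum_(0 <= k < n) u ^+ k = 0 by rewrite geom_sum un subrr.
    move/eqP; rewrite mulf_eq0 subr_eq0 eq_sym (negPf zn) /= => /eqP ->; ring.
  under eq_bigr => k _ do rewrite exprM.
  have un1 : 1 - u != 0 by rewrite subr_eq0 eq_sym.
  have -> : \sum_(0 <= k < n) (k%:R : C) * u ^+ k = - n%:R / (1 - u).
    by rewrite -e mulrAC mulfV // mul1r.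
  rewrite normrM normrN normfV normr_nat exprMn exprVn //.
move: h; rewrite (@eq_big_nat _ _ _ 1 n _ _ key) -mulr_sumr => h.
have : n%:R ^+ 2 * \sum_(1 <= i < n) `|1 - z ^+ i| ^- 2 <= n%:R ^+ 2 * n%:R ^+ 2.
  apply: (@le_trans _ _ (n%:R * \sum_(0 <= k < n) `|(k%:R : C)| ^+ 2)).
    by rewrite -h lerDr exprn_ge0.
  rewrite [in leRHS]expr2 -mulrA; apply: ler_wpM2l; first exact: ltW.
  apply: (@le_trans _ _ (\sum_(0 <= k < n) n%:R ^+ 2)); last first.
    by rewrite sumr_const_nat subn0 -[leLHS]mulr_natl expr2.
  apply: ler_sum_nat => k /andP[_ kn]; rewrite normr_nat lerXn2r ?nnegrE ?ler0n //.
  by rewrite ler_nat ltnW.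
by rewrite ler_pM2l // exprn_gt0.
Qed.

(** Parseval for the coefficients c k = w^k.  It carries a sum over the
    fractions with denominator n to a single fraction with another denominator. *)
Lemma sum_inv_shift z w n : n.-primitive_root z -> `|w| = 1 -> w ^+ n != 1 ->
  \sum_(0 <= a < n) `|1 - w * z ^+ a| ^- 2 = n%:R ^+ 2 * `|1 - w ^+ n| ^- 2.
Proof.
move=> hz w1 wn.
have wn1 : 1 - w ^+ n != 0 by rewrite subr_eq0 eq_sym.
have := parseval (fun k => w ^+ k) hz.
have -> : \sum_(0 <= k < n) `|w ^+ k| ^+ 2 = n%:R.
  under eq_bigr do rewrite normrX w1 !expr1n.
  by rewrite sumr_const_nat subn0.
rewrite -expr2 => <-; rewrite mulr_suml; apply: eq_bigr => a _.
set u := w * z ^+ a.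
have un : u ^+ n = w ^+ n.
  by rewrite /u exprMn -exprM mulnC exprM (prim_expr_order hz) expr1n mulr1.
have un1 : 1 - u != 0.
  by rewrite subr_eq0 eq_sym; apply: contra_neq wn => e; rewrite -un e expr1n.
have -> : \sum_(0 <= k < n) w ^+ k * z ^+ (a * k) = \sum_(0 <= k < n) u ^+ k.
  by apply: eq_bigr => k _; rewrite /u exprMn exprM.
have := geom_sum u n; rewrite un => e.
rewrite -e normrM exprMn [in RHS]invfM [RHS]mulrCA mulfV ?mulr1 //.
rewrite expf_neq0 // normr_eq0; apply: contra_neq wn1 => h.
by rewrite -e h mulr0.
Qed.

End RootsOfUnity.

(** * The large sieve for prime moduli *)
Lemma sum_by_class (V : nmodType) (T : Type) (s : seq T) (c : T -> nat) (l : nat) (F : T -> V) :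
  (forall n, c n < l)%N ->
  \sum_(n <- s) F n = \sum_(0 <= h < l) \sum_(n <- s | c n == h) F n.
Proof.
move=> cl; rewrite (exchange_big_dep xpredT) //=; apply: eq_bigr => n _.
rewrite -big_filter (eq_filter (a2 := pred1 (c n))); last by move=> h; rewrite /= eq_sym.
by rewrite filter_pred1_uniq ?iota_uniq ?mem_index_iota ?cl //= big_seq1.
Qed.

Definition zeta (l : nat) : algC := sval (C_prim_root_exists (ltn0Sn l.-1)).

Lemma zetaP l : (0 < l)%N -> l.-primitive_root (zeta l).
Proof. by case: l => // l _; rewrite /zeta; case: C_prim_root_exists. Qed.

(** Parseval turns the mean square of the class counts into exponential sums at
    the fractions a / l; the frequency 0 gives (size s)^2. *)
Lemma sum_sqr_class_count (s : seq nat) (N l : nat) :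
  uniq s -> all (fun n => n < N)%N s -> (0 < l)%N ->
  (size s)%:R ^+ 2 + \sum_(1 <= a < l) `|\sum_(0 <= n < N) (n \in s)%:R * (zeta l ^+ a) ^+ n| ^+ 2
   = l%:R * \sum_(0 <= h < l) (count (fun n => n %% l == h)%N s)%:R ^+ 2 :> algC.
Proof.
move=> us sN l0; have hz := zetaP l0.
have e1 a : \sum_(0 <= n < N) (n \in s)%:R * (zeta l ^+ a) ^+ n = \sum_(n <- s) (zeta l ^+ a) ^+ n.
  rewrite (eq_bigr (fun n => if n \in s then (zeta l ^+ a) ^+ n else 0)); last first.
    by move=> n _; case: ifP; rewrite ?mul1r ?mul0r.
  rewrite -big_mkcond -big_filter; apply: perm_big; apply: uniq_perm => //.
    exact/filter_uniq/iota_uniq.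
  move=> n; rewrite mem_filter mem_index_iota /=; case: (boolP (n \in s)) => //= h.
  exact: (allP sN).
have e a : \sum_(n <- s) (zeta l ^+ a) ^+ n =
   \sum_(0 <= h < l) (count (fun n => n %% l == h)%N s)%:R * zeta l ^+ (a * h).
  rewrite (@sum_by_class _ _ _ (modn^~ l) l); last by move=> n; rewrite ltn_mod.
  apply: eq_bigr => h _.
  rewrite (eq_bigr (fun=> zeta l ^+ (a * h))); last first.
    move=> n /eqP <-; rewrite -exprM; apply/eqP.
    by rewrite (eq_prim_root_expr hz) modnMmr.
  by rewrite big_const_seq iter_addr_0 mulr_natl.
under eq_bigr => a _ do rewrite e1 e.
have := parseval (fun h => (count (fun n => n %% l == h)%N s)%:R) hz.
rewrite [in X in X = _ -> _](big_ltn l0).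
have -> : \sum_(0 <= k < l) (count (fun n => n %% l == k)%N s)%:R * zeta l ^+ (0 * k) = (size s)%:R.
  rewrite -e expr0; under eq_bigr do rewrite expr1n.
  by rewrite big_const_seq count_predT iter_addr_0.
rewrite normr_nat => ->.
by under eq_bigr do rewrite normr_nat.
Qed.

(** The rows of the dual form are sums of |1 - e (a / l - a' / l')|^-2.  For
    l' = l they are bounded by [sum_inv_prim].  For l' <> l the sum over a' is
    given by [sum_inv_shift] and depends only on a l' modulo l, and distinct l' in
    (Q, 2 Q] give distinct nonzero residues, so that [sum_inv_prim] applies once
    more.  This exploits that the moduli are primes of the same size. *)
Lemma large_sieve (Q N : nat) (Lp s : seq nat) :
  (0 < Q)%N -> (0 < N)%N -> uniq Lp -> all (fun l => prime l && (Q < l <= 2 * Q))%N Lp ->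
  uniq s -> all (fun n => n < N)%N s ->
  (\sum_(l <- Lp) l * \sum_(0 <= h < l) (count (fun n => n %% l == h) s) ^ 2
    <= \sum_(l <- Lp) (size s) ^ 2 + (8 * N + 168 * Q ^ 2) * size s)%N.
Proof.
move=> Q0 N0 uL hL us sN.
have Lprime l : l \in Lp -> prime l by move/(allP hL)/andP => [].
have LQ l : l \in Lp -> (Q < l <= 2 * Q)%N by move/(allP hL)/andP => [].
have Lgt0 l : l \in Lp -> (0 < l)%N by move/Lprime/prime_gt0.
pose X := [seq (l, a) | l <- Lp, a <- index_iota 1 l].
pose z (x : nat * nat) : algC := zeta x.1 ^+ x.2.
have zn l : `|zeta l| = 1.
  by have := zetaP (ltn0Sn l.-1); rewrite /zeta => /prim_norm1.
have z1 x : `|z x| = 1 by rewrite /z normrX zn expr1n.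
pose K := (N + Q ^ 2)%N.
pose B : algC := (4 * N + 84 * Q ^ 2)%:R.
have B0 : 0 < B by rewrite ltr0n; lia.
have NK : (0 < N <= K)%N by rewrite N0 leq_addr.
have row x : x \in X ->
     \sum_(y <- X) `|\sum_(0 <= j < N + K) (z x * (z y)^*) ^+ j| ^+ 2 <= K%:R * B.
  case: x => l a /allpairsPdep[l' [a' [lL]]]; rewrite mem_index_iota => a1l [? ?]; subst l' a'.
  have l0 := Lgt0 _ lL; have hz := zetaP l0.
  have LQl := LQ _ lL.
  pose D y := `|\sum_(0 <= j < N + K) (z (l, a) * (z y)^*) ^+ j| ^+ 2.
  have Dle y : z (l, a) * (z y)^* != 1 -> D y <= 4 * `|1 - z (l, a) * (z y)^*| ^- 2.
    by move=> h; apply: geom_sum_norm => //; rewrite normrM norm_conjC !z1 mulr1.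
  have lR : 0 < (l%:R : algC) by rewrite ltr0n.
  have S0 : \sum_(1 <= h < l) `|1 - zeta l ^+ h| ^- 2 <= (2 * Q)%:R ^+ 2.
    apply: (le_trans (sum_inv_prim hz)); rewrite lerXn2r ?nnegrE ?ler0n // ler_nat; clear -LQl; lia.
  have inv0 (u : algC) : 0 <= `|u| ^- 2 by rewrite invr_ge0 exprn_ge0.
  have diag : \sum_(a' <- index_iota 1 l) D (l, a') <= (N + K)%:R ^+ 2 + 4 * (2 * Q)%:R ^+ 2.
    rewrite (bigD1_seq a) ?iota_uniq ?mem_index_iota //=; apply: lerD.
      rewrite /D lerXn2r ?nnegrE ?ler0n //; apply: (le_trans (ler_norm_sum _ _ _)).
      apply: (@le_trans _ _ (\sum_(0 <= j < N + K) 1)); last first.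
        by rewrite sumr_const_nat subn0.
      by apply: ler_sum => j _; rewrite normrX normrM norm_conjC !z1 mulr1 expr1n.
    apply: le_trans (_ : 4 * \sum_(1 <= h < l) `|1 - zeta l ^+ h| ^- 2 <= _); last first.
      by rewrite ler_pM2l ?ltr0n.
    (* the exponent of zeta l in the product of z (l, a) and the conjugate of z (l, a') *)
    pose f a' := ((a + (l - a')) %% l)%N.
    have fE a' : (a' < l)%N -> z (l, a) * (z (l, a'))^* = zeta l ^+ f a'.
      move=> a'l; rewrite /f (prim_expr_mod hz) exprD /z /=; congr (_ * _).
      have : zeta l ^+ a' * zeta l ^+ (l - a') = zeta l ^+ a' * (zeta l ^+ a')^*.
        by rewrite -exprD subnKC ?(ltnW a'l) // (prim_expr_order hz) norm1_mulC // normrX zn expr1n.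
      by move/mulfI => <- //; rewrite -normr_eq0 normrX zn expr1n oner_neq0.
    have fP a' : (1 <= a' < l)%N -> a' != a -> (1 <= f a' < l)%N.
      move=> h ne; rewrite /f ltn_mod l0 andbT lt0n; apply/negP => /eqP.
      by move/eqP; rewrite -/(dvdn _ _) => /dvdnP[k hk]; case: k hk => [|[|k]] hk; clear -h hk ne a1l; lia.
    rewrite -big_filter mulr_sumr.
    set s' := filter _ _.
    have s'P a' : a' \in s' -> (1 <= a' < l)%N && (a' != a).
      by rewrite mem_filter mem_index_iota andbC.
    apply: (@le_trans _ _ (\sum_(h <- map f s') 4 * `|1 - zeta l ^+ h| ^- 2)).
      rewrite big_map big_seq [leRHS]big_seq; apply: ler_sum => a' /s'P /andP[h1 h2].
      have a'l : (a' < l)%N by case/andP: h1.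
      have := Dle (l, a'); rewrite (fE _ a'l); apply.
      by rewrite -(prim_order_dvd hz) gtnNdvd //; case/andP: (fP _ h1 h2).
    apply: ler_sum_sub.
    - rewrite map_inj_in_uniq ?filter_uniq ?iota_uniq // => b b' /s'P /andP[h1 h2] /s'P /andP[h3 h4].
      rewrite /f => /eqP; rewrite eqn_modDl => /eqP; rewrite !modn_small; clear -h1 h3; lia.
    - by move=> h /mapP[a' /s'P /andP[h1 h2] ->]; rewrite mem_index_iota; exact: fP.
    - by move=> h _; rewrite mulr_ge0 ?ler0n.
  have off l' : l' \in Lp -> l' != l ->
      \sum_(a' <- index_iota 1 l') D (l', a') <= (16 * Q ^ 2)%:R * `|1 - zeta l ^+ (a * l' %% l)| ^- 2.
    move=> l'L ne; have l'0 := Lgt0 _ l'L; have hz' := zetaP l'0.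
    have wl : (zeta l ^+ a) ^+ l' != 1.
      rewrite -exprM -(prim_order_dvd hz) Euclid_dvdM ?Lprime // negb_or gtnNdvd //; last by case/andP: a1l.
      - by rewrite dvdn_prime2 ?Lprime // eq_sym.
      - by case/andP: a1l.
    have hs := sum_inv_shift (prim_conj hz') (z1 (l, a)) wl.
    apply: (@le_trans _ _ (\sum_(0 <= a' < l') 4 * `|1 - z (l, a) * (zeta l')^* ^+ a'| ^- 2)).
      rewrite [leRHS]big_ltn // -[leLHS]add0r; apply: lerD; first by rewrite mulr_ge0 ?ler0n.
      apply: ler_sum_nat => a' h; have := Dle (l', a'); rewrite /z /= rmorphXn; apply.
      apply: contraNneq wl => /(congr1 (fun u => u ^+ l')).
      rewrite expr1n exprMn -[(_ ^+ a') ^+ l']exprM mulnC exprM.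
      by rewrite (prim_expr_order (prim_conj hz')) expr1n mulr1 => ->.
    rewrite -mulr_sumr hs /z /= -exprM (prim_expr_mod hz).
    rewrite mulrA; apply: ler_wpM2r => //.
    rewrite -natrX -natrM ler_nat (_ : 16 * Q ^ 2 = 4 * (2 * Q) ^ 2)%N; last by rewrite expnMn mulnA.
    by rewrite leq_mul2l leq_exp2r //; case/andP: (LQ _ l'L).
  rewrite big_allpairs_dep /= (bigD1_seq l) //=.
  apply: (@le_trans _ _ ((N + K)%:R ^+ 2 + 4 * (2 * Q)%:R ^+ 2 + (16 * Q ^ 2)%:R * (2 * Q)%:R ^+ 2)); last first.
    by rewrite /B /K -!natrX -!natrM -!natrD ler_nat; clear; nia.
  apply: lerD; first exact: diag.
  apply: (@le_trans _ _ (\sum_(l' <- Lp | l' != l) (16 * Q ^ 2)%:R * `|1 - zeta l ^+ (a * l' %% l)| ^- 2)).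
    rewrite big_seq_cond [leRHS]big_seq_cond; apply: ler_sum => l' /andP[h1 h2]; exact: off.
  rewrite -mulr_sumr; apply: ler_wpM2l; first exact: ler0n.
  apply: le_trans S0; rewrite -big_filter; set s' := filter _ _.
  have s'P l' : l' \in s' -> (l' != l) && (l' \in Lp) by rewrite mem_filter.
  rewrite -(big_map (fun l' => a * l' %% l)%N xpredT (fun h => `|1 - zeta l ^+ h| ^- 2)).
  have cop : coprime l a by rewrite prime_coprime ?Lprime // gtnNdvd //; case/andP: a1l.
  apply: ler_sum_sub => //.
  - rewrite map_inj_in_uniq ?filter_uniq // => b b' /s'P /andP[h1 /LQ h2] /s'P /andP[h3 /LQ h4].
    move/eqP.
    wlog bb' : b b' h1 h2 h3 h4 / (b <= b')%N.
      move=> W h; case: (leqP b b') => [|/ltnW] hb; first exact: W.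
      by apply/esym; apply: W => //; rewrite eq_sym.
    rewrite eq_sym eqn_mod_dvd ?leq_mul2l ?bb' ?orbT // -mulnBr Gauss_dvdr //.
    case: (posnP (b' - b)%N) => [h0 _|h]; first by clear -bb' h0; lia.
    by move/(dvdn_leq h); clear -LQl h2 h4; lia.
  - move=> h /mapP[l' /s'P /andP[h1 h2] ->]; rewrite mem_index_iota ltn_mod l0 andbT lt0n.
    by rewrite -/(dvdn _ _) Gauss_dvdr // dvdn_prime2 ?Lprime // eq_sym.
have main := dual_sieve (fun n => (n \in s)%:R) z1 NK B0 row.
have sz : \sum_(0 <= n < N) `|((n \in s)%:R : algC)| ^+ 2 = (size s)%:R.
  under eq_bigr => n _ do rewrite normr_nat -natrX.
  rewrite -natr_sum -sum1_size; congr _%:R.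
  rewrite (eq_bigr (fun n => if n \in s then 1%N else 0%N)); last by move=> n _; case: (n \in s).
  rewrite -big_mkcond -big_filter; apply: perm_big; apply: uniq_perm => //.
    exact/filter_uniq/iota_uniq.
  move=> n; rewrite mem_filter mem_index_iota /=; case: (boolP (n \in s)) => //= h.
  exact: (allP sN).
rewrite sz big_allpairs_dep /= in main.
rewrite -(ler_nat algC) natrD natrM !natr_sum.
apply: (@le_trans _ _ (\sum_(l <- Lp) ((size s)%:R ^+ 2 +
   \sum_(1 <= a < l) `|\sum_(0 <= n < N) (n \in s)%:R * (zeta l ^+ a) ^+ n| ^+ 2))).
  rewrite big_seq [leRHS]big_seq; apply: ler_sum => l /Lgt0 l0.
  rewrite sum_sqr_class_count // natrM natr_sum.
  by under eq_bigr do rewrite natrX.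
rewrite big_split /=; apply: lerD.
  by apply: ler_sum => l _; rewrite natrX.
apply: (le_trans main); rewrite /B -!natrM ler_nat leq_mul2r; apply/orP; right; clear; lia.
Qed.

(** * Discrepancy of products in the residue class 1 *)
(** Recovers Cauchy-Schwarz from the family of weighted inequalities. *)
Lemma sqr_le_of_AGM (R : realFieldType) (X A B : R) : 0 <= X -> 0 <= A -> 0 <= B ->
  (forall t, 0 < t -> 2 * X <= t * A + B / t) -> X ^+ 2 <= A * B.
Proof.
move=> X0 A0 B0 h.
have [->|Xn] := eqVneq X 0; first by rewrite expr0n mulr_ge0.
have Xp : 0 < X by rewrite lt0r Xn.
have [Az|An] := eqVneq A 0.
  have t0 : 0 < (B + 1) / X by rewrite divr_gt0 //; lra.
  have := h _ t0; rewrite Az mulr0 add0r invf_div mulrA => h1.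
  have : B * X / (B + 1) <= X by rewrite ler_pdivrMr; nra.
  lra.
have Ap : 0 < A by rewrite lt0r An.
have := h (X / A) (divr_gt0 Xp Ap).
have -> : X / A * A = X by rewrite divfK.
rewrite invf_div mulrA -lerBlDl => h1.
have : X <= B * A / X by lra.
by rewrite ler_pdivlMr // expr2 mulrC (mulrC A).
Qed.

(** The inverse modulo a prime l, by Fermat's theorem. *)
Definition modinv (l g : nat) := (g ^ l.-2 %% l)%N.

Lemma modinvP l g : prime l -> ~~ (l %| g)%N -> (g * modinv l g = 1 %[mod l])%N.
Proof.
move=> pl lg; have l1 := prime_gt1 pl.
rewrite /modinv modnMmr -expnS prednK; last by lia.
by rewrite -totient_prime // Euler_exp_totient // coprime_sym prime_coprime.
Qed.

Lemma mod_eq_modinv l g m : prime l -> ~~ (l %| g)%N ->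
  ((g * m) %% l == 1)%N = (m %% l == modinv l g)%N.
Proof.
move=> pl lg; have l1 := prime_gt1 pl.
have e := modinvP pl lg.
have e1 : (1 %% l = 1)%N by rewrite modn_small.
apply/eqP/eqP => h.
  rewrite -[RHS]modn_mod -[m in LHS]muln1.
  have -> : (m * 1 = m * (g * modinv l g) %[mod l])%N by rewrite -modnMmr -e modnMmr.
  by rewrite mulnA (mulnC m) -modnMml h mul1n.
by rewrite -modnMmr h e e1.
Qed.

Lemma modinv_bound l g : prime l -> (0 < g < l)%N -> (0 < modinv l g < l)%N.
Proof.
move=> pl /andP[g0 gl]; have l0 := prime_gt0 pl.
rewrite ltn_mod l0 andbT lt0n; apply/negP => /eqP h.
have := modinvP pl (negbT (gtnNdvd g0 gl)).
by rewrite h muln0 mod0n modn_small // prime_gt1.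
Qed.

Lemma modinv_inj l : prime l -> {in [pred g | 0 < g < l]%N &, injective (modinv l)}.
Proof.
move=> pl g g' /andP[g0 gl] /andP[g0' gl'] h.
have e := modinvP pl (negbT (gtnNdvd g0 gl)).
have e' := modinvP pl (negbT (gtnNdvd g0' gl')).
rewrite -(modn_small gl) -(modn_small gl') -[g]muln1 -[g']muln1.
by rewrite -[in LHS]modnMmr -e' modnMmr -[in RHS]modnMmr -e modnMmr h mulnCA.
Qed.

Lemma perm_modinv l : prime l -> perm_eq (map (modinv l) (index_iota 1 l)) (index_iota 1 l).
Proof.
move=> pl.
have u : uniq (map (modinv l) (index_iota 1 l)).
  rewrite map_inj_in_uniq ?iota_uniq // => a b; rewrite !mem_index_iota.
  exact: modinv_inj.
have sub : {subset map (modinv l) (index_iota 1 l) <= index_iota 1 l}.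
  by move=> h /mapP[g]; rewrite !mem_index_iota => /(modinv_bound pl) hg ->.
have := uniq_min_size u sub; rewrite size_map leqnn => /(_ isT)[_ e].
by apply: uniq_perm => //; apply: iota_uniq.
Qed.

Section Discrepancy.
Variable R : realFieldType.

(** The indicator of the class 1 modulo l, minus its expected share among the
    integers prime to l. *)
Definition local_disc (l n : nat) : R := (n %% l == 1)%N%:R - (~~ (l %| n)%N)%:R / (l.-1)%:R.

Definition class_count (l h : nat) (s : seq nat) : nat := count (fun n => n %% l == h)%N s.

(** The variance of s over all classes modulo l, including the class 0. *)
Definition class_var (l : nat) (s : seq nat) : R :=
  \sum_(0 <= h < l) ((class_count l h s)%:R - (size s)%:R / l%:R) ^+ 2.

Lemma sum_class_count l s : (0 < l)%N -> \sum_(0 <= h < l) (class_count l h s)%:R = (size s)%:R :> R.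
Proof.
move=> l0; rewrite -sum1_size natr_sum [RHS](@sum_by_class _ _ _ (modn^~ l) l); last by move=> n; rewrite ltn_mod.
by apply: eq_bigr => h _; rewrite big_const_seq iter_addr_0.
Qed.

Lemma sum_by_count l (s : seq nat) (F : nat -> R) : (0 < l)%N ->
  \sum_(n <- s) F (n %% l)%N = \sum_(0 <= h < l) (class_count l h s)%:R * F h.
Proof.
move=> l0; rewrite (@sum_by_class _ _ _ (modn^~ l) l); last by move=> n; rewrite ltn_mod.
apply: eq_bigr => h _; rewrite (eq_bigr (fun=> F h)); last by move=> n /eqP ->.
by rewrite big_const_seq iter_addr_0 mulr_natl.
Qed.

Lemma class_varE l s : (0 < l)%N ->
  l%:R * class_var l s = l%:R * \sum_(0 <= h < l) (class_count l h s)%:R ^+ 2 - (size s)%:R ^+ 2.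
Proof.
move=> l0; have lR : (l%:R : R) != 0 by rewrite pnatr_eq0 -lt0n.
rewrite /class_var.
under eq_bigr => h _ do rewrite sqrrB.
rewrite big_split sumrB /= sumr_const_nat subn0 -mulr_natr.
under [X in _ - X]eq_bigr => h _ do rewrite -mulrnAr.
rewrite -mulr_suml sum_class_count //; field => //.
Qed.

(** p m = 1 modulo l means that m is in the class inverse to that of p.  Summed over
    p and m, the discrepancy is therefore the scalar product of the centred class
    counts of P with the centred class counts of M permuted by inversion. *)
Lemma bilinear_disc (l : nat) (P M : seq nat) (t : R) : prime l -> 0 < t ->
  2 * `|\sum_(p <- P) \sum_(m <- M) local_disc l (p * m)| <= t * class_var l P + class_var l M / t.
Proof.
move=> pl t0; have l0 := prime_gt0 pl; have l1 := prime_gt1 pl.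
have lR : 0 < (l.-1%:R : R) by rewrite ltr0n; lia.
have lR' : 0 < (l%:R : R) by rewrite ltr0n.
pose x g : R := (class_count l g P)%:R - (size P)%:R / l%:R.
pose Ms : R := (count (fun m => ~~ (l %| m)%N) M)%:R.
pose y g : R := (class_count l g M)%:R - Ms / l.-1%:R.
have MsE : Ms = \sum_(1 <= h < l) (class_count l h M)%:R.
  rewrite /Ms -sum1_count natr_sum big_mkcond /=.
  rewrite (eq_bigr (fun m => (fun h => (h != 0%N)%:R) (m %% l)%N)); last first.
    by move=> m _ /=; rewrite -/(dvdn l m); case: (l %| m)%N.
  rewrite (sum_by_count M (fun h => (h != 0%N)%:R) l0) (big_ltn l0) /= mulr0n mulr0 add0r; apply: eq_big_nat => h /andP[h0 _].
  by rewrite -lt0n h0 mulr1.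
have y0 : \sum_(1 <= h < l) y h = 0.
  rewrite sumrB -MsE sumr_const_nat -[X in _ - X]mulr_natr subn1 divfK ?subrr //.
  by rewrite gt_eqF.
have E : \sum_(p <- P) \sum_(m <- M) local_disc l (p * m) =
    \sum_(1 <= g < l) x g * y (modinv l g).
  transitivity (\sum_(1 <= g < l) (class_count l g P)%:R * y (modinv l g)).
    rewrite (eq_bigr (fun p => (fun h => if h == 0%N then 0 else y (modinv l h)) (p %% l)%N)).
      rewrite (sum_by_count P (fun h => if h == 0%N then 0 else y (modinv l h)) l0) big_ltn //= mulr0 add0r; apply: eq_big_nat => g /andP[g0 _].
      by rewrite gtn_eqF.
    move=> p _; have [lp|lp] /= := boolP (l %| p)%N.
      rewrite -/(dvdn l p) lp big1 // => m _; rewrite /local_disc dvdn_mulr // mul0r subr0.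
      by move: (dvdn_mulr m lp); rewrite /dvdn => /eqP ->.
    rewrite -/(dvdn l p) (negPf lp).
    have lp' : ~~ (l %| p %% l)%N by rewrite /dvdn modn_mod.
    rewrite /y /Ms /class_count -!sum1_count !natr_sum mulr_suml [X in _ = X - _]big_mkcond [X in _ = _ - X]big_mkcond /= -sumrB.
    apply: eq_bigr => m _; rewrite /local_disc -(mod_eq_modinv _ pl lp') modnMml Euclid_dvdM // (negPf lp) /=.
    by case: (_ == _); case: (l %| m)%N => /=; rewrite ?mul0r ?mul1r ?subr0 ?sub0r.
  have h : \sum_(1 <= g < l) y (modinv l g) = 0.
    by rewrite -(big_map (modinv l) xpredT y) (perm_big _ (perm_modinv pl)) /=.
  rewrite /x; under [RHS]eq_bigr => g _ do rewrite mulrBl.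
  by rewrite sumrB -mulr_sumr h mulr0 subr0.
have hx : \sum_(1 <= g < l) x g ^+ 2 <= class_var l P.
  by rewrite /class_var [leRHS]big_ltn // lerDr sqr_ge0.
have hy : \sum_(1 <= g < l) y (modinv l g) ^+ 2 <= class_var l M.
  rewrite -(big_map (modinv l) xpredT (fun g => y g ^+ 2)) (perm_big _ (perm_modinv pl)) /=.
  pose b := (size M)%:R / l%:R - Ms / l.-1%:R : R.
  apply: (@le_trans _ _ (\sum_(1 <= h < l) ((class_count l h M)%:R - (size M)%:R / l%:R) ^+ 2)); last first.
    by rewrite /class_var [leRHS]big_ltn // lerDr sqr_ge0.
  have e h : ((class_count l h M)%:R - (size M)%:R / l%:R) ^+ 2 = y h ^+ 2 - 2 * b * y h + b ^+ 2.
    by rewrite /y /b; ring.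
  under [leRHS]eq_bigr => h _ do rewrite e.
  rewrite big_split sumrB /= -mulr_sumr y0 mulr0 subr0 lerDl.
  by apply: sumr_ge0 => h _; exact: sqr_ge0.
rewrite E.
apply: (@le_trans _ _ (\sum_(1 <= g < l) (t * x g ^+ 2 + y (modinv l g) ^+ 2 / t))).
  apply: (@le_trans _ _ (2 * \sum_(1 <= g < l) `|x g * y (modinv l g)|)).
    by rewrite ler_pM2l ?ltr0n // ler_norm_sum.
  rewrite mulr_sumr; apply: ler_sum => g _.
  have := AGM2_weighted (normr_ge0 (x g)) (normr_ge0 (y (modinv l g))) t0.
  by rewrite normrM !real_normK ?num_real.
rewrite big_split /= -mulr_sumr -mulr_suml; apply: lerD.
  by rewrite ler_pM2l.
by rewrite ler_pM2r // invr_gt0.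
Qed.

Lemma sum_class_var (Q N : nat) (Lp s : seq nat) :
  (0 < Q)%N -> (0 < N)%N -> uniq Lp -> all (fun l => prime l && (Q < l <= 2 * Q))%N Lp ->
  uniq s -> all (fun n => n < N)%N s ->
  Q%:R * \sum_(l <- Lp) class_var l s <= (8 * N + 168 * Q ^ 2)%:R * (size s)%:R.
Proof.
move=> Q0 N0 uL hL us sN.
have := large_sieve Q0 N0 uL hL us sN.
rewrite -(ler_nat R) natrD natrM !natr_sum => h.
apply: (@le_trans _ _ (\sum_(l <- Lp) l%:R * class_var l s)).
  rewrite mulr_sumr big_seq [leRHS]big_seq; apply: ler_sum => l /(allP hL)/andP[_ /andP[h1 _]].
  apply: ler_wpM2r; first by apply: sumr_ge0 => g _; apply: sqr_ge0.
  by rewrite ler_nat ltnW.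
rewrite (eq_big_seq (fun l => l%:R * \sum_(0 <= h < l) (class_count l h s)%:R ^+ 2 - (size s)%:R ^+ 2)); last first.
  by move=> l /(allP hL)/andP[/prime_gt0 l0 _]; exact: class_varE.
rewrite sumrB lerBlDl; apply: le_trans (_ : _ <= \sum_(l <- Lp) (size s)%:R ^+ 2 + _) => //.
have -> : \sum_(i <- Lp) (i%:R : R) * \sum_(0 <= h < i) (class_count i h s)%:R ^+ 2 =
  \sum_(i <- Lp) (i * \sum_(0 <= h < i) count (fun n : nat => (n %% i)%N == h) s ^ 2)%:R.
  by apply: eq_bigr => l _; rewrite natrM natr_sum; under [in RHS]eq_bigr do rewrite natrX.
by under [X in _ <= X + _]eq_bigr do rewrite -natrX.
Qed.

(** The large sieve bounds both variances on average over l, whatever P and M are;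
    this gain over the trivial bound is what products offer and single
    intervals do not. *)
Lemma bilinear_dyadic (Q NP NM : nat) (Lp P M : seq nat) (lg : nat -> R) (B : R) :
  (0 < Q)%N -> (0 < NP)%N -> (0 < NM)%N ->
  uniq Lp -> all (fun l => prime l && (Q < l <= 2 * Q))%N Lp ->
  uniq P -> all (fun n => n < NP)%N P -> uniq M -> all (fun n => n < NM)%N M ->
  0 <= B -> (forall l, l \in Lp -> 0 <= lg l <= B) ->
  (\sum_(l <- Lp) lg l * \sum_(p <- P) \sum_(m <- M) local_disc l (p * m)) ^+ 2 <=
  B ^+ 2 * (168 ^ 2 * ((NP + Q ^ 2) * NP * (NM + Q ^ 2) * NM))%:R / Q%:R ^+ 2.
Proof.
move=> Q0 NP0 NM0 uL hL uP hP uM hM B0 hlg.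
have QR : 0 < (Q%:R : R) by rewrite ltr0n.
set S := \sum_(l <- Lp) _.
have V0 l s : 0 <= class_var l s by apply: sumr_ge0 => g _; apply: sqr_ge0.
have hVP := sum_class_var Q0 NP0 uL hL uP hP.
have hVM := sum_class_var Q0 NM0 uL hL uM hM.
set VP := \sum_(l <- Lp) _ in hVP; set VM := \sum_(l <- Lp) _ in hVM.
have VP0 : 0 <= VP by apply: sumr_ge0 => l _.
have VM0 : 0 <= VM by apply: sumr_ge0 => l _.
have h1 : `|S| ^+ 2 <= (B * VP) * (B * VM).
  apply: sqr_le_of_AGM; rewrite ?mulr_ge0 // => t t0.
  apply: (@le_trans _ _ (\sum_(l <- Lp) B * (t * class_var l P + class_var l M / t))).
    apply: (@le_trans _ _ (2 * \sum_(l <- Lp) `|lg l * \sum_(p <- P) \sum_(m <- M) local_disc l (p * m)|)).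
      by rewrite ler_pM2l ?ltr0n // ler_norm_sum.
    rewrite mulr_sumr big_seq [leRHS]big_seq; apply: ler_sum => l lL.
    have /andP[g0 gB] := hlg _ lL; have /andP[pl _] := allP hL _ lL.
    rewrite normrM (ger0_norm g0) mulrCA; apply: ler_pM => //; first by rewrite mulr_ge0.
    exact: bilinear_disc.
  by rewrite -mulr_sumr big_split /= -mulr_sumr -mulr_suml -/VP -/VM mulrDr mulrCA -mulrA.
have sP : (size P <= NP)%N.
  rewrite -[NP](size_iota 0); apply: uniq_leq_size => // n /(allP hP); by rewrite mem_iota.
have sM : (size M <= NM)%N.
  rewrite -[NM](size_iota 0); apply: uniq_leq_size => // n /(allP hM); by rewrite mem_iota.
have gen (N sz : nat) : (sz <= N)%N -> ((8 * N + 168 * Q ^ 2)%:R * sz%:R <= (168 * ((N + Q ^ 2) * N))%:R :> R).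
  move=> h; rewrite -natrM ler_nat mulnA; apply: leq_mul => //.
  by rewrite mulnDr leq_add2r leq_mul2r orbT.
have {}hVP := le_trans hVP (gen _ _ sP); have {}hVM := le_trans hVM (gen _ _ sM).
have QV : (Q%:R * VP) * (Q%:R * VM) <= (168 * ((NP + Q ^ 2) * NP))%:R * (168 * ((NM + Q ^ 2) * NM))%:R.
  by apply: ler_pM; rewrite ?mulr_ge0 // ltW.
rewrite -(ger0_norm (sqr_ge0 S)) normrX; apply: (le_trans h1).
rewrite ler_pdivlMr ?exprn_gt0 //.
have -> : B * VP * (B * VM) * Q%:R ^+ 2 = B ^+ 2 * (Q%:R * VP * (Q%:R * VM)) by ring.
apply: ler_wpM2l; first exact: sqr_ge0.
by apply: (le_trans QV); rewrite -natrM ler_nat; apply/eq_leq; ring.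
Qed.

End Discrepancy.

(** * Discrepancy summed over the moduli *)
Definition dyadic_primes (b : nat) := [seq l <- iota (2 ^ b).+1 (2 ^ b) | prime l].
Definition moduli (b0 b1 : nat) := flatten [seq dyadic_primes b | b <- index_iota b0 b1].

Lemma mem_dyadic_primes b l : (l \in dyadic_primes b) = prime l && (2 ^ b < l <= 2 ^ b.+1)%N.
Proof. by rewrite mem_filter mem_iota addSn ltnS addnn -mul2n -expnS. Qed.

Lemma mem_moduli b0 b1 l : (l \in moduli b0 b1) = (b0 < b1)%N && (prime l && (2 ^ b0 < l <= 2 ^ b1)%N).
Proof.
apply/flatten_mapP/idP => [[b]|/and3P[b01 pl /andP[h1 h2]]].
  rewrite mem_index_iota mem_dyadic_primes => /andP[h1 h2] /and3P[-> h3 h4].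
  rewrite (leq_ltn_trans h1 h2) (leq_ltn_trans _ h3) ?leq_exp2l //=.
  by rewrite (leq_trans h4) // leq_exp2l.
exists (trunc_log 2 l.-1).
  have l1 := prime_gt1 pl.
  rewrite mem_index_iota trunc_log_max //=; last by lia.
  by rewrite -(ltn_exp2l _ _ (isT : 1 < 2)%N) (leq_ltn_trans (trunc_logP _ _)) //; lia.
have l1 := prime_gt1 pl.
have /andP[h3 h4] := @trunc_log_bounds 2 l.-1 isT ltac:(by lia).
rewrite mem_dyadic_primes pl /=; lia.
Qed.

Lemma moduli_uniq b0 b1 : uniq (moduli b0 b1).
Proof.
rewrite /moduli /index_iota; move: (b1 - b0)%N => n; elim: n b0 => //= n IH b.
rewrite cat_uniq IH filter_uniq ?iota_uniq //= andbT.
apply/hasPn => l /flatten_mapP[c]; rewrite mem_iota !mem_dyadic_primes => /andP[h _] /and3P[-> h1 _].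
by rewrite /= negb_and -!ltnNge (leq_ltn_trans _ h1) ?orbT // leq_exp2l.
Qed.

Section Weight.
Variables (R : realFieldType) (lg : nat -> R) (B : R) (b0 b1 : nat).
Hypothesis B0 : 0 <= B.
Hypothesis lgB : forall l, l \in moduli b0 b1 -> 0 <= lg l <= B.

(** The discrepancy of n in the class 1, summed over all moduli with the weight
    lg l, which will be the base 2 logarithm. *)
Definition disc_weight n : R := \sum_(l <- moduli b0 b1) lg l * local_disc R l n.

(** The ranges 2^a and 2^(i - a) of the two factors multiply to 2^i up to a constant.
    The large sieve is efficient as soon as both exceed 2^(6 s) and the squares of
    the moduli stay between 2^(6 s) and 2^(i - 6 s); the saving is 8^s. *)
Lemma block_disc (i a s : nat) (P M : seq nat) :
  (3 * s <= b0)%N -> (2 * b1 + 6 * s <= i)%N -> (6 * s <= a)%N -> (a + 6 * s <= i)%N ->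
  uniq P -> all (fun n => n < 2 ^ a.+1)%N P ->
  uniq M -> all (fun n => n < 2 ^ (i - a).+1)%N M ->
  `|\sum_(p <- P) \sum_(m <- M) disc_weight (p * m)| <= (1100 * i * 2 ^ i)%:R * B / 8 ^+ s.
Proof.
move=> sb0 b1i sa ai uP hP uM hM.
have e8 : (8 ^ s = 2 ^ (3 * s))%N by rewrite expnM.
have b1i' : (b1 <= i)%N by lia.
have dyad b : (b0 <= b < b1)%N ->
   `|\sum_(l <- dyadic_primes b) lg l * \sum_(p <- P) \sum_(m <- M) local_disc R l (p * m)|
     <= (1100 * 2 ^ i)%:R * B / 8 ^+ s.
  move=> /andP[hb0 hb1].
  have hlg l : l \in dyadic_primes b -> 0 <= lg l <= B.
    move=> lb; apply: lgB; rewrite mem_moduli; move: lb; rewrite mem_dyadic_primes => /and3P[-> h1 h2].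
    rewrite (leq_ltn_trans hb0 hb1) (leq_ltn_trans _ h1) ?leq_exp2l //=.
    by rewrite (leq_trans h2) // leq_exp2l.
  have uL : uniq (dyadic_primes b) by apply/filter_uniq/iota_uniq.
  have hL : all (fun l => prime l && (2 ^ b < l <= 2 * 2 ^ b))%N (dyadic_primes b).
    by apply/allP => l; rewrite mem_dyadic_primes expnS.
  have := bilinear_dyadic _ _ _ uL hL uP hP uM hM B0 hlg; rewrite !expn_gt0 => /(_ isT isT isT).
  set S := \sum_(l <- _) _ => h.
  have r0 : 0 <= (1100 * 2 ^ i)%:R * B / 8 ^+ s by rewrite divr_ge0 ?mulr_ge0 // exprn_ge0.
  rewrite -(ler_pXn2r (isT : 0 < 2)%N) ?nnegrE // real_normK ?num_real //; apply: (le_trans h).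
  have -> : ((1100 * 2 ^ i)%:R * B / 8 ^+ s) ^+ 2 =
      B ^+ 2 * (((1100 * 2 ^ i) ^ 2)%:R / (8 ^ (s * 2))%:R) :> R.
    by rewrite exprMn exprVn -exprM exprMn -!natrX [_ * B ^+ 2]mulrC mulrA.
  rewrite -mulrA; apply: ler_wpM2l; first exact: sqr_ge0.
  rewrite -natrX ler_pdivrMr ?ltr0n ?expn_gt0 // mulrAC ler_pdivlMr ?ltr0n ?expn_gt0 //.
  rewrite -!natrM ler_nat.
  have -> : (8 ^ (s * 2) = 2 ^ (6 * s))%N by rewrite expnM e8 -expnM; congr (_ ^ _)%N; clear; lia.
  set NP := (2 ^ a.+1)%N; set NM := (2 ^ (i - a).+1)%N; set Q := (2 ^ b)%N; set T := (2 ^ (6 * s))%N.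
  set Y := (2 ^ i)%N.
  have h1 : (NP * NM = 4 * Y)%N.
    by rewrite /NP /NM /Y -expnD (_ : 4 = 2 ^ 2)%N // -expnD; congr (_ ^ _)%N; clear -ai; lia.
  have h2 : (NP * T <= 2 * Y)%N by rewrite /NP /T /Y -expnD -expnS leq_exp2l //; clear -ai sa; lia.
  have h3 : (NM * T <= 2 * Y)%N by rewrite /NM /T /Y -expnD -expnS leq_exp2l //; clear -ai sa; lia.
  have h4 : (Q ^ 2 * T <= Y)%N by rewrite /Q /T /Y -expnM -expnD leq_exp2l //; clear -b1i hb1; lia.
  have h5 : (T <= Q ^ 2)%N by rewrite /Q /T -expnM leq_exp2l //; clear -sb0 hb0; lia.
  have -> : ((NP + Q ^ 2) * NP * (NM + Q ^ 2) * NM = 4 * Y * (4 * Y + Q ^ 2 * (NP + NM + Q ^ 2)))%N.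
    rewrite -h1; ring.
  have h6 : ((4 * Y + Q ^ 2 * (NP + NM + Q ^ 2)) * T <= 9 * (Y * Q ^ 2))%N.
    have -> : ((4 * Y + Q ^ 2 * (NP + NM + Q ^ 2)) * T = 4 * (Y * T) + Q ^ 2 * (NP * T + NM * T + Q ^ 2 * T))%N by ring.
    have g1 : (Y * T <= Y * Q ^ 2)%N by rewrite leq_mul2l h5 orbT.
    have g2 : (Q ^ 2 * (NP * T + NM * T + Q ^ 2 * T) <= Q ^ 2 * (5 * Y))%N.
      by rewrite leq_mul2l; apply/orP; right; clear -h2 h3 h4; lia.
    have g3 : (Q ^ 2 * (5 * Y) = 5 * (Y * Q ^ 2))%N by ring.
    clear -g1 g2 g3; lia.
  have g (c : nat) : (c ^ 2 * (4 * Y * (4 * Y + Q ^ 2 * (NP + NM + Q ^ 2))) * T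
      = c ^ 2 * 4 * Y * ((4 * Y + Q ^ 2 * (NP + NM + Q ^ 2)) * T))%N by ring.
  have g' (c : nat) : (c ^ 2 * 4 * Y * (9 * (Y * Q ^ 2)) = (c * 6 * Y) ^ 2 * Q ^ 2)%N by ring.
  apply: (@leq_trans ((168 * 6 * Y) ^ 2 * Q ^ 2)%N).
    by rewrite g -g' leq_mul2l h6 orbT.
  by rewrite leq_mul2r leq_exp2r // leq_mul2r orbA orbT.
have -> : \sum_(p <- P) \sum_(m <- M) disc_weight (p * m) =
   \sum_(b0 <= b < b1) \sum_(l <- dyadic_primes b) lg l * \sum_(p <- P) \sum_(m <- M) local_disc R l (p * m).
  transitivity (\sum_(l <- moduli b0 b1) lg l * \sum_(p <- P) \sum_(m <- M) local_disc R l (p * m)).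
    under eq_bigr => p _ do rewrite exchange_big /=.
    rewrite exchange_big /=; apply: eq_bigr => l _; rewrite mulr_sumr; apply: eq_bigr => p _.
    by rewrite mulr_sumr.
  by rewrite /moduli big_flatten /= big_map.
apply: (le_trans (ler_norm_sum _ _ _)).
apply: (@le_trans _ _ (\sum_(b0 <= b < b1) (1100 * 2 ^ i)%:R * B / 8 ^+ s)).
  by apply: ler_sum_nat => b hb; apply: dyad.
rewrite sumr_const_nat -[leLHS]mulr_natl.
have -> : (1100 * i * 2 ^ i)%:R * B / 8 ^+ s = i%:R * ((1100 * 2 ^ i)%:R * B / 8 ^+ s).
  by rewrite !natrM; ring.
apply: ler_wpM2r; first by rewrite divr_ge0 ?mulr_ge0 // exprn_ge0.
by rewrite ler_nat; lia.
Qed.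

End Weight.

(** * Rough composite numbers cut into boxes *)
Lemma harmonic_pow2_le (R : realFieldType) i : \sum_(n <- iota 1 (2 ^ i)) n%:R^-1 <= i.+1%:R :> R.
Proof.
elim: i => [|i IH]; first by rewrite expn0 big_seq1 invr1.
rewrite expnS mul2n -addnn iotaD big_cat /= -[i.+2]addn1 natrD; apply: lerD => //.
apply: (@le_trans _ _ (\sum_(n <- iota (1 + 2 ^ i) (2 ^ i)) (2 ^ i)%:R^-1)).
  rewrite big_seq [leRHS]big_seq; apply: ler_sum => n; rewrite mem_iota => /andP[h1 h2].
  have w0 : (0 < 2 ^ i)%N by rewrite expn_gt0.
  by rewrite lef_pV2 ?posrE ?ltr0n ?ler_nat; clear -h1 w0; lia.
rewrite big_const_seq count_predT size_iota iter_addr_0 -[_ *+ _]mulr_natr mulVf //.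
by rewrite pnatr_eq0 -lt0n expn_gt0.
Qed.

Section Blocks.
Variable s : nat.

(** The dyadic interval around p is cut into 2^s blocks of this length; [blk_top] is
    the end of the block of p. *)
Definition blk_len (p : nat) := (2 ^ (trunc_log 2 p - s))%N.
Definition blk_idx (p : nat) := (p %/ blk_len p)%N.
Definition blk_top (p : nat) := (blk_len p * (blk_idx p).+1)%N.
(** One number recording the dyadic interval, the block and the class modulo W of
    p: summing over its fibres is summing over blocks. *)
Definition blk_code (W p : nat) := ((trunc_log 2 p * 2 ^ s.+1 + blk_idx p) * W + p %% W)%N.

Lemma blk_len_gt0 p : (0 < blk_len p)%N.
Proof. by rewrite expn_gt0. Qed.

Lemma blk_topP p : (p < blk_top p)%N.
Proof. by rewrite /blk_top mulnC ltn_ceil // blk_len_gt0. Qed.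

Lemma blk_topP' p : (blk_top p <= p + blk_len p)%N.
Proof. by rewrite /blk_top mulnS addnC leq_add2r mulnC leq_divM. Qed.

Lemma blk_idx_bound p : (2 ^ s <= p)%N -> (2 ^ s <= blk_idx p < 2 ^ s.+1)%N.
Proof.
move=> sp; have p0 : (0 < p)%N by apply: leq_trans sp; rewrite expn_gt0.
have /andP[h1 h2] := @trunc_log_bounds 2 p isT p0.
have sa : (s <= trunc_log 2 p)%N by rewrite trunc_log_max.
rewrite /blk_idx leq_divRL ?blk_len_gt0 // ltn_divLR ?blk_len_gt0 // /blk_len -!expnD.
have -> : (s + (trunc_log 2 p - s) = trunc_log 2 p)%N by clear -sa; lia.
have -> : (s.+1 + (trunc_log 2 p - s) = (trunc_log 2 p).+1)%N by clear -sa; lia.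
by rewrite h1 h2.
Qed.

Lemma blk_len_le p : (2 ^ s <= p)%N -> (blk_len p * 2 ^ s <= p)%N.
Proof.
move=> sp; have p0 : (0 < p)%N by apply: leq_trans sp; rewrite expn_gt0.
have sa : (s <= trunc_log 2 p)%N by rewrite trunc_log_max.
by rewrite /blk_len -expnD subnK // trunc_logP.
Qed.

Lemma blk_code_inj W p q : (0 < W)%N -> (2 ^ s <= p)%N -> (2 ^ s <= q)%N ->
  blk_code W p = blk_code W q ->
  [/\ trunc_log 2 p = trunc_log 2 q, blk_top p = blk_top q & p %% W = q %% W]%N.
Proof.
move=> W0 sp sq h.
have e1 : (p %% W = q %% W)%N.
  have := congr1 (modn^~ W) h; by rewrite /blk_code !modnMDl !modn_mod.
have e2 : (trunc_log 2 p * 2 ^ s.+1 + blk_idx p = trunc_log 2 q * 2 ^ s.+1 + blk_idx q)%N.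
  move: h; rewrite /blk_code e1 => /addIn /eqP.
  by rewrite eqn_mul2r => /orP[/eqP W00|/eqP //]; rewrite W00 in W0.
have /andP[_ hp] := blk_idx_bound sp; have /andP[_ hq] := blk_idx_bound sq.
have e3 : trunc_log 2 p = trunc_log 2 q.
  have := congr1 (fun x => x %/ 2 ^ s.+1)%N e2.
  by rewrite !divnMDl ?expn_gt0 // (divn_small hp) (divn_small hq) !addn0.
split=> //; move: e2; rewrite /blk_top /blk_len e3 => /addnI ->; by [].
Qed.

(** The conditions on m that depend on p are replaced by conditions on the end U of
    the block of p and on the class c of p, so that p and m become independent
    inside a block. *)
Definition cofactors (W i U c : nat) :=
  [seq m <- iota 2 (2 ^ i) | [&& m * U <= 2 ^ i, U <= pdiv m & (c * m) %% W == 1 %% W]%N].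

Definition small_primes (v i : nat) :=
  [seq p <- iota 0 (2 ^ i).+1 | [&& prime p, 2 ^ v < p & p * p <= 2 ^ i]%N].

Definition rough_composites (W v i : nat) :=
  [seq n <- iota 2 (2 ^ i).-1 | [&& n %% W == 1 %% W, 2 ^ v < pdiv n & ~~ prime n]%N].

(** Pairs (p, m) with p the smallest prime factor of p m, for which the decoupled
    conditions of [cofactors] hold. *)
Definition good_pairs (W v i : nat) :=
  [seq (p, m) | p <- small_primes v i, m <- cofactors W i (blk_top p) (p %% W)].

Lemma mem_small_primes v i p :
  p \in small_primes v i -> [/\ prime p, 2 ^ v < p & p * p <= 2 ^ i]%N.
Proof. by rewrite mem_filter => /andP[/and3P[]]. Qed.

Lemma good_pairsP W v i x : x \in good_pairs W v i ->
  [/\ x.1 \in small_primes v i, pdiv (x.1 * x.2) = x.1,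
     (x.1 * x.2)%N \in rough_composites W v i & (1 < x.2)%N].
Proof.
case/allpairsPdep => p [m [pP]]; rewrite mem_filter mem_iota => /andP[/and3P[h1 h2 h3] /andP[m1 _]] -> /=.
have [pp wp ppY] := mem_small_primes pP.
have p1 := prime_gt1 pp.
have pm1 : (1 < p * m)%N by clear -p1 m1; nia.
have e : pdiv (p * m) = p.
  apply/eqP; rewrite eqn_leq pdiv_min_dvd ?dvdn_mulr //=.
  have := pdiv_prime pm1; have := pdiv_dvd (p * m); set q := pdiv _ => qpm pq.
  move: qpm; rewrite Euclid_dvdM // dvdn_prime2 // => /orP[/eqP -> //|qm].
  apply: (leq_trans (ltnW (blk_topP p))); apply: (leq_trans h2).
  by apply: pdiv_min_dvd => //; exact: prime_gt1.
split=> //.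
rewrite mem_filter mem_iota e wp.
have -> /= : ((p * m) %% W == 1 %% W)%N by move: h3; rewrite modnMml.
have np : ~~ prime (p * m).
  by apply/primePn; right; exists p; rewrite ?dvdn_mulr // p1 /= ltn_Pmulr // ltnW.
rewrite np pm1 /= add2n prednK ?expn_gt0 // ltnS.
apply: leq_trans h1; rewrite mulnC leq_mul2l; apply/orP; right; exact: ltnW (blk_topP p).
Qed.

Lemma good_pairs_uniq W v i : uniq [seq x.1 * x.2 | x <- good_pairs W v i]%N.
Proof.
rewrite map_inj_in_uniq.
  apply: allpairs_uniq_dep => [|p _|[a b] [c d] _ _ /= [-> ->]] //; exact/filter_uniq/iota_uniq.
move=> [a b] [c d] /good_pairsP[/= aP e1 _ _] /good_pairsP[/= _ e2 _ _] h.
have ac : a = c by rewrite -e1 -e2 h.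
have [pa _ _] := mem_small_primes aP.
by congr pair => //; apply/eqP; rewrite -(eqn_pmul2l (prime_gt0 pa)) {2}ac h.
Qed.

(** A rough composite n = p m is lost by the decoupling only if m exceeds the bound
    computed with the end of the block, and then n is within a factor 1 + 2^-s
    of 2^i, or if the smallest prime factor of m lies in the block of p.  In the
    second case n is a multiple of p q with q in a short block above p; the sum of
    1 / (p q) over such pairs is small. *)
Lemma size_dropped (R : realFieldType) W v i : (s <= v)%N -> (s <= i)%N ->
  (size [seq n <- rough_composites W v i | n \notin [seq x.1 * x.2 | x <- good_pairs W v i]%N])%:R
    <= (i.+3 * 2 ^ i)%:R / 2 ^+ s :> R.
Proof.
move=> sv si; set D := filter _ _; set Y := (2 ^ i)%N.
(* X1 lists the n close to 2^i; X2 lists the multiples of p q with q in the block of p *)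
pose X1 := iota ((2 ^ s * Y) %/ (2 ^ s).+1).+1 (Y - (2 ^ s * Y) %/ (2 ^ s).+1).
pose X2 := flatten [seq flatten [seq [seq p * q * k | k <- iota 1 (Y %/ (p * q))]%N
    | q <- iota (blk_len p * blk_idx p) (blk_len p)] | p <- small_primes v i].
have uD : uniq D by apply/filter_uniq/filter_uniq/iota_uniq.
have K0 : (0 < 2 ^ s)%N by rewrite expn_gt0.
have sub : {subset D <= X1 ++ X2}.
  move=> n; rewrite mem_filter [X in _ && X]mem_filter mem_iota => /andP[nG /andP[/and3P[nW wn np] /andP[n2 nY]]].
  have {}nY : (n <= Y)%N by move: nY; rewrite add2n prednK ?expn_gt0 // ltnS.
  have n1 : (1 < n)%N by [].
  set p := pdiv n in wn; have pp : prime p by exact: pdiv_prime.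
  have pn : (p %| n)%N := pdiv_dvd n.
  set m := (n %/ p)%N; have nE : n = (p * m)%N by rewrite mulnC divnK.
  have p0 := prime_gt0 pp.
  have m1 : (1 < m)%N.
    rewrite ltnNge; apply/negP => m1; case/negP: np.
    have : m != 0%N by apply: contraTneq n1 => m0; rewrite nE m0 muln0.
    by move: m1; case: (m) nE => [|[|//]] // -> _ _; rewrite muln1.
  set q := pdiv m; have qm : (q %| m)%N := pdiv_dvd m.
  have pq : prime q by exact: pdiv_prime.
  have pq_le : (p <= q)%N.
    by apply: pdiv_min_dvd; [exact: prime_gt1|rewrite nE dvdn_mull].
  have qm_le : (q <= m)%N by apply: dvdn_leq qm; exact: ltnW.
  have ppY : (p * p <= Y)%N by apply: (leq_trans _ nY); rewrite nE leq_mul2l (leq_trans pq_le qm_le) orbT.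
  have sp : (2 ^ s <= p)%N by apply: (leq_trans _ (ltnW wn)); rewrite leq_exp2l.
  have pS : p \in small_primes v i.
    rewrite mem_filter pp wn ppY mem_iota /= add0n ltnS -/Y.
    by apply: (leq_trans _ ppY); rewrite leq_pmulr.
  rewrite mem_cat.
  have [big|sm] := ltnP Y (m * blk_top p).
    apply/orP; left; rewrite mem_iota.
    have h1 := blk_topP' p; have h2 := blk_len_le sp.
    have h3 : ((2 ^ s * Y) < n * (2 ^ s).+1)%N.
      have g1 : (2 ^ s * Y < 2 ^ s * (m * blk_top p))%N by rewrite ltn_mul2l K0.
      apply: (leq_trans g1); rewrite nE.
      have -> : (2 ^ s * (m * blk_top p) = m * (2 ^ s * blk_top p))%N by ring.
      have -> : (p * m * (2 ^ s).+1 = m * (2 ^ s * p + p))%N by ring.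
      rewrite leq_mul2l; apply/orP; right.
      apply: (@leq_trans (2 ^ s * (p + blk_len p))%N); first by rewrite leq_mul2l h1 orbT.
      by rewrite mulnDr leq_add2l mulnC.
    rewrite ltn_divLR // h3 /=.
    have : ((2 ^ s * Y) %/ (2 ^ s).+1 <= Y)%N.
      by rewrite -ltnS ltn_divLR // mulnC -[X in (_ < X * _)%N]addn1 mulnDl; clear; nia.
    by clear -nY; lia.
  have [tq|sq] := leqP (blk_top p) q.
    case/mapP: nG; exists (p, m) => //; apply/allpairsPdep; exists p, m; split=> //.
    rewrite mem_filter sm tq modnMml -nE nW /= mem_iota m1 /= add2n ltnS ltnW //.
    by rewrite ltnS; apply: (leq_trans _ nY); rewrite nE leq_pmull.
  apply/orP; right; apply/flatten_mapP; exists p => //; apply/flatten_mapP; exists q.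
    rewrite mem_iota; apply/andP; split; last by move: sq; rewrite /blk_top mulnS addnC.
    by apply: (leq_trans _ pq_le); rewrite mulnC leq_divM.
  apply/mapP; exists (m %/ q)%N; last by rewrite -mulnA (mulnC q) divnK.
  rewrite mem_iota divn_gt0 ?prime_gt0 // qm_le /= add1n ltnS leq_divRL ?muln_gt0 ?p0 ?prime_gt0 //.
  by rewrite mulnCA divnK // -nE.
have hsz : (size D <= size X1 + size X2)%N by rewrite -size_cat; exact: uniq_leq_size.
have KR : 0 < (2 ^+ s : R) by rewrite exprn_gt0.
have h1 : (size X1)%:R <= (2 * Y)%:R / 2 ^+ s :> R.
  rewrite ler_pdivlMr // -natrX -natrM ler_nat size_iota.
  have KY : (2 ^ s <= Y)%N by rewrite leq_exp2l.
  have := ltn_ceil (2 ^ s * Y) (ltn0Sn (2 ^ s)); set t := (_ %/ _)%N => ht.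
  move: (2 ^ s)%N KY ht => K KY ht.
  rewrite mulnBl; clear -KY ht; nia.
have h2 : (size X2)%:R <= (i.+1 * Y)%:R / 2 ^+ s :> R.
  rewrite size_flatten /shape sumnE -map_comp big_map natr_sum.
  apply: (@le_trans _ _ (\sum_(p <- small_primes v i) Y%:R / 2 ^+ s * p%:R^-1)).
    rewrite big_seq [leRHS]big_seq; apply: ler_sum => p /mem_small_primes[pp wp _].
    have p0 := prime_gt0 pp.
    have sp : (2 ^ s <= p)%N by apply: (leq_trans _ (ltnW wp)); rewrite leq_exp2l.
    have sa : (s <= trunc_log 2 p)%N by rewrite trunc_log_max.
    rewrite /= size_flatten /shape sumnE -map_comp big_map natr_sum.
    apply: (@le_trans _ _ (\sum_(q <- iota (blk_len p * blk_idx p) (blk_len p))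
              Y%:R / p%:R / (2 ^ trunc_log 2 p)%:R)).
      rewrite big_seq [leRHS]big_seq; apply: ler_sum => q; rewrite mem_iota => /andP[hq _] /=.
      have aq : (2 ^ trunc_log 2 p <= q)%N.
        apply: leq_trans hq; have /andP[h _] := blk_idx_bound sp.
        apply: (@leq_trans (blk_len p * 2 ^ s)); last by rewrite leq_mul2l h orbT.
        by rewrite /blk_len -expnD subnK.
      rewrite size_map size_iota ler_pdivlMr ?ltr0n ?expn_gt0 // ler_pdivlMr ?ltr0n //.
      rewrite -!natrM ler_nat; apply: (@leq_trans (Y %/ (p * q) * (p * q))%N); last exact: leq_divM.
      by rewrite -mulnA leq_mul2l; apply/orP; right; rewrite mulnC leq_mul2l aq orbT.
    rewrite big_const_seq count_predT size_iota iter_addr_0 -[_ *+ _]mulr_natr /blk_len.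
    have -> : (2 ^ trunc_log 2 p)%:R = (2 ^ (trunc_log 2 p - s))%:R * 2 ^+ s :> R.
      by rewrite -natrX -natrM -expnD subnK.
    set L : R := (2 ^ (_ - _))%:R; have L0 : L != 0 by rewrite pnatr_eq0 -lt0n expn_gt0.
    have K0' : 2 ^+ s != 0 :> R by rewrite gt_eqF.
    have p0' : p%:R != 0 :> R by rewrite pnatr_eq0 -lt0n.
    move: (2 ^+ s) K0' => K K0'.
    by rewrite le_eqVlt; apply/orP; left; apply/eqP; field; rewrite K0' p0' L0.
  rewrite -mulr_sumr natrM -[leRHS]mulrA mulrC; apply: ler_wpM2r; first by rewrite divr_ge0 // ltW.
  apply: le_trans (harmonic_pow2_le R i); apply: ler_sum_sub.
  - exact/filter_uniq/iota_uniq.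
  - move=> p; rewrite mem_filter !mem_iota => /andP[/and3P[/prime_gt0 p0 _ _] /andP[_ h]].
    by rewrite p0.
  - by move=> p _; rewrite invr_ge0.
apply: (@le_trans _ _ ((size X1)%:R + (size X2)%:R)); first by rewrite -natrD ler_nat.
apply: (le_trans (lerD h1 h2)); rewrite -mulrDl -natrD -mulnDl.
by rewrite add2n.
Qed.
End Blocks.

(** * Discrepancy of the rough composite numbers *)
Section CompositeDisc.
Variables (R : realFieldType) (lg : nat -> R) (B G : R) (b0 b1 W v s i : nat).
Hypothesis B0 : 0 <= B.
Hypothesis lgB : forall l, l \in moduli b0 b1 -> 0 <= lg l <= B.
Hypothesis W0 : (0 < W)%N.
Hypothesis i0 : (0 < i)%N.
Hypothesis sv : (6 * s <= v)%N.
Hypothesis sb0 : (3 * s <= b0)%N.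
Hypothesis b1i : (2 * b1 + 6 * s <= i)%N.
Hypothesis hG : forall n, (1 < n <= 2 ^ i)%N -> `|disc_weight lg b0 b1 n| <= G.

Local Notation g := (disc_weight lg b0 b1).

(** There are at most (i + 1) 2^(s + 1) W blocks, and [block_disc] saves 8^s on
    each of them. *)
Lemma good_pairs_disc :
  `|\sum_(x <- good_pairs s W v i) g (x.1 * x.2)|
    <= (i.+1 * 2 ^ s.+1 * W)%:R * ((1100 * i * 2 ^ i)%:R * B / 8 ^+ s).
Proof.
have s_v : (s <= v)%N by clear -sv; lia.
rewrite big_allpairs_dep /=.
set H := (i.+1 * 2 ^ s.+1 * W)%N.
have H0 : (0 < H)%N by rewrite !muln_gt0 expn_gt0 W0.
rewrite (@sum_by_class _ _ _ (fun p => blk_code s W p %% H)%N H); last by move=> p; rewrite ltn_mod.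
apply: (le_trans (ler_norm_sum _ _ _)).
have e0 : 0 <= (1100 * i * 2 ^ i)%:R * B / 8 ^+ s by rewrite divr_ge0 ?mulr_ge0 // exprn_ge0.
apply: (@le_trans _ _ (\sum_(0 <= h < H) (1100 * i * 2 ^ i)%:R * B / 8 ^+ s)); last first.
  by rewrite sumr_const_nat subn0 -[leLHS]mulr_natl.
apply: ler_sum_nat => h hH.
rewrite -big_filter; set Ph := filter _ _.
have PhP p : p \in Ph -> [/\ p \in small_primes v i, (2 ^ s <= p)%N & blk_code s W p = h].
  rewrite mem_filter => /andP[/eqP e pS]; have [pp wp ppY] := mem_small_primes pS.
  have sp : (2 ^ s <= p)%N by apply: (leq_trans _ (ltnW wp)); rewrite leq_exp2l.
  split=> //; move: e; rewrite modn_small // /H /blk_code.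
  have p0 := prime_gt0 pp.
  have ai : (trunc_log 2 p <= i)%N.
    rewrite -(@leq_exp2l 2) //; apply: (leq_trans (trunc_logP _ _)) => //.
    by apply: (leq_trans _ ppY); rewrite leq_pmulr.
  have /andP[_ hj] := blk_idx_bound sp.
  have c1 : (p %% W < W)%N by rewrite ltn_mod.
  have c2 : (trunc_log 2 p * 2 ^ s.+1 + blk_idx s p < i.+1 * 2 ^ s.+1)%N.
    apply: (@leq_trans ((trunc_log 2 p).+1 * 2 ^ s.+1)); first by rewrite mulSn addnC ltn_add2r.
    by rewrite leq_mul2r ltnS ai orbT.
  apply: (@leq_trans ((trunc_log 2 p * 2 ^ s.+1 + blk_idx s p).+1 * W)%N); first by rewrite mulSn addnC ltn_add2r.
  by rewrite leq_mul2r c2 orbT.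
have uPh : uniq Ph by apply/filter_uniq/filter_uniq/iota_uniq.
case E: Ph => [|p0 ps]; first by rewrite big_nil normr0.
have p0P : p0 \in Ph by rewrite E inE eqxx.
have [p0S sp0 c0] := PhP _ p0P.
rewrite -E.
have same p : p \in Ph -> [/\ trunc_log 2 p = trunc_log 2 p0, blk_top s p = blk_top s p0 & p %% W = p0 %% W]%N.
  by move=> /PhP[_ sp cp]; apply: blk_code_inj => //; rewrite cp c0.
rewrite (eq_big_seq (fun p => \sum_(m <- cofactors W i (blk_top s p0) (p0 %% W)) g (p * m))); last first.
  by move=> p /same[_ -> ->].
have [pp0 wp0 ppY0] := mem_small_primes p0S.
have p00 := prime_gt0 pp0.
have /andP[a1 a2] := @trunc_log_bounds 2 p0 isT p00.
set a := trunc_log 2 p0 in a1 a2 same *.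
have va : (v <= a)%N by rewrite trunc_log_max // ltnW.
have ai : (2 * a <= i)%N.
  rewrite -(@leq_exp2l 2) // mulnC expnM; apply: leq_trans ppY0; rewrite -mulnn; exact: leq_mul.
apply: (block_disc B0 lgB (a := a)) => //.
- by clear -va sv; lia.
- by clear -va sv ai; lia.
- apply/allP => p hp; have [e _ _] := same _ hp.
  have [pS _ _] := PhP _ hp; have [pp _ _] := mem_small_primes pS.
  by rewrite -e trunc_log_ltn.
- exact/filter_uniq/iota_uniq.
apply/allP => m; rewrite mem_filter => /andP[/and3P[h1 _ _] _].
have ai' : (a <= i)%N by clear -ai; lia.
apply: (@leq_ltn_trans (2 ^ (i - a))); last by rewrite ltn_exp2l.
rewrite -(@leq_pmul2r (2 ^ a)) ?expn_gt0 // -expnD subnK //.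
apply: leq_trans h1; rewrite leq_mul2l; apply/orP; right.
exact: (leq_trans a1 (ltnW (blk_topP s p0))).
Qed.

Lemma composite_disc :
  `|\sum_(n <- rough_composites W v i) g n|
    <= (i.+1 * 2 ^ s.+1 * W)%:R * ((1100 * i * 2 ^ i)%:R * B / 8 ^+ s)
       + (i.+3 * 2 ^ i)%:R / 2 ^+ s * G.
Proof.
have s_v : (s <= v)%N by clear -sv; lia.
have s_i : (s <= i)%N by clear -b1i; lia.
set GL := [seq x.1 * x.2 | x <- good_pairs s W v i]%N.
rewrite (bigID (fun n => n \in GL)) /=; apply: (le_trans (ler_normD _ _)); apply: lerD.
  rewrite -big_filter (perm_big GL) /=; first by rewrite /GL big_map; exact: good_pairs_disc.
  apply: uniq_perm; [exact/filter_uniq/filter_uniq/iota_uniq|exact: good_pairs_uniq|].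
  move=> n; rewrite mem_filter; apply: andb_idr => /mapP[x hx ->].
  by have [] := good_pairsP hx.
rewrite -big_filter; apply: (le_trans (ler_norm_sum _ _ _)).
apply: (@le_trans _ _ (\sum_(n <- [seq n <- rough_composites W v i | n \notin GL]) G)).
  rewrite big_seq [leRHS]big_seq; apply: ler_sum => n; rewrite mem_filter => /andP[_].
  rewrite mem_filter mem_iota => /andP[_ /andP[n2 h]]; apply: hG; rewrite n2 /=.
  by move: h; rewrite add2n prednK ?expn_gt0 // ltnS.
rewrite big_const_seq count_predT iter_addr_0 -[leLHS]mulr_natl.
have G0 : 0 <= G.
  by apply: le_trans (hG (n := 2) _) => //=; rewrite -[X in (X < _)%N](expn0 2) ltn_exp2l.
by apply: ler_wpM2r => //; exact: size_dropped.
Qed.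

End CompositeDisc.

(** * Rough numbers in progressions *)
Definition sieving_primes (W v : nat) := [seq p <- primes_upto (2 ^ v) | ~~ (p %| W)%N].

Lemma mem_sieving_primes W v p :
  (p \in sieving_primes W v) = [&& ~~ (p %| W), prime p & p <= 2 ^ v]%N.
Proof. by rewrite mem_filter mem_primes_upto. Qed.

Lemma all_dvdn_prod (ps : seq nat) n : uniq ps -> all prime ps ->
  all (fun p => p %| n)%N ps = (\prod_(p <- ps) p %| n)%N.
Proof.
move=> u pp; apply/idP/idP; first exact: prod_primes_dvdn.
move=> h; apply/allP => p hp; apply: dvdn_trans h.
by rewrite (big_rem p hp) dvdn_mulr.
Qed.

(** [sieve_bound] for the progression 1 + u n, whose distribution is [count_AP]. *)
Lemma sieve_AP_core (R : realFieldType) (ps : seq nat) (X u r : nat) :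
  uniq ps -> all (fun p => prime p && ~~ (p %| u))%N ps ->
  `|(count (fun n => all (fun p => ~~ (p %| u * n + 1))%N ps) (iota 0 X))%:R
     - X%:R * \prod_(p <- ps) (1 - p%:R^-1)|
    <= X%:R / 2 ^+ r * \prod_(p <- ps) (1 + 2 / p%:R) + (size ps).+1%:R ^+ r :> R.
Proof.
move=> ups hps.
have hp p : p \in ps -> prime p && ~~ (p %| u)%N by move/(allP hps).
have := @sieve_bound R nat (fun p n => p %| u * n + 1)%N ps (iota 0 X) X%:R r (ler0n _ _).
have h1 : all (fun p => 0 < p)%N ps by apply/allP => p /hp /andP[/prime_gt0].
move=> /(_ h1); apply => ds sub; have uds := subseq_uniq sub ups.
have pds : all prime ds by apply/allP => p /(mem_subseq sub) /hp /andP[].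
rewrite (eq_count (a2 := fun n => (\prod_(p <- ds) p %| u * n + 1)%N)); last first.
  by move=> n; rewrite /= all_dvdn_prod.
apply: count_AP.
  by rewrite big_seq prodn_cond_gt0 // => p /(allP pds) /prime_gt0.
rewrite coprime_sym; move/mem_subseq: sub => sub.
elim: ds {uds} pds sub => [|p ds IH] /=.
  by rewrite big_nil coprime1n.
move=> /andP[pp pds] sub; rewrite big_cons coprimeMl IH // ?andbT; last first.
  by move=> q qd; apply: sub; rewrite inE qd orbT.
by rewrite prime_coprime //; have /hp /andP[] := sub p (mem_head _ _).
Qed.

Lemma prod_1plus2_pow (R : realFieldType) (ps : seq nat) v :
  uniq ps -> all (fun p => 0 < p <= 2 ^ v)%N ps ->
  \prod_(p <- ps) (1 + 2 / p%:R) <= (4 ^ v.+1)%:R :> R.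
Proof.
move=> ups ha; apply: (le_trans (prod_1plus2_le R ups ha)).
rewrite -natrX ler_nat (_ : 4 ^ v.+1 = (2 * 2 ^ v) ^ 2)%N; last first.
  by rewrite -expnS -expnM mulnC expnM.
by rewrite leq_exp2r // mul2n -addnn -addn1 leq_add2l expn_gt0.
Qed.

Lemma size_primes_le_pow (ps : seq nat) v :
  uniq ps -> all (fun p => 0 < p <= 2 ^ v)%N ps -> (size ps <= 2 ^ v)%N.
Proof.
move=> ups ha; rewrite -[X in (_ <= X)%N](size_iota 1).
apply: uniq_leq_size => // p /(allP ha) /andP[p0 h].
by rewrite mem_iota p0 add1n ltnS.
Qed.

Lemma prod_1minus_01 (R : realFieldType) (ps : seq nat) :
  all (fun p => 0 < p)%N ps -> 0 <= \prod_(p <- ps) (1 - p%:R^-1 : R) <= 1.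
Proof.
elim: ps => [|q qs IHq] /=; first by rewrite big_nil ler01 lexx.
move=> /andP[q0 qs0]; rewrite big_cons.
have q1 : (q%:R : R)^-1 <= 1 by rewrite invf_le1 ?ltr0n // ler1n.
have q1' : 0 <= (q%:R : R)^-1 by rewrite invr_ge0 ler0n.
move: (IHq qs0) => /andP[h1 h2]; apply/andP; split; nra.
Qed.

Definition is_rough (W v n : nat) := all (fun p => ~~ (p %| n))%N (sieving_primes W v).

(** Both the rough numbers equal to 1 modulo l and those prime to l are counted by
    the sieve, with main terms in the ratio 1 to l - 1; only the error terms of
    Brun's sieve survive. *)
Lemma rough_local_disc (R : realFieldType) (W v r X l : nat) :
  prime l -> (0 < v)%N -> (0 < W)%N -> (W < l)%N -> (0 < X)%N -> (l <= X)%N ->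
  `|\sum_(0 <= k < X | is_rough W v (W * k + 1)) local_disc R l (W * k + 1)|
    <= 16 * (X * 4 ^ v.+1)%:R / (l%:R * 2 ^+ r) + (4 * 2 ^ (v.+1 * r))%:R.
Proof.
move=> pl v1 W0 Wl X0 lX.
have l0 := prime_gt0 pl; have l1 := prime_gt1 pl.
have lW : ~~ (l %| W)%N by rewrite gtnNdvd.
pose ps2 := [seq p <- sieving_primes W v | p != l].
have ups2 : uniq ps2 by apply/filter_uniq/filter_uniq/primes_upto_uniq.
have ps2P p : p \in ps2 -> [/\ prime p, ~~ (p %| W)%N, (p <= 2 ^ v)%N & p != l].
  by rewrite mem_filter mem_sieving_primes => /and4P[h1 h2 h3 h4].
pose V : R := \prod_(p <- ps2) (1 - p%:R^-1).
have V01 : 0 <= V <= 1 by apply: prod_1minus_01; apply/allP => p /ps2P[/prime_gt0].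
have psE n : is_rough W v n && ~~ (l %| n)%N = ~~ (l %| n)%N && all (fun p => ~~ (p %| n)%N) ps2.
  rewrite andbC; case: (boolP (l %| n)%N) => //= ln.
  rewrite /is_rough /ps2 [RHS]all_filter; apply: eq_all => p /=.
  by case: eqVneq => [->|] //=; rewrite ln.
pose N1 := count (fun k => is_rough W v (W * k + 1) && ((W * k + 1) %% l == 1)%N) (iota 0 X).
pose N2 := count (fun k => is_rough W v (W * k + 1) && ~~ (l %| W * k + 1)%N) (iota 0 X).
have -> : \sum_(0 <= k < X | is_rough W v (W * k + 1)) local_disc R l (W * k + 1)
    = N1%:R - N2%:R / l.-1%:R.
  rewrite /local_disc sumrB -mulr_suml; congr (_ - _ / _).
    rewrite /N1 -sum1_count natr_sum big_mkcondr /index_iota subn0; apply: eq_bigr => k _.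
    by case: (_ == _).
  rewrite /N2 -sum1_count natr_sum big_mkcondr /index_iota subn0; apply: eq_bigr => k _.
  by case: (_ %| _)%N.
have ha : all (fun p => 0 < p <= 2 ^ v)%N ps2.
  by apply/allP => p /ps2P[/prime_gt0 -> _ ->].
have psz := size_primes_le_pow ups2 ha.
have pQ := prod_1plus2_pow R ups2 ha.
have v0 : (0 < v)%N by exact: v1.
have pow_le k : (k <= (2 ^ v).+2)%N -> (k%:R ^+ r <= (2 ^ (v.+1 * r))%:R :> R).
  move=> hk; rewrite expnM -natrX ler_nat.
  have [->|r0] := posnP r; first by rewrite !expn0.
  rewrite leq_exp2r //; apply: (leq_trans hk).
  rewrite expnS mul2n -addnn -addn2 leq_add2l -[X in (X <= _)%N](expn1 2) leq_exp2l //.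
have K0 : 0 < (2 ^+ r : R) by rewrite exprn_gt0.
have Q0 : 0 <= \prod_(p <- ps2) (1 + 2 / p%:R) :> R.
  by apply: prodr_ge0 => p _; rewrite addr_ge0 // divr_ge0.
have lR : 0 < (l%:R : R) by rewrite ltr0n.
pose Z := (2 ^ (v.+1 * r))%N.
(* k = 0 modulo l is the same as W k + 1 = 1 modulo l, since l is prime to W *)
pose X' := ((X + l.-1) %/ l)%N.
have N1E : N1 = count (fun j => all (fun p => ~~ (p %| (W * l) * j + 1))%N ps2) (iota 0 X').
  have perm : perm_eq [seq k <- iota 0 X | (l %| k)%N] [seq (l * j)%N | j <- iota 0 X'].
    apply: uniq_perm; first exact/filter_uniq/iota_uniq.
      by rewrite map_inj_uniq ?iota_uniq // => a b /eqP; rewrite eqn_pmul2l // => /eqP.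
    move=> k; rewrite mem_filter mem_iota /=; apply/andP/mapP => [[/dvdnP[j ->] h]|[j]].
      exists j; last by rewrite mulnC.
      rewrite mem_iota /= add0n /X' leq_divRL // mulSn addnC.
      by move: h; rewrite add0n; clear -l0; lia.
    rewrite mem_iota /= add0n /X' leq_divRL // mulSn => h ->; rewrite dvdn_mulr //; split=> //.
    by move: h; rewrite mulnC; clear -l0; lia.
  transitivity (count (fun k => all (fun p => ~~ (p %| W * k + 1))%N ps2) [seq k <- iota 0 X | (l %| k)%N]).
    rewrite count_filter; apply: eq_count => k /=.
    have e : ((W * k + 1) %% l == 1)%N = (l %| k)%N.
      rewrite -[X in _ == X](modn_small l1) -[X in _ == X %[mod _]]add0n eqn_modDr mod0n.
      by rewrite -/(dvdn _ _) Euclid_dvdM // (negPf lW).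
    rewrite e; have [lk|] := boolP (l %| k)%N; last by rewrite !andbF.
    have nl : ~~ (l %| W * k + 1)%N.
      by rewrite dvdn_addr ?dvdn_mull // dvdn1 gtn_eqF.
    by rewrite !andbT; have := psE (W * k + 1)%N; rewrite nl andbT.
  by rewrite (seq.permP perm) count_map; apply: eq_count => j /=; rewrite mulnA.
have N1b : `|N1%:R - X'%:R * V| <= X'%:R * (4 ^ v.+1)%:R / 2 ^+ r + Z%:R :> R.
  rewrite N1E; apply: le_trans (sieve_AP_core R X' (u := (W * l)%N) r ups2 _) _.
    apply/allP => p /ps2P[pp pW _ pl']; rewrite pp Euclid_dvdM // negb_or pW /=.
    by rewrite dvdn_prime2.
  apply: lerD; last by apply: pow_le; apply: (leq_trans psz).
  by rewrite [leLHS]mulrAC ler_pM2r ?invr_gt0 // ler_wpM2l.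
have N2b : `|N2%:R - X%:R * ((1 - l%:R^-1) * V)| <= 2 * (X%:R * (4 ^ v.+1)%:R / 2 ^+ r) + Z%:R :> R.
  have -> : N2 = count (fun k => all (fun p => ~~ (p %| W * k + 1))%N (l :: ps2)) (iota 0 X).
    by apply: eq_count => k; rewrite psE.
  have ul : uniq (l :: ps2) by rewrite /= ups2 andbT mem_filter eqxx.
  have := sieve_AP_core R X (u := W) r ul; rewrite !big_cons; move=> h; apply: le_trans (h _) _.
    by rewrite /= pl lW /=; apply/allP => p /ps2P[-> ->].
  apply: lerD; last by apply: pow_le; rewrite /= !ltnS.
  have : 2 / (l%:R : R) <= 1 by rewrite ler_pdivrMr // mul1r (ler_nat _ 2).
  move=> h2; have -> : 2 * (X%:R * (4 ^ v.+1)%:R / 2 ^+ r) = X%:R / 2 ^+ r * (2 * (4 ^ v.+1)%:R) :> R.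
    by move: (_ ^+ r) => KK; ring.
  apply: ler_wpM2l; first by rewrite divr_ge0 // ltW.
  by apply: ler_pM => //; [rewrite addr_ge0 // divr_ge0 // ltW|lra].
have Z1 : 1 <= (Z%:R : R) by rewrite ler1n expn_gt0.
pose E : R := (4 ^ v.+1)%:R / 2 ^+ r.
have E0 : 0 <= E by rewrite divr_ge0 // ltW.
have l1R : 0 < (l.-1%:R : R) by rewrite ltr0n; clear -l1; lia.
have lE : l%:R = l.-1%:R + 1 :> R by rewrite natr1 prednK.
have lXR : (l%:R : R) <= X%:R by rewrite ler_nat.
have l2R : (2 : R) <= l%:R by rewrite ler_nat.
have X'h : X'%:R * l%:R <= X%:R + l.-1%:R :> R by rewrite -natrM -natrD ler_nat leq_divM.
have X'l : X%:R <= X'%:R * l%:R :> R.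
  rewrite -natrM ler_nat; have := ltn_ceil (X + l.-1) l0; rewrite -/X' mulSn.
  by clear -l0; lia.
have hX1 : X%:R / l%:R <= X'%:R :> R by rewrite ler_pdivrMr.
have hX2 : X'%:R <= X%:R / l%:R + 1 :> R.
  have -> : X%:R / l%:R + 1 = (X%:R + l%:R) / l%:R :> R by field; rewrite gt_eqF.
  by rewrite ler_pdivlMr //; lra.
have hX3 : X'%:R <= 2 * (X%:R / l%:R) :> R.
  by rewrite mulrA ler_pdivlMr //; lra.
set x := X%:R / l%:R in hX1 hX2 hX3.
have x0 : 0 <= x by rewrite divr_ge0.
have {}N1b : `|N1%:R - X'%:R * V| <= X'%:R * E + Z%:R.
  by rewrite /E [X'%:R * (_ / _)]mulrA.
have {}N2b : `|N2%:R - X%:R * ((1 - l%:R^-1) * V)| <= 2 * (X%:R * E) + Z%:R.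
  by rewrite /E [X%:R * (_ / _)]mulrA.
have -> : 16 * (X * 4 ^ v.+1)%:R / (l%:R * 2 ^+ r) = 16 * (x * E).
  by rewrite /x /E natrM invfM -!mulrA; congr (_ * (_ * _)); rewrite mulrCA.
have d0 : N1%:R - N2%:R / l.-1%:R = (N1%:R - X'%:R * V) + (X'%:R - x) * V
    - (N2%:R - X%:R * ((1 - l%:R^-1) * V)) / l.-1%:R.
  rewrite /x lE; field; rewrite gt_eqF // gt_eqF //; lra.
rewrite d0.
apply: (le_trans (ler_normB _ _)).
apply: (@le_trans _ _ ((2 * x * E + Z%:R) + 1 + (4 * x * E + Z%:R))); last first.
  rewrite natrM; nra.
apply: lerD.
  apply: (le_trans (ler_normD _ _)); apply: lerD.
    by apply: (le_trans N1b); rewrite lerD2r; apply: ler_wpM2r.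
  case/andP: V01 => V0 V1; rewrite normrM (ger0_norm V0).
  have : `|X'%:R - x| <= 1 by rewrite ler_norml; apply/andP; split; lra.
  by move=> h; rewrite mulr_ile1.
rewrite normrM normfV (gtr0_norm l1R) ler_pdivrMr //.
apply: (le_trans N2b).
have e : X%:R * E <= 2 * x * E * l.-1%:R.
  have -> : 2 * x * E * l.-1%:R = (2 * x * l.-1%:R) * E by ring.
  apply: ler_wpM2r => //.
  have xl : x * l%:R = X%:R by rewrite /x divfK // gt_eqF.
  by rewrite -xl lE; nra.
have z : Z%:R <= Z%:R * l.-1%:R :> R.
  by rewrite ler_peMr // ler1n; clear -l1; lia.
have -> : (4 * x * E + Z%:R) * l.-1%:R = 2 * (2 * x * E * l.-1%:R) + Z%:R * l.-1%:R by ring.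
lra.
Qed.

(** * Discrepancy of the primes congruent to 1 modulo W *)
(** The primes up to 2^v are left out, so that these primes and [rough_composites]
    together exhaust the rough numbers greater than 1 in the progression. *)
Definition ap_primes (W v i : nat) :=
  [seq n <- iota 2 (2 ^ i).-1 | [&& n %% W == 1 %% W, 2 ^ v < pdiv n & prime n]%N].

Lemma rough_pdiv W v n : (1 < n)%N -> (n %% W == 1 %% W)%N ->
  is_rough W v n = (2 ^ v < pdiv n)%N.
Proof.
move=> n1 nW; apply/allP/idP => [h|h p].
  rewrite ltnNge; apply/negP => hp.
  have /h : pdiv n \in sieving_primes W v.
    rewrite mem_sieving_primes pdiv_prime // hp !andbT; apply/negP => pW.
    have : (pdiv n %| 1)%N.
      have e : (n = 1 %[mod pdiv n])%N.
        by move/eqP: nW => /(congr1 (modn^~ (pdiv n))); rewrite !modn_dvdm.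
      by rewrite /dvdn -e; have := pdiv_dvd n; rewrite /dvdn => /eqP ->.
    by rewrite dvdn1 => /eqP e; have := pdiv_prime n1; rewrite e.
  by rewrite pdiv_dvd.
rewrite mem_sieving_primes => /and3P[_ pp hp]; apply/negP => pn.
have := pdiv_min_dvd (prime_gt1 pp) pn; by rewrite leqNgt (leq_ltn_trans hp).
Qed.

Lemma dvdn_primes_count (s : seq nat) n : uniq s -> all prime s -> (0 < n)%N ->
  (2 ^ count (fun p => p %| n) s <= n)%N.
Proof.
move=> us ps n0; rewrite -size_filter; set t := filter _ _.
have ut : uniq t by apply: filter_uniq.
have pt : all prime t by apply/allP => p; rewrite mem_filter => /andP[_ /(allP ps)].
have dt : all (fun p => p %| n)%N t by apply/allP => p; rewrite mem_filter => /andP[].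
have := dvdn_leq n0 (prod_primes_dvdn ut pt dt); apply: leq_trans.
elim: t pt {ut dt} => [|p t IH] /=; first by rewrite big_nil.
by move=> /andP[pp pt]; rewrite big_cons expnS leq_mul ?IH // prime_gt1.
Qed.

Section PrimeDisc.
Variables (R : realFieldType) (lg : nat -> R) (B : R) (b0 b1 W v s i r : nat).
Hypothesis B0 : 0 <= B.
Hypothesis lgB : forall l, l \in moduli b0 b1 -> 0 <= lg l <= B.
Hypothesis W0 : (0 < W)%N.
Hypothesis Wb : (W <= 2 ^ b0)%N.
Hypothesis i0 : (0 < i)%N.
Hypothesis v0 : (0 < v)%N.
Hypothesis sv : (6 * s <= v)%N.
Hypothesis sb0 : (3 * s <= b0)%N.
Hypothesis b01 : (b0 + b1 <= i)%N.
Hypothesis b1i : (2 * b1 + 6 * s <= i)%N.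

Local Notation g := (disc_weight lg b0 b1).

Lemma moduli_prime l : l \in moduli b0 b1 -> prime l.
Proof. by rewrite mem_moduli => /and3P[]. Qed.

Lemma moduli_size : (size (moduli b0 b1) <= 2 ^ b1)%N.
Proof.
rewrite -[X in (_ <= X)%N](size_iota 1); apply: uniq_leq_size (moduli_uniq _ _) _ => l.
by rewrite mem_moduli mem_iota add1n ltnS => /and3P[_ /prime_gt0 -> /andP[]].
Qed.

Lemma moduli_inv_sum : \sum_(l <- moduli b0 b1) l%:R^-1 <= i.+1%:R :> R.
Proof.
apply: le_trans (harmonic_pow2_le R i); apply: ler_sum_sub.
- exact: moduli_uniq.
- move=> l; rewrite mem_moduli mem_iota add1n ltnS => /and3P[_ /prime_gt0 -> /andP[_ h]].
  by apply: (leq_trans h); rewrite leq_exp2l //; clear -b1i; lia.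
- by move=> l _; rewrite invr_ge0.
Qed.

(** A trivial bound, used for the composite numbers lost in [size_dropped]: n - 1
    has at most i prime factors and the sum of 1 / l is at most i + 1. *)
Lemma disc_weight_bound n : (1 < n <= 2 ^ i)%N -> `|g n| <= B * (3 * i + 2)%:R.
Proof.
move=> /andP[n1 nY]; apply: (le_trans (ler_norm_sum _ _ _)).
apply: (@le_trans _ _ (\sum_(l <- moduli b0 b1) B * ((l %| n.-1)%N%:R + 2 * l%:R^-1))).
  rewrite big_seq [leRHS]big_seq; apply: ler_sum => l lL.
  have /andP[g0 gB] := lgB lL; have pl := moduli_prime lL.
  have l1 := prime_gt1 pl; have l0 := prime_gt0 pl.
  rewrite normrM (ger0_norm g0); apply: ler_pM => //.
  have e : (n %% l == 1)%N = (l %| n.-1)%N.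
    by rewrite -subn1 -eqn_mod_dvd ?(ltnW n1) // (modn_small l1).
  rewrite /local_disc e; apply: (le_trans (ler_normB _ _)); rewrite normr_nat lerD2l.
  have lR : 0 < (l%:R : R) by rewrite ltr0n.
  have l1R : 0 < (l.-1%:R : R) by rewrite ltr0n; clear -l1; lia.
  rewrite normrM normfV !normr_nat -/(2 / l%:R) ler_pdivrMr // mulrAC ler_pdivlMr // -!natrM ler_nat.
  by clear -l1; case: (~~ _); lia.
rewrite -mulr_sumr; apply: ler_wpM2l => //; rewrite big_split /= -mulr_sumr.
have h1 : \sum_(l <- moduli b0 b1) (l %| n.-1)%N%:R <= i%:R :> R.
  have -> : \sum_(l <- moduli b0 b1) (l %| n.-1)%N%:R = (count (fun l => l %| n.-1)%N (moduli b0 b1))%:R :> R.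
    rewrite -sum1_count natr_sum [RHS]big_mkcond /=; apply: eq_bigr => l _; by case: (_ %| _)%N.
  rewrite ler_nat -(@leq_exp2l 2) //.
  have ap : all prime (moduli b0 b1) by apply/allP => l; exact: moduli_prime.
  apply: (leq_trans (dvdn_primes_count (moduli_uniq _ _) ap _)); first by clear -n1; lia.
  by apply: leq_trans nY; rewrite leq_pred.
have h2 := moduli_inv_sum.
have -> : (3 * i + 2)%:R = i%:R + 2 * i.+1%:R :> R by rewrite -natrM -natrD; congr _%:R; clear; lia.
lra.
Qed.

Lemma rough_disc (X : nat) : (2 ^ b1 <= X <= 2 ^ i)%N ->
  `|\sum_(0 <= k < X | is_rough W v (W * k + 1)) g (W * k + 1)|
    <= B * (16 * (2 ^ i * 4 ^ v.+1)%:R / 2 ^+ r * i.+1%:R + (4 * 2 ^ (v.+1 * r) * 2 ^ b1)%:R).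
Proof.
move=> /andP[bX XY].
have X0 : (0 < X)%N by apply: leq_trans bX; rewrite expn_gt0.
rewrite exchange_big /=; apply: (le_trans (ler_norm_sum _ _ _)).
apply: (@le_trans _ _ (\sum_(l <- moduli b0 b1)
   B * (16 * (2 ^ i * 4 ^ v.+1)%:R / 2 ^+ r * l%:R^-1 + (4 * 2 ^ (v.+1 * r))%:R))).
  rewrite big_seq [leRHS]big_seq; apply: ler_sum => l lL.
  have /andP[g0 gB] := lgB lL; have pl := moduli_prime lL.
  rewrite -mulr_sumr normrM (ger0_norm g0); apply: ler_pM => //.
  have Wl : (W < l)%N.
    by apply: leq_ltn_trans Wb _; move: lL; rewrite mem_moduli => /and3P[_ _ /andP[]].
  have lX : (l <= X)%N.
    by apply: leq_trans bX; move: lL; rewrite mem_moduli => /and3P[_ _ /andP[]].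
  apply: (le_trans (rough_local_disc R r pl v0 W0 Wl X0 lX)); rewrite lerD2r.
  rewrite invfM mulrA [leLHS]mulrAC; apply: ler_wpM2r; first by rewrite invr_ge0.
  apply: ler_wpM2r; first by rewrite invr_ge0 exprn_ge0.
  by rewrite ler_pM2l // ler_nat leq_mul2r XY orbT.
rewrite -mulr_sumr; apply: ler_wpM2l => //; rewrite big_split /= -mulr_sumr; apply: lerD.
  apply: ler_wpM2l; last exact: moduli_inv_sum.
  by rewrite mulr_ge0 // ?mulr_ge0 // invr_ge0 exprn_ge0.
rewrite big_const_seq count_predT iter_addr_0 -[leLHS]mulr_natr -natrM ler_nat.
by rewrite leq_mul2l moduli_size orbT.
Qed.

Lemma disc_weight1 : `|g 1%N| <= B * (2 ^ b1)%:R.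
Proof.
apply: (le_trans (ler_norm_sum _ _ _)).
apply: (@le_trans _ _ (\sum_(l <- moduli b0 b1) B)).
  rewrite big_seq [leRHS]big_seq; apply: ler_sum => l lL.
  have /andP[g0 gB] := lgB lL; have pl := moduli_prime lL; have l1 := prime_gt1 pl.
  rewrite normrM (ger0_norm g0) -[leRHS]mulr1; apply: ler_pM => //.
  rewrite /local_disc modn_small // eqxx dvdn1 gtn_eqF //=.
  have : (1 : R) <= l.-1%:R by rewrite ler1n; clear -l1; lia.
  move=> h; have i0' : 0 <= (l.-1%:R : R)^-1 by rewrite invr_ge0.
  have i1' : (l.-1%:R : R)^-1 <= 1 by rewrite invf_le1 //; lra.
  by rewrite mulr1n mul1r ler_norml; apply/andP; split; lra.
rewrite big_const_seq count_predT iter_addr_0 -[leLHS]mulr_natr; apply: ler_wpM2l => //.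
by rewrite ler_nat moduli_size.
Qed.

(** Primes = rough numbers - rough composites - {1}.  The four terms bound, in this
    order, the boxes of composites, the composites lost by the decoupling, and the
    two error terms of the sieve, the last of which absorbs n = 1. *)
Lemma prime_disc :
  `|\sum_(n <- ap_primes W v i) g n|
    <= B * ((i.+1 * 2 ^ s.+1 * W)%:R * ((1100 * i * 2 ^ i)%:R / 8 ^+ s)
       + (i.+3 * 2 ^ i)%:R / 2 ^+ s * (3 * i + 2)%:R
       + 16 * (2 ^ i * 4 ^ v.+1)%:R / 2 ^+ r * i.+1%:R
       + (5 * 2 ^ (v.+1 * r) * 2 ^ b1)%:R).
Proof.
pose X := ((2 ^ i).-1 %/ W).+1.
have Y0 : (0 < 2 ^ i)%N by rewrite expn_gt0.
have hX : (2 ^ b1 <= X <= 2 ^ i)%N.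
  apply/andP; split.
    apply: (@leq_trans (2 ^ i %/ 2 ^ b0)).
      by rewrite -expnB // ?leq_exp2l //; clear -b01; lia.
    apply: (@leq_trans (2 ^ i %/ W)); first exact: leq_div2l.
    rewrite /X -[X in (X %/ W)%N](prednK Y0).
    by rewrite divnS //; case: (_ %| _)%N.
  rewrite /X -[X in (_ < X)%N](prednK Y0) ltnS; exact: leq_div.
have split : \sum_(0 <= k < X | is_rough W v (W * k + 1)) g (W * k + 1)
   = g 1%N + \sum_(n <- rough_composites W v i) g n + \sum_(n <- ap_primes W v i) g n.
  rewrite big_ltn_cond // muln0 add0n.
  have -> : is_rough W v 1 = true.
    by apply/allP => p; rewrite mem_sieving_primes dvdn1 => /and3P[_ /prime_gt1 p1 _]; rewrite gtn_eqF.
  rewrite -addrA; congr (_ + _).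
  have -> : \sum_(1 <= k < X | is_rough W v (W * k + 1)) g (W * k + 1) =
     \sum_(n <- [seq n <- iota 2 (2 ^ i).-1 | (n %% W == 1 %% W) && (2 ^ v < pdiv n)]%N) g n.
    rewrite -big_filter -(big_map (fun k => W * k + 1)%N xpredT g).
    apply: perm_big; apply: uniq_perm; last 1 first.
    - move=> n; rewrite mem_filter mem_iota add2n prednK // ltnS.
      apply/mapP/idP => [[k]|/andP[/andP[h1 h2] /andP[h3 h4]]].
        rewrite mem_filter mem_index_iota => /andP[hr /andP[k1 kX]] ->.
        have n1 : (1 < W * k + 1)%N by rewrite addn1 ltnS muln_gt0 W0 k1.
        have nW : ((W * k + 1) %% W == 1 %% W)%N by rewrite mulnC modnMDl.
        rewrite nW -(rough_pdiv v n1 nW) hr n1 /= addn1.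
        move: kX; rewrite /X ltnS leq_divRL // mulnC => h; apply: (leq_ltn_trans h).
        by rewrite prednK.
      have n1 : (1 < n)%N by [].
      exists (n.-1 %/ W)%N.
        have hd : (W %| n.-1)%N by rewrite -subn1 -eqn_mod_dvd ?(ltnW n1).
        have e : (W * (n.-1 %/ W) + 1 = n)%N by rewrite mulnC divnK // addn1 prednK // ltnW.
        rewrite mem_filter e rough_pdiv // h2 mem_index_iota /= divn_gt0 // /X ltnS.
        rewrite leq_div2r ?andbT; first by apply: dvdn_leq => //; clear -n1; lia.
        by clear -h4; lia.
      have hd : (W %| n.-1)%N by rewrite -subn1 -eqn_mod_dvd ?(ltnW n1).
      by rewrite mulnC divnK // addn1 prednK // ltnW.
    - rewrite map_inj_uniq ?filter_uniq ?iota_uniq // => a b /eqP.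
      by rewrite eqn_add2r eqn_pmul2l // => /eqP.
    - exact/filter_uniq/iota_uniq.
  rewrite (bigID prime) /= addrC !big_filter_cond.
  by congr (_ + _); apply: eq_bigl => n; rewrite /= ?andbT -?andbA.
have h1 := rough_disc hX.
have h2 := disc_weight1.
have h3 := composite_disc B0 lgB W0 i0 sv sb0 b1i disc_weight_bound.
have -> : \sum_(n <- ap_primes W v i) g n =
  \sum_(0 <= k < X | is_rough W v (W * k + 1)) g (W * k + 1) - g 1%N - \sum_(n <- rough_composites W v i) g n.
  by rewrite split; ring.
apply: (le_trans (ler_normB _ _)); apply: (le_trans (lerD (ler_normB _ _) (lexx _))).
apply: (le_trans (lerD (lerD h1 h2) h3)).
rewrite -[in leRHS]mulnA natrM.
have -> : (4 * 2 ^ (v.+1 * r) * 2 ^ b1)%:R = 4 * (2 ^ (v.+1 * r) * 2 ^ b1)%:R :> R by rewrite -mulnA natrM.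
have hz : (2 ^ b1)%:R <= (2 ^ (v.+1 * r) * 2 ^ b1)%:R :> R by rewrite ler_nat leq_pmull // expn_gt0.
have := ler_wpM2l B0 hz.
set z := (2 ^ (v.+1 * r) * 2 ^ b1)%:R; set y := (2 ^ b1)%:R => hyz.
set a1 := (_ / 2 ^+ r * _); set a2 := (_%:R * (_ / 8 ^+ s)).
set a3 := (_ / 2 ^+ s); set a4 := (3 * i + 2)%:R.
have -> : (i.+1 * 2 ^ s.+1 * W)%:R * ((1100 * i * 2 ^ i)%:R * B / 8 ^+ s) = B * a2.
  by rewrite /a2; ring.
lra.
Qed.

End PrimeDisc.

(** * The norm form of Z[x] / (Phi) *)
Section MulMatrix.
Variables (n : nat) (Phi : {poly int}).
Hypothesis Pmon : Phi \is monic.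
Hypothesis Psz : size Phi = n.+1.

Local Notation red p := (Pdiv.CommonRing.rmodp p Phi).
Local Notation quo p := (Pdiv.CommonRing.rdivp p Phi).

(** Multiplication by p on Z[x] / (Phi) in the basis of the powers of x, acting on
    row vectors; its determinant is the norm of p. *)
Definition mul_mx (p : {poly int}) : 'M[int]_n := \matrix_(i < n) poly_rV (red ('X^i * p)).

Lemma Phi_neq0 : Phi != 0.
Proof. by rewrite -size_poly_eq0 Psz. Qed.

Lemma size_red p : (size (red p) <= n)%N.
Proof. by rewrite -ltnS -Psz Pdiv.CommonRing.ltn_rmodpN0 // Phi_neq0. Qed.

(** Stated after an arbitrary ring morphism, because it will be used over Z and
    over the prime fields. *)
Lemma mul_mxP (R : comNzRingType) (f : {rmorphism int -> R}) (u : 'rV[R]_n) p :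
  exists k : {poly R}, rVpoly u * map_poly f p = k * map_poly f Phi + rVpoly (u *m map_mx f (mul_mx p)).
Proof.
exists (\sum_(i < n) u 0 i *: map_poly f (quo ('X^i * p))).
rewrite mulmx_sum_row linear_sum /= {1}[u]row_sum_delta linear_sum /= !mulr_suml -big_split /=.
apply: eq_bigr => i _; rewrite !linearZ /= rVpoly_delta -!scalerAl -scalerDr; congr (_ *: _).
have -> : row i (map_mx f (mul_mx p)) = poly_rV (map_poly f (red ('X^i * p))).
  by rewrite -map_row rowK map_poly_rV.
rewrite poly_rV_K; last by apply: leq_trans (size_red ('X^i * p)); exact: size_poly.
by rewrite -rmorphM -rmorphD /= -Pdiv.RingMonic.rdivp_eq // rmorphM /= map_polyXn.
Qed.

Definition poly_norm p : int := \det (mul_mx p).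

Lemma mul_mx_addC (a : int) p : mul_mx (a%:P + p) = a%:M + mul_mx p.
Proof.
apply/matrixP => i j; rewrite !mxE mulrDr Pdiv.RingMonic.rmodpD // coefD; congr (_ + _).
rewrite mulrC mul_polyC Pdiv.RingMonic.rmodpZ // coefZ Pdiv.CommonRing.rmodp_small; last first.
  by rewrite size_polyXn Psz ltnS.
by rewrite coefXn mulr_natr -val_eqE /= eq_sym.
Qed.

(** As a function of the constant term a, the norm is a characteristic polynomial,
    hence monic of degree n: it takes each value at most n times. *)
Lemma poly_norm_roots (v : int) p (s : seq int) : uniq s ->
  all (fun a => poly_norm (a%:P + p) == v) s -> (0 < n)%N -> (size s <= n)%N.
Proof.
(* a + M is a characteristic matrix of - M evaluated at a *)
move=> us hs n0; pose P := char_poly (- mul_mx p) - v%:P.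
have PE a : P.[a] = poly_norm (a%:P + p) - v.
  rewrite hornerD hornerN hornerC; congr (_ - _).
  rewrite /poly_norm mul_mx_addC /char_poly.
  transitivity (\det (map_mx (horner_eval a) (char_poly_mx (- mul_mx p)))).
    by rewrite det_map_mx.
  congr (\det _); apply/matrixP => i j; rewrite !mxE /horner_eval hornerD hornerN hornerMn hornerX hornerC opprK.
  by [].
have sP : size P = n.+1.
  rewrite /P size_polyDl ?size_char_poly // size_polyN.
  by apply: leq_ltn_trans (size_polyC_leq1 _) _.
have P0 : P != 0 by rewrite -size_poly_eq0 sP.
rewrite -ltnS -sP; apply: max_poly_roots => //.
by apply/allP => a /(allP hs); rewrite /root PE subr_eq0.
Qed.

Lemma poly_norm_bound : exists C0 : nat, forall (p : {poly int}) (B : nat),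
  (size p <= n)%N -> (forall k, `|p`_k| <= B%:Z) -> `|poly_norm p| <= (C0 * B ^ n)%N%:Z.
Proof.
pose e (i k j : nat) : nat := `|((red 'X^(i + k))`_j)%R|%N.
pose E := (\sum_(i < n) \sum_(k < n) \sum_(j < n) e i k j)%N.
exists (n`! * E ^ n)%N => p B sp hB.
have ent i j : `|mul_mx p i j| <= (E * B)%N%:Z.
  rewrite mxE mxE -{1}(coefK p) poly_def mulr_sumr Pdiv.RingMonic.rmodp_sum //.
  rewrite coef_sum; apply: (le_trans (ler_norm_sum _ _ _)).
  apply: (@le_trans _ _ (\sum_(k < size p) B%:Z * (e i k j)%:Z)).
    apply: ler_sum => k _; rewrite -scalerAr -exprD Pdiv.RingMonic.rmodpZ // coefZ normrM.
    by apply: ler_pM; rewrite ?normr_ge0 // /e abszE.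
  rewrite -mulr_sumr mulnC PoszM; apply: ler_wpM2l => //.
  rewrite -(big_mkord xpredT (fun k => (e i k j)%:Z)).
  rewrite -(natz (\sum_(i < n) _)%N) natr_sum.
  apply: (@le_trans _ _ (\sum_(0 <= k < n) (e i k j)%:Z)).
    rewrite [leRHS](big_cat_nat (n := size p)) //= lerDl; exact: sumr_ge0.
  rewrite big_mkord [leRHS](bigD1 i) //= -[leLHS]addr0; apply: lerD; last first.
    by apply: sumr_ge0.
  rewrite natz -[leRHS]natz natr_sum; apply: ler_sum => k _.
  rewrite natz (bigD1 j) //= lez_nat; exact: leq_addr.
apply: (le_trans (ler_norm_sum _ _ _)).
apply: (@le_trans _ _ (\sum_(s : {perm 'I_n}) ((E * B) ^ n)%N%:Z)).
  apply: ler_sum => s _; rewrite normrM normrX normrN1 expr1n mul1r normr_prod.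
  apply: (@le_trans _ _ (\prod_(i < n) (E * B)%N%:Z)).
    by apply: ler_prod => i _; rewrite normr_ge0 /=.
  by rewrite prodr_const card_ord -!natz natrX.
by rewrite sumr_const card_Sn -[leLHS]mulr_natl natz -PoszM lez_nat expnMn mulnA.
Qed.

Hypothesis Pirr : forall u p k : {poly int}, (size u <= n)%N -> (size p <= n)%N ->
  u * p = k * Phi -> u = 0 \/ p = 0.

(** A kernel vector of the multiplication matrix would be a nonzero u with u p
    divisible by Phi. *)
Lemma poly_norm_neq0 (p : {poly int}) : p != 0 -> (size p <= n)%N -> poly_norm p != 0.
Proof.
move=> p0 sp; apply/negP => /det0P[u u0 h].
have [k] := mul_mxP idfun u p.
rewrite !map_poly_id // map_mx_id // h linear0 addr0 => e.
have su : (size (rVpoly u) <= n)%N by exact: size_poly.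
have [u0'|p0'] := Pirr su sp e; last by rewrite p0' eqxx in p0.
by case/negP: u0; apply/eqP; rewrite -(rVpolyK u) u0' linear0.
Qed.

End MulMatrix.

(** * Prime divisors of values of the norm form *)
(** The hypothesis says that the kernel meets every coordinate hyperplane, as it
    does when its dimension is at least 2; then every minor of size n - 1 is 0. *)
Lemma adj_eq0 (F : fieldType) (n : nat) (A : 'M[F]_n) :
  (forall i : 'I_n, exists v : 'rV_n, [/\ v != 0, v 0 i = 0 & v *m A = 0]) -> \adj A = 0.
Proof.
case: n A => [|n] A h; apply/matrixP => j i; first by case: i.
rewrite !mxE /cofactor.
have [v [v0 vi vA]] := h i.
suff -> : \det (row' i (col' j A)) = 0 by rewrite mulr0.
apply/eqP/det0P; exists (col' i v).
  apply: contra_neq v0 => e; apply/rowP => k; rewrite mxE.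
  case: (unliftP i k) => [k' ->|-> //].
  by have /rowP/(_ k') := e; rewrite !mxE.
apply/rowP => k; rewrite mxE [RHS]mxE.
have /rowP/(_ (lift j k)) := vA; rewrite mxE [RHS]mxE.
rewrite (bigD1_ord i) //= vi mul0r add0r => e; rewrite -[RHS]e.
by apply: eq_bigr => l _; rewrite !mxE.
Qed.

(** If q divides all entries of the adjugate of M, then the determinant d satisfies
    q^n d | d^n, because M adj M = d I. *)
Lemma dvdz_sqr_det (n q : nat) (M : 'M[int]_n) : prime q -> (0 < n)%N ->
  map_mx (intr : int -> 'F_q) (\adj M) = 0 -> (q%:Z ^+ 2 %| \det M)%Z.
Proof.
move=> pq n0 h.
have [->|d0] := eqVneq (\det M) 0; first by rewrite dvdz0.
pose B := \matrix_(i < n, j < n) (\adj M i j %/ q%:Z)%Z.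
have e : \adj M = q%:Z *: B.
  apply/matrixP => i j; rewrite [RHS]mxE [X in _ * X]mxE mulrC divzK //.
  rewrite (dvdz_pcharf (pchar_Fp pq)).
  by have /matrixP/(_ i j) := h; rewrite !mxE => ->.
have := congr1 determinant (mul_mx_adj M).
rewrite det_mulmx e detZ det_scalar => e2.
have := congr1 absz e2; rewrite !abszM !abszX /=; set d := `|\det M|%N => e3.
have dpos : (0 < d)%N by rewrite absz_gt0.
rewrite dvdzE abszX /= -/d pfactor_dvdn //.
have dv : (q ^ n * d %| d ^ n)%N.
  by rewrite -e3 mulnCA mulnA dvdn_mulr.
have dn0 : (0 < d ^ n)%N by rewrite expn_gt0 dpos.
have := dvdn_leq_log q dn0 dv.
have qn0 : (0 < q ^ n)%N by rewrite expn_gt0 prime_gt0.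
rewrite lognM // (pfactorK n pq) (lognX q d n).
by case: (logn q d) => [|[|k]] //; clear -n0; lia.
Qed.

Section NormDvd.
Variables (n : nat) (Phi : {poly int}).
Hypothesis n0 : (0 < n)%N.
Hypothesis Pmon : Phi \is monic.
Hypothesis Psz : size Phi = n.+1.
Variable q : nat.
Hypothesis pq : prime q.

Local Notation F := 'F_q.
Local Notation "p ^%q" := (map_poly (intr : int -> F) p) (at level 2, format "p ^%q").

Lemma Phif_size : size Phi^%q = n.+1.
Proof. by rewrite size_map_poly_id0 // (monicP Pmon) rmorph1 oner_neq0. Qed.

Lemma Phif_neq0 : Phi^%q != 0.
Proof. by rewrite -size_poly_eq0 Phif_size. Qed.

(** A kernel vector modulo q is a polynomial u of degree < n with Phi | u p, which
    is impossible when p is prime to Phi. *)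
Lemma norm_dvd_ncoprime p : (q%:Z %| poly_norm n Phi p)%Z -> ~~ coprimep p^%q Phi^%q.
Proof.
rewrite (dvdz_pcharf (pchar_Fp pq)) /poly_norm -det_map_mx => /det0P[u u0 h].
have [k] := mul_mxP Pmon Psz (intr : {rmorphism int -> F}) u p.
rewrite h linear0 addr0 => e; apply/negP => cop.
have : Phi^%q %| rVpoly u * p^%q by rewrite e dvdp_mull.
rewrite Gauss_dvdpl; last by rewrite coprimep_sym.
move=> /dvdp_leq; have ru : rVpoly u != 0.
  by apply: contra_neq u0 => e'; rewrite -(rVpolyK u) e' linear0.
move=> /(_ ru); rewrite Phif_size ltnNge => /negP; apply; exact: size_poly.
Qed.

(** If h divides both p and Phi, then the multiples of Phi / h of degree < n are
    killed by p modulo Phi. *)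
Lemma kernel_vec p (h c : {poly F}) : h %| p^%q -> h %| Phi^%q -> (size c < size h)%N ->
  let u : 'rV[F]_n := poly_rV (c * (Phi^%q %/ h)) in
  rVpoly u = c * (Phi^%q %/ h) /\ u *m map_mx intr (mul_mx n Phi p) = 0.
Proof.
move=> hp hP sc u.
have Pe : Phi^%q = (Phi^%q %/ h) * h by rewrite divpK.
have h0 : h != 0 by apply: contraTneq hP => ->; rewrite dvd0p Phif_neq0.
have d0 : Phi^%q %/ h != 0.
  by apply: contra_neq Phif_neq0 => e; rewrite Pe e mul0r.
have su : (size (c * (Phi^%q %/ h))%R <= n)%N.
  have := Phif_size; rewrite {1}Pe size_mul // => e.
  have hs : (0 < size h)%N by rewrite size_poly_gt0.
  apply: (leq_trans (size_polyMleq _ _)); move: (size _) (size h) (size c) e hs sc; clear; lia.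
have ue : rVpoly u = c * (Phi^%q %/ h) by rewrite /u poly_rV_K.
split=> //.
have [k] := mul_mxP Pmon Psz (intr : {rmorphism int -> F}) u p.
rewrite ue; set r := rVpoly (u *m _) => e.
have er : r = (c * (p^%q %/ h) - k) * Phi^%q.
  have : r = c * (Phi^%q %/ h) * p^%q - k * Phi^%q by rewrite e addrC addKr.
  move=> ->; rewrite mulrBl; congr (_ - _).
  by rewrite -{1}(divpK hp) [in RHS]Pe; ring.
have sr : (size r <= n)%N by exact: size_poly.
have r0 : r = 0.
  apply/eqP; apply: contraTT sr => r0; rewrite -ltnNge -Phif_size.
  by apply: dvdp_leq => //; rewrite er dvdp_mull.
by rewrite -(rVpolyK (u *m _)) -/r r0 linear0.
Qed.

Lemma norm_dvd_common_factor p (h : {poly F}) : (1 < size h)%N -> h %| p^%q -> h %| Phi^%q ->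
  (q%:Z %| poly_norm n Phi p)%Z.
Proof.
move=> sh hp hP.
have [] := @kernel_vec p h 1 hp hP; first by rewrite size_poly1.
set u : 'rV[F]_n := poly_rV _ => ue uM.
rewrite (dvdz_pcharf (pchar_Fp pq)) /poly_norm -det_map_mx; apply/det0P; exists u => //.
apply/eqP => u0; move: ue; rewrite u0 linear0 mul1r => e.
by move: Phif_neq0; rewrite -(divpK hP) -e mul0r eqxx.
Qed.

(** A common factor of degree at least 2 makes the kernel at least 2-dimensional.
    A second factor q is what makes the sum over these q converge. *)
Lemma norm_sqr_dvd_common_factor p (h : {poly F}) : (2 < size h)%N -> h %| p^%q -> h %| Phi^%q ->
  (q%:Z ^+ 2 %| poly_norm n Phi p)%Z.
Proof.
move=> sh hp hP; apply: dvdz_sqr_det => //.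
rewrite map_mx_adj; apply: adj_eq0 => i.
pose D := Phi^%q %/ h.
have D0 : D != 0 by apply: contra_neq Phif_neq0 => e; rewrite -(divpK hP) -/D e mul0r.
have key (c : {poly F}) : c != 0 -> (size c < size h)%N -> (c * D)`_i = 0 ->
  exists v : 'rV[F]_n, [/\ v != 0, v 0 i = 0 & v *m map_mx intr (mul_mx n Phi p) = 0].
  move=> c0 sc ci; have [] := @kernel_vec p h c hp hP sc.
  set u : 'rV[F]_n := poly_rV _ => ue uM; exists u; split=> //.
    apply/eqP => u0; move: ue; rewrite u0 linear0 => /esym/eqP; rewrite mulf_eq0.
    by rewrite (negPf c0) (negPf D0).
  by rewrite /u mxE.
have [a0|a0] := eqVneq D`_i 0.
  by apply: (key 1); rewrite ?oner_neq0 ?mul1r // size_poly1; apply: ltn_trans sh.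
(* a combination of D and x D chosen to have i-th coefficient 0 *)
apply: (key ((('X * D)`_i)%:P - D`_i *: 'X)).
- apply: contraTneq isT => e; have := congr1 (fun t : {poly F} => t`_1) e.
  rewrite coefB coefC coefZ coefX /= mulr1 coef0 sub0r => /eqP; rewrite oppr_eq0.
  by rewrite (negPf a0).
- apply: leq_ltn_trans sh; apply: (leq_trans (size_polyD _ _)); rewrite geq_max size_polyN.
  rewrite (leq_trans (size_polyC_leq1 _)) //=.
  by apply: (leq_trans (size_scale_leq _ _)); rewrite size_polyX.
- by rewrite mulrBl -scalerAl mul_polyC coefB !coefZ mulrC subrr.
Qed.

End NormDvd.

(** * Cyclotomic polynomials modulo a prime *)
(** Irreducibility of 'Phi_W, in the form needed by [poly_norm_neq0]: evaluate at
    a primitive root, whose minimal polynomial has degree totient W. *)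
Lemma Cyclotomic_prime_ideal W (u p k : {poly int}) : (0 < W)%N ->
  (size u <= totient W)%N -> (size p <= totient W)%N ->
  u * p = k * 'Phi_W -> u = 0 \/ p = 0.
Proof.
move=> W0 su sp e.
have [z pz] := C_prim_root_exists W0.
have rz : root (map_poly (intr : int -> algC) 'Phi_W) z.
  by rewrite (Cintr_Cyclotomic pz) root_cyclotomic.
have key (r : {poly int}) : (size r <= totient W)%N ->
    root (map_poly (intr : int -> algC) r) z -> r = 0.
  move=> sr rr; apply/eqP; apply: contraTT sr => r0; rewrite -ltnNge.
  have [f [fE _] fP] := minCpolyP z.
  have := congr1 (fun t : {poly algC} => size t) fE.
  rewrite (minCpoly_cyclotomic pz) size_cyclotomic size_map_poly => sf.
  have re : map_poly (intr : int -> algC) r = map_poly ratr (map_poly (intr : int -> rat) r).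
    by rewrite -map_poly_comp; apply: eq_map_poly => t /=; rewrite rmorph_int.
  move: rr; rewrite re fP => /dvdp_leq.
  rewrite -size_poly_eq0 size_map_inj_poly //; last exact: intr_inj.
  by rewrite size_poly_eq0 -sf => /(_ r0).
have : root (map_poly (intr : int -> algC) (u * p)) z.
  by rewrite e rmorphM rootM rz orbT.
by rewrite rmorphM rootM => /orP[] /key h; [left|right]; apply: h.
Qed.

Lemma root_prod_has (R : idomainType) (I : Type) (s : seq I) (f : I -> {poly R}) x :
  root (\prod_(i <- s) f i) x = has (fun i => root (f i) x) s.
Proof.
elim: s => [|i s IH]; first by rewrite big_nil rootE hornerC oner_eq0.
by rewrite big_cons rootM IH.
Qed.

(** A root g of 'Phi_W modulo q has exact order W, since 'X^W - 1 is separable and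
    its factors 'Phi_d with d < W are prime to 'Phi_W; so W divides q - 1. *)
Lemma root_Cyclotomic_Fp W q (g : 'F_q) : (0 < W)%N -> prime q -> ~~ (q %| W)%N ->
  root (map_poly intr 'Phi_W) g -> (q %% W = 1 %% W)%N.
Proof.
move=> W0 pq nqW rg.
have prodP d : (0 < d)%N -> \prod_(e <- divisors d) map_poly (intr : int -> 'F_q) 'Phi_e = 'X^d - 1.
  move=> d0; have := congr1 (map_poly (intr : int -> 'F_q)) (prod_Cyclotomic d0).
  by rewrite rmorph_prod rmorphB rmorph1 /= map_polyXn.
have rX d : root ('X^d - 1 : {poly 'F_q}) g = (g ^+ d == 1).
  by rewrite /root !hornerE subr_eq0.
have gW : g ^+ W = 1.
  apply/eqP; rewrite -rX -prodP // root_prod_has; apply/hasP; exists W => //.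
  by rewrite -dvdn_divisors.
have [d pd dW] := prim_order_exists W0 gW.
have d0 := prim_order_gt0 pd.
have dE : d = W.
  apply/eqP; rewrite eqn_leq dvdn_leq //= leqNgt; apply/negP => lt.
  have : root ('X^d - 1 : {poly 'F_q}) g by rewrite rX prim_expr_order.
  rewrite -prodP // root_prod_has => /hasP[e]; rewrite -dvdn_divisors // => ed /= re.
  have eW : e \in divisors W by rewrite -dvdn_divisors // (dvdn_trans ed).
  have neW : e != W by apply: contraTneq ed => ->; apply/negP => /(dvdn_leq d0); rewrite leqNgt lt.
  have : separable_poly ('X^W - 1 : {poly 'F_q}).
    apply: separable_Xn_sub_1; apply: contra nqW => h.
    by rewrite (dvdn_pcharf (pchar_Fp pq)).
  rewrite -(prodP W W0) (big_rem W) /=; last by rewrite -dvdn_divisors.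
  rewrite separable_mul => /and3P[_ _ cop].
  have : root (\prod_(y <- rem W (divisors W)) map_poly (intr : int -> 'F_q) 'Phi_y) g.
    rewrite root_prod_has; apply/hasP; exists e => //=.
    by rewrite (mem_rem_uniq _ (divisors_uniq W)) !inE neW.
  by rewrite rootE => r0; have := coprimep_root cop rg; rewrite r0.
have g0 : g != 0.
  apply: contra_eq_neq gW => ->; rewrite expr0n; case: (W) W0 => //= _ _; by rewrite eq_sym oner_neq0.
have : g ^+ q.-1 = 1.
  apply: (mulfI g0); rewrite mulr1 -exprS prednK ?prime_gt0 //.
  by rewrite -{2}(expf_card g) card_Fp.
move=> /eqP; rewrite -(prim_order_dvd pd) dE => h.
have q0 := prime_gt0 pq.
by apply/eqP; rewrite eqn_mod_dvd // subn1.
Qed.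

(** A substitute for the factorisation into irreducibles: enough factors h of P to
    detect every polynomial that is not prime to P. *)
Lemma factor_list (F : fieldType) (P : {poly F}) : P != 0 ->
  exists hs : seq {poly F}, [/\ (size hs <= (size P).-1)%N,
    forall h, h \in hs -> (1 < size h)%N /\ h %| P
    & forall a, ~~ coprimep a P -> exists2 h, h \in hs & h %| a].
Proof.
have [N] := ubnP (size P); elim: N P => // N IH P sP P0.
have [sP1|sP1] := leqP (size P) 1.
  exists [::]; split=> // a; have /size_poly1P[c c0 ->] : size P == 1%N.
    by rewrite eqn_leq sP1 size_poly_gt0.
  by rewrite -alg_polyC coprimepZr // coprimep1.
have [[d [dP d1 d2]]|nod] := boolp.pselect (exists d, [/\ d %| P, (1 < size d)%N & (size d < size P)%N]).
  pose e := P %/ d; have Pe : P = e * d by rewrite /e divpK.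
  have d0 : d != 0 by rewrite -size_poly_eq0 -lt0n ltnW.
  have e0 : e != 0 by apply: contra_neq P0 => h; rewrite Pe h mul0r.
  have se : size P = (size e + size d).-1 by rewrite {1}Pe size_mul.
  have [|//|hs [s1 s2 s3]] := IH d; first by rewrite (leq_trans d2).
  have [|//|hs' [s1' s2' s3']] := IH e.
    by move: se sP d1; move: (size e) (size d) (size P); clear; lia.
  have ge0 : (0 < size e)%N by rewrite size_poly_gt0.
  exists (hs ++ hs'); split=> [|h|a].
  - rewrite size_cat; move: se s1 s1' d1 ge0; move: (size e) (size d) (size P) (size hs) (size hs').
    by clear; lia.
  - rewrite mem_cat => /orP[/s2[-> hd]|/s2'[-> hd]]; split=> //.
      by apply: dvdp_trans hd dP.
    by apply: dvdp_trans hd _; rewrite Pe dvdp_mulr.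
  - rewrite Pe coprimepMr negb_and => /orP[/s3'|/s3] [h hh ha]; exists h => //;
    by rewrite mem_cat hh ?orbT.
exists [:: P]; split=> // [|h|a].
- by move: sP1; case: (size P) => [|[]].
- by rewrite inE => /eqP ->.
move=> cop; exists P; rewrite ?mem_head //.
have g0 : gcdp a P != 0 by rewrite gcdp_eq0 negb_and P0 orbT.
have sg : (1 < size (gcdp a P))%N.
  by rewrite ltn_neqAle eq_sym [_ == _](negPf cop) size_poly_gt0.
have gP : gcdp a P %= P.
  apply/negPn/negP => ne; apply: nod; exists (gcdp a P); split=> //; first exact: dvdp_gcdr.
  by rewrite ltn_neqAle dvdp_leq ?dvdp_gcdr // andbT (dvdp_size_eqp (dvdp_gcdr a P)).
by rewrite -(eqp_dvdl _ gP) dvdp_gcdl.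
Qed.

(** * Spacing of the multiples of a factor *)
Section Spacing.
Variables (n : nat) (Phi : {poly int}).
Hypothesis n0 : (0 < n)%N.
Hypothesis Pmon : Phi \is monic.
Hypothesis Psz : size Phi = n.+1.
Hypothesis Pirr : forall u p k : {poly int}, (size u <= n)%N -> (size p <= n)%N ->
  u * p = k * Phi -> u = 0 \/ p = 0.
Variable C0 : nat.
Hypothesis C0P : forall (p : {poly int}) (B : nat),
  (size p <= n)%N -> (forall k, `|p`_k| <= B%:Z) -> `|poly_norm n Phi p| <= (C0 * B ^ n)%N%:Z.
Variable A : nat.

Local Notation box := {ffun 'I_n -> 'I_A}.

Definition box_poly (a : box) : {poly int} := rVpoly (\row_i (a i : nat)%:Z).

Lemma size_box_poly a : (size (box_poly a) <= n)%N.
Proof. exact: size_poly. Qed.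

Lemma box_poly_inj : injective box_poly.
Proof.
move=> a b /(can_inj rVpolyK)/rowP h; apply/ffunP => i; apply: val_inj.
by have := h i; rewrite !mxE => -[].
Qed.

Lemma coef_box_poly_sub_le (a b : box) (B : nat) :
  (forall i, `|(a i : nat)%:Z - (b i : nat)%:Z| <= B%:Z) ->
  forall k, `|(box_poly a - box_poly b)`_k| <= B%:Z.
Proof.
move=> h k; rewrite /box_poly -linearB /= coef_rVpoly; case: insubP => [i _ _|_]; last by rewrite normr0.
by rewrite !mxE.
Qed.

Lemma coef_box_poly_le (a : box) k : `|(box_poly a)`_k| <= A.-1%:Z.
Proof.
rewrite /box_poly coef_rVpoly; case: insubP => [i _ _|_]; last by rewrite normr0.
rewrite !mxE /= -natz normr_nat natz lez_nat -ltnS prednK //.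
by apply: leq_ltn_trans (ltn_ord (a i)).
Qed.

(** Two elements of K differ by a nonzero element whose norm is divisible by D, so
    their difference has a coefficient of size at least r, where r is minimal
    with D <= C r^n.  Cutting the box into cells of side r, each cell contains at
    most one element of K. *)
Lemma class_spacing (D : nat) (K : {set box}) : (0 < D)%N ->
  {in K, forall a, box_poly a != 0 /\ (D%:Z %| poly_norm n Phi (box_poly a))%Z} ->
  {in K &, forall a b, (D%:Z %| poly_norm n Phi (box_poly a - box_poly b))%Z} ->
  (#|K| * D <= 2 ^ n * (C0.+1 * A ^ n))%N.
Proof.
move=> D0 hK hKK.
(* a nonzero element with norm divisible by D cannot have small coefficients *)
have big (p : {poly int}) (B : nat) : (size p <= n)%N -> p != 0 -> (forall k, `|p`_k| <= B%:Z) ->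
    (D%:Z %| poly_norm n Phi p)%Z -> (D <= C0.+1 * B ^ n)%N.
  move=> sp p0 pB dv; have nz := poly_norm_neq0 Pmon Psz Pirr p0 sp.
  apply: (@leq_trans `|poly_norm n Phi p|%N).
    by apply: dvdn_leq; rewrite ?absz_gt0 //; move: dv; rewrite dvdzE.
  have := C0P sp pB; rewrite -abszE lez_nat => h; apply: leq_trans h _.
  by rewrite leq_mul2r leqnSn orbT.
have ex : exists r, (D <= C0.+1 * r ^ n)%N.
  exists D; rewrite -[leqLHS]mul1n leq_mul //.
  by rewrite -{1}(expn1 D) leq_pexp2l.
case: (ex_minnP ex) => r rD rmin.
have r0 : (0 < r)%N.
  by rewrite lt0n; apply: contraTneq rD => ->; rewrite exp0n // muln0 -ltnNge.
have small B : (B < r)%N -> ~~ (D <= C0.+1 * B ^ n)%N.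
  by move=> Br; apply/negP => /rmin; rewrite leqNgt Br.
have [Ar|rA] := ltnP A.-1 r.
  have -> : K = set0.
    apply/setP => a; rewrite inE; apply/negbTE/negP => aK; have [a0 ad] := hK a aK.
    have := big _ _ (size_box_poly a) a0 (coef_box_poly_le a) ad.
    by apply/negP; exact: small.
  by rewrite cards0 mul0n.
pose c := (A.-1 %/ r).+1.
pose cell (a : box) : {ffun 'I_n -> 'I_c} := [ffun i => inord (a i %/ r)].
have cellE a i : cell a i = (a i %/ r)%N :> nat.
  rewrite ffunE inordK // ltnS leq_div2r // -ltnS prednK //.
  by apply: leq_ltn_trans (ltn_ord (a i)).
have inj : {in K &, injective cell}.
  move=> a b aK bK /ffunP e; apply/eqP; apply/negPn/negP => ne.
  have := big (box_poly a - box_poly b) r.-1.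
  have -> : (D <= C0.+1 * r.-1 ^ n)%N = false by apply/negbTE/small; rewrite prednK.
  move=> h; suff : false by []. apply: h => //.
  - by rewrite /box_poly -linearB; exact: size_poly.
  - by rewrite subr_eq0 (inj_eq box_poly_inj).
  - apply: coef_box_poly_sub_le => i.
    have := congr1 val (e i); rewrite /= !cellE => ei.
    have := divn_eq (a i) r; have := divn_eq (b i) r; rewrite ei.
    have := ltn_mod (a i) r; have := ltn_mod (b i) r; rewrite r0.
    move: (a i : nat) (b i : nat) => x y; move: (x %% r)%N (y %% r)%N (y %/ r * r)%N.
    by clear -r0; lia.
  - exact: hKK.
have hc : (#|K| <= c ^ n)%N.
  rewrite -(card_in_imset inj); apply: (leq_trans (max_card _)).
  by rewrite card_ffun !card_ord.
apply: (leq_trans (leq_mul hc rD)).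
rewrite mulnCA [leqRHS]mulnCA leq_mul2l /= -!expnMn leq_exp2r //.
have := leq_trunc_div A.-1 r; rewrite /c mulSn; move: (A.-1 %/ r * r)%N (leq_pred A) rA => x; clear; lia.
Qed.

End Spacing.

(** * Norms divisible by a given prime *)
Section BadPrime.
Variables (n : nat) (Phi : {poly int}).
Hypothesis n0 : (0 < n)%N.
Hypothesis Pmon : Phi \is monic.
Hypothesis Psz : size Phi = n.+1.
Hypothesis Pirr : forall u p k : {poly int}, (size u <= n)%N -> (size p <= n)%N ->
  u * p = k * Phi -> u = 0 \/ p = 0.
Variable C0 : nat.
Hypothesis C0P : forall (p : {poly int}) (B : nat),
  (size p <= n)%N -> (forall k, `|p`_k| <= B%:Z) -> `|poly_norm n Phi p| <= (C0 * B ^ n)%N%:Z.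
Variable A : nat.
Variable R : realFieldType.

Local Notation box := {ffun 'I_n -> 'I_A}.

(** If q divides the norm of a, then a is divisible modulo q by one of the factors of
    [factor_list].  A factor of degree 1 forces a root of Phi modulo q and costs
    1 / q; a factor of higher degree costs 1 / q^2. *)
Lemma norm_dvd_count (q : nat) (rt : bool) : prime q ->
  (forall g : 'F_q, root (map_poly intr Phi) g -> rt) ->
  #|[set a : box | (box_poly a != 0) && (q%:Z %| poly_norm n Phi (box_poly a))%Z]|%:R
   <= n%:R * (2 ^ n * (C0.+1 * A ^ n))%N%:R * (rt%:R / q%:R + (q%:R ^+ 2)^-1) :> R.
Proof.
move=> pq hrt; set K := (2 ^ n * _)%N; set S := [set a | _].
have q0 := prime_gt0 pq.
have qR : 0 < q%:R :> R by rewrite ltr0n.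
have Pf0 := Phif_neq0 Pmon Psz q.
have [hs [s1 s2 s3]] := factor_list Pf0.
rewrite (Phif_size Pmon Psz) /= in s1.
pose cl (h : {poly 'F_q}) := [set a in S | h %| map_poly intr (box_poly a)].
set E := rt%:R / _ + _.
have E0 : 0 <= E by rewrite addr_ge0 ?divr_ge0 ?invr_ge0 ?exprn_ge0 ?ler0n.
have clB h : h \in hs -> #|cl h|%:R <= K%:R * E.
  move=> hh; have [sh hP] := s2 h hh.
  have dvd_sub a b : a \in cl h -> b \in cl h -> h %| map_poly intr (box_poly a - box_poly b).
    rewrite !inE => /andP[_ ha] /andP[_ hb].
    by rewrite rmorphB /= dvdp_sub.
  have [sh2|sh2] := leqP (size h) 2.
    have sh' : size h = 2%N by apply/eqP; rewrite eqn_leq sh2.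
    have rtT : rt.
      have [g rg] : exists g, root h g.
        have h1 : h`_1 != 0 by rewrite -[1%N]/(2.-1) -sh' -lead_coefE lead_coef_eq0 -size_poly_eq0 sh'.
        exists (- h`_0 / h`_1); rewrite rootE horner_coef sh' big_ord_recl big_ord1 /= expr0 mulr1 expr1.
        by rewrite mulrC divfK // subrr.
      apply: (hrt g); have [z ->] := dvdpP _ _ hP; by rewrite rootM rg orbT.
    have := @class_spacing n Phi n0 Pmon Psz Pirr C0 C0P A q (cl h) q0.
    have H1 : {in cl h, forall a, box_poly a != 0 /\ (q %| poly_norm n Phi (box_poly a))%Z}.
      by move=> a; rewrite !inE => /andP[/andP[]].
    have H2 : {in cl h &, forall a b, (q %| poly_norm n Phi (box_poly a - box_poly b))%Z}.
      move=> a b ha hb; apply: (norm_dvd_common_factor Pmon Psz pq sh) => //; exact: dvd_sub.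
    move=> /(_ H1 H2); rewrite -/K -(ler_nat R) natrM -ler_pdivlMr // => h1.
    apply: (le_trans h1); rewrite /E rtT ler_wpM2l ?ler0n // mul1r lerDl.
    by rewrite invr_ge0 exprn_ge0 // ler0n.
  have := @class_spacing n Phi n0 Pmon Psz Pirr C0 C0P A (q ^ 2)%N (cl h).
  have H1 : {in cl h, forall a, box_poly a != 0 /\ ((q ^ 2)%N%:Z %| poly_norm n Phi (box_poly a))%Z}.
    move=> a; rewrite !inE => /andP[/andP[a0 _] ha]; split=> //.
    have := norm_sqr_dvd_common_factor n0 Pmon Psz pq sh2 ha hP.
    by rewrite -(natz q) -natrX natz.
  have H2 : {in cl h &, forall a b, ((q ^ 2)%N%:Z %| poly_norm n Phi (box_poly a - box_poly b))%Z}.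
    move=> a b ha hb; have := norm_sqr_dvd_common_factor n0 Pmon Psz pq sh2 (dvd_sub _ _ ha hb) hP.
    by rewrite -(natz q) -natrX natz.
  rewrite expn_gt0 q0 => /(_ isT H1 H2).
  rewrite -/K -(ler_nat R) natrM -ler_pdivlMr ?ltr0n ?expn_gt0 ?q0 // => h1.
  apply: (le_trans h1); rewrite /E natrX ler_wpM2l ?ler0n // lerDr.
  by rewrite divr_ge0 // ler0n.
have cov : (#|S| <= \sum_(h <- hs) #|cl h|)%N.
  rewrite -sum1_card.
  have -> : (\sum_(h <- hs) #|cl h| = \sum_(a in S) \sum_(h <- hs) (a \in cl h : nat))%N.
    rewrite exchange_big /=; apply: eq_bigr => h _; rewrite -sum1_card.
    rewrite [LHS]big_mkcond [RHS]big_mkcond; apply: eq_bigr => a _.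
    by rewrite [a \in cl h]inE; case: (a \in S) => //=; case: ifP.
  apply: leq_sum => a aS.
  have : ~~ coprimep (map_poly intr (box_poly a)) (map_poly (intr : int -> 'F_q) Phi).
    apply: (norm_dvd_ncoprime Pmon Psz pq); by move: aS; rewrite inE => /andP[].
  move=> /s3[h hh ha]; rewrite (big_rem h) //= inE aS ha //.
rewrite -mulrA; apply: (@le_trans _ _ (\sum_(h <- hs) #|cl h|%:R)).
  by rewrite -natr_sum ler_nat.
apply: (@le_trans _ _ (\sum_(h <- hs) K%:R * E)).
  by rewrite big_seq [leRHS]big_seq; apply: ler_sum.
rewrite big_const_seq count_predT iter_addr_0 -[leLHS]mulr_natl.
by apply: ler_wpM2r; rewrite ?ler_nat // mulr_ge0 // ler0n.
Qed.

End BadPrime.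

(** A q0-smooth number below 2^L is determined by its q0 + 1 exponents, so there are
    only about L^(q0 + 1) of them. *)
Lemma smooth_exponents q0 L v : (0 < v)%N -> (v < 2 ^ L)%N ->
  (forall p, prime p -> (p %| v)%N -> (p <= q0)%N) ->
  exists f : {ffun 'I_q0.+1 -> 'I_L.+1}, v = (\prod_(p < q0.+1) p ^ f p)%N.
Proof.
move=> v0 vL hv.
exists [ffun p : 'I_q0.+1 => inord (logn p v)].
have pin : [pred p | (p < q0.+1)%N].-nat v.
  apply/andP; split=> //; apply/allP => p; rewrite mem_primes => /and3P[pp _ pv].
  by rewrite inE /= ltnS hv.
rewrite -{1}(part_pnat_id pin) (widen_partn _ (leq_maxl v q0)) big_mkord.
rewrite -(big_ord_widen _ (fun p => p ^ logn p v)%N) ?ltnS ?leq_maxr //.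
apply: eq_bigr => p _; rewrite ffunE inordK // ltnS.
have [pp|np] := boolP (prime p); last by rewrite lognE (negPf np).
apply: ltnW.
rewrite -(@ltn_exp2l 2) //; apply: leq_ltn_trans vL.
apply: (@leq_trans (p ^ logn p v)); first by case: (logn p v) => // k; rewrite leq_exp2r // prime_gt1.
by apply: dvdn_leq => //; exact: pfactor_dvdnn.
Qed.

(** * Divergence of the reciprocal sum of the primes congruent to 1 modulo W *)
Section SmoothCount.
Variables (m : nat) (Phi : {poly int}).
Local Notation n := m.+1.
Hypothesis Pmon : Phi \is monic.
Hypothesis Psz : size Phi = n.+1.
Variable A : nat.
Local Notation box := {ffun 'I_n -> 'I_A}.

(** Fix all coefficients but the constant one and use [poly_norm_roots]. *)
Lemma norm_fiber (v : int) :
  (#|[set a : box | poly_norm n Phi (box_poly a) == v]| <= A ^ m * n)%N.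
Proof.
set S := [set a | _].
pose rest (a : box) : {ffun 'I_m -> 'I_A} := [ffun i => a (lift ord0 i)].
have -> : #|S| = (\sum_(g : {ffun 'I_m -> 'I_A}) #|[set a in S | rest a == g]|)%N.
  rewrite -sum1_card (partition_big rest xpredT) //=; apply: eq_bigr => g _.
  by rewrite -sum1_card; apply: eq_bigl => a; rewrite [RHS]inE.
apply: (@leq_trans (\sum_(g : {ffun 'I_m -> 'I_A}) n)%N); last first.
  by rewrite sum_nat_const card_ffun !card_ord.
apply: leq_sum => g _; set T := [set a in S | _].
have [T0|[b bT]] := set_0Vmem T; first by rewrite T0 cards0.
(* the part of the polynomial that is constant on the fibre *)
pose p0 := box_poly b - (b ord0 : nat)%:Z%:P.
have bE a : a \in T -> box_poly a = ((a ord0 : nat)%:Z)%:P + p0.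
  rewrite !inE => /andP[_ /eqP ag].
  move: bT; rewrite !inE => /andP[_ /eqP bg].
  apply/polyP => k; rewrite /p0 coefD coefB !coefC /box_poly !coef_rVpoly.
  case: insubP => [i _ ik|]; last first.
    by case: k => //= k _; rewrite subrr addr0.
  rewrite !mxE; case: (unliftP ord0 i) ik => [j ->|->] <-; last by rewrite /= subrr addr0.
  rewrite /= add0r subr0; congr (Posz (nat_of_ord _)).
  by have /ffunP/(_ j) := etrans ag (esym bg); rewrite !ffunE.
have -> : #|T| = size [seq ((a : box) ord0 : nat)%:Z | a <- enum T] by rewrite size_map -cardE.
apply: (poly_norm_roots Pmon Psz (v := v) (p := p0)) => //.
  rewrite map_inj_in_uniq ?enum_uniq // => a a'; rewrite !mem_enum => aT aT' [e].
  by apply: (@box_poly_inj n A); rewrite (bE a) // (bE a') // e.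
apply/allP => _ /mapP[a aT ->]; rewrite mem_enum in aT.
by rewrite -bE //; move: aT; rewrite !inE => /andP[].
Qed.

Lemma smooth_norm_count q0 L :
  (#|[set a : box | [&& (poly_norm n Phi (box_poly a) != 0)%R, (`|poly_norm n Phi (box_poly a)| < (2 ^ L)%N%:Z)%R
     & all (fun p => p <= q0)%N (primes `|poly_norm n Phi (box_poly a)|)]]|
    <= 2 * L.+1 ^ q0.+1 * (A ^ m * n))%N.
Proof.
set S := [set a | _].
pose P (f : {ffun 'I_q0.+1 -> 'I_L.+1}) := (\prod_(p < q0.+1) p ^ f p)%N.
pose V := [seq Posz (P f) | f <- enum {ffun 'I_q0.+1 -> 'I_L.+1}]
       ++ [seq - Posz (P f) | f <- enum {ffun 'I_q0.+1 -> 'I_L.+1}].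
have sV : size V = (2 * L.+1 ^ q0.+1)%N.
  have -> : size V = (#|{ffun 'I_q0.+1 -> 'I_L.+1}| + #|{ffun 'I_q0.+1 -> 'I_L.+1}|)%N.
    by rewrite /V size_cat; congr (_ + _)%N; rewrite size_map cardE.
  by rewrite card_ffun !card_ord mul2n addnn.
have cov : (#|S| <= \sum_(v <- V) #|[set a : box | poly_norm n Phi (box_poly a) == v]|)%N.
  have -> : (\sum_(v <- V) #|[set a : box | poly_norm n Phi (box_poly a) == v]|
     = \sum_(a : box) \sum_(v <- V) (poly_norm n Phi (box_poly a) == v : nat))%N.
    rewrite exchange_big /=; apply: eq_bigr => v _; rewrite -sum1_card big_mkcond.
    by apply: eq_bigr => a _; rewrite inE; case: eqP.
  rewrite -sum1_card big_mkcond /=; apply: leq_sum => a _; case: ifP => //.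
  rewrite inE => /and3P[nz lt sm]; set N := poly_norm _ _ _ in nz lt sm *.
  have [||p pp pv|f fE] := @smooth_exponents q0 L `|N|.
  - by rewrite absz_gt0.
  - by rewrite -ltz_nat abszE.
  - by have /allP/(_ p) := sm; apply; rewrite mem_primes pp pv absz_gt0 nz.
  have NV : N \in V.
    rewrite mem_cat; apply/orP; have [N0|N0] := leP 0 N.
      by left; apply/mapP; exists f; rewrite ?mem_enum // /P -fE gez0_abs.
    by right; apply/mapP; exists f; rewrite ?mem_enum // /P -fE ltz0_abs // opprK.
  by rewrite (big_rem N) //= eqxx.
apply: (leq_trans cov); rewrite -sV.
apply: (@leq_trans (\sum_(v <- V) (A ^ m * n))%N).
  by apply: leq_sum => v _; exact: norm_fiber.
by rewrite big_const_seq count_predT iter_addn_0 mulnC.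
Qed.

End SmoothCount.

Lemma exp_beats_poly (c d k : nat) : exists2 a, (1 < a)%N & (c * (d * a.+1) ^ k <= 2 ^ a)%N.
Proof.
pose e := (c + d * k)%N; pose t := (e + 2 * k + 1)%N.
exists (2 ^ (2 * t))%N.
  by rewrite -{1}(expn0 2) ltn_exp2l // /t addn1 mulnS.
have h1 : ((2 ^ (2 * t)).+1 <= 2 ^ (2 * t).+1)%N.
  by move: (2 * t)%N => u; rewrite expnS; have := @expn_gt0 2 u; clear; lia.
have h2 : (c * (d * (2 ^ (2 * t)).+1) ^ k <= 2 ^ (e + (2 * t).+1 * k))%N.
  apply: (@leq_trans (2 ^ c * (2 ^ d * 2 ^ (2 * t).+1) ^ k))%N.
    apply: leq_mul; first exact/ltnW/ltn_expl.
    case: (k) => // k'; rewrite leq_exp2r //; apply: leq_mul => //; exact/ltnW/ltn_expl.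
  by rewrite -expnD -expnM -expnD leq_exp2l // /e mulnDl addnA.
apply: (leq_trans h2); rewrite leq_exp2l //.
have h3 : (t.+1 * t.+1 <= 2 ^ (2 * t))%N.
  rewrite mul2n -addnn expnD; apply: leq_mul; exact: ltn_expl.
apply: leq_trans h3; rewrite /t; clear; nia.
Qed.

Lemma sum_inv_sqr_tail (R : realFieldType) a b : (0 < a)%N ->
  \sum_(a.+1 <= k < b) (k%:R ^+ 2)^-1 <= a%:R^-1 :> R.
Proof.
move=> a0; have [ab|ba] := leqP a.+1 b; last by rewrite big_geq ?invr_ge0 ?ler0n // ltnW.
apply: (@le_trans _ _ (a%:R^-1 - b.-1%:R^-1)); last first.
  by rewrite lerBlDr lerDl invr_ge0 ler0n.
rewrite -(subnK ab); elim: (b - a.+1)%N => [|d IH].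
  by rewrite add0n big_geq // subrr.
rewrite addSn big_nat_recr ?leq_addl //=.
apply: (le_trans (lerD IH (lexx _))).
set k := (d + a.+1)%N; have k0 : (0 < k)%N by rewrite /k addnS.
have k1 : (0 < k.-1)%N by rewrite /k addnS /= addn_gt0 a0 orbT.
rewrite -addrA lerD2l addrC lerBlDr -(@prednK k) //=.
move: k1; case: (k.-1) => // j _; rewrite -!natr1.
have j0 : 0 <= j%:R :> R := ler0n _ _.
rewrite -subr_ge0.
have -> : - (j%:R + 1 + 1)^-1 + (j%:R + 1)^-1 - ((j%:R + 1 + 1) ^+ 2)^-1 
   = ((j%:R + 1) * (j%:R + 1 + 1) ^+ 2)^-1 :> R.
  by field; rewrite !gt_eqF //; lra.
by rewrite invr_ge0 mulr_ge0 ?exprn_ge0 //; lra.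
Qed.

(** If the sum over q > q0 were small for every X, then fewer than 3/4 of the
    elements of a large box could have a norm divisible by a prime q > q0 or be 0;
    the others have q0-smooth norms, and by [smooth_norm_count] there are too few
    of those.  The constant C depends on W only, because in the final count the
    primes q not congruent to 1 contribute at most the tail of sum 1 / q^2. *)
Theorem sum_inv_primes_ap (R : realFieldType) W : (0 < W)%N -> exists C : nat, forall q0, exists X,
  1 <= C%:R * \sum_(q <- primes_upto X | (q0 < q)%N && (q %% W == 1 %% W)%N) q%:R^-1 :> R.
Proof.
move=> W0; pose m := (totient W).-1.
have nE : m.+1 = totient W by rewrite /m prednK // totient_gt0.
pose Phi := 'Phi_W.
have Pmon : Phi \is monic by exact: Cyclotomic_monic.
have Psz : size Phi = m.+2 by rewrite size_Cyclotomic nE.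
have Pirr (u p k : {poly int}) : (size u <= m.+1)%N -> (size p <= m.+1)%N ->
  u * p = k * Phi -> u = 0 \/ p = 0 by rewrite nE; exact: Cyclotomic_prime_ideal.
have [C0 C0P] := poly_norm_bound m.+1 Pmon.
(* with q0 >= C both the tail of 1 / q^2 and the assumed bound take at most a quarter of the box *)
pose K := (2 ^ m.+1 * C0.+1)%N; pose C := (4 * (m.+1 * K))%N.
exists C => q1; pose q0 := (q1 + W + C)%N.
have C0' : (0 < C)%N by rewrite !muln_gt0 expn_gt0.
have [a a1 ha] := exp_beats_poly (8 * m.+1) (C0 + m.+3) q0.+1.
pose A := (2 ^ a)%N; pose L := (C0 + m.+1 * a + 1)%N; pose X := (2 ^ L)%N.
exists X; rewrite leNgt; apply/negP => hs.
pose box := {ffun 'I_m.+1 -> 'I_A}.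
pose Nm (f : box) := poly_norm m.+1 Phi (box_poly f).
have NmX f : `|Nm f| < X%:Z.
  have h := C0P _ _ (size_box_poly f) (coef_box_poly_le f).
  apply: (le_lt_trans h); rewrite ltz_nat.
  apply: (@leq_ltn_trans (C0 * A ^ m.+1)%N).
    by rewrite leq_mul2l leq_exp2r // leq_pred orbT.
  apply: (@leq_ltn_trans (2 ^ C0 * 2 ^ (m.+1 * a))%N).
    apply: leq_mul; first exact/ltnW/ltn_expl.
    by rewrite /A -expnM mulnC.
  by rewrite -expnD /X /L addn1 ltn_exp2l.
pose Bad q : {set box} := [set f : box | (box_poly f != 0) && (q%:Z %| Nm f)%Z].
pose Sm : {set box} := [set f : box | [&& (Nm f != 0)%R, (`|Nm f| < (2 ^ L)%N%:Z)%R
     & all (fun p => p <= q0)%N (primes `|Nm f|)]].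
pose Ze : {set box} := [set f : box | box_poly f == 0].
have cov : (#|{: box}| <= #|Ze| + (#|Sm| + \sum_(q <- primes_upto X | (q0 < q)%N) #|Bad q|))%N.
  have -> : (\sum_(q <- primes_upto X | (q0 < q)%N) #|Bad q|
     = \sum_(f : box) \sum_(q <- primes_upto X | (q0 < q)%N) (f \in Bad q : nat))%N.
    rewrite exchange_big /=; apply: eq_bigr => q _; rewrite -sum1_card big_mkcond.
    by apply: eq_bigr => f _; case: (f \in Bad q).
  rewrite -!sum1_card [X in (_ <= X + (_ + _))%N]big_mkcond [X in (_ <= _ + (X + _))%N]big_mkcond /=.
  rewrite -!big_split /=; apply: leq_sum => f _.
  have [z|nz] := eqVneq (box_poly f) 0; first by rewrite [f \in Ze]inE z eqxx.
  have Nz : Nm f != 0 by apply: (poly_norm_neq0 Pmon Psz Pirr nz); exact: size_box_poly.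
  have [sm|] := boolP (all (fun p => p <= q0)%N (primes `|Nm f|)).
    have -> : f \in Sm by rewrite inE Nz NmX sm.
    by rewrite addnCA.
  case/allPn => p; rewrite mem_primes => /and3P[pp N0 pN]; rewrite -ltnNge => q0p.
  have pX : p \in primes_upto X.
    rewrite mem_primes_upto pp; apply: leq_trans (dvdn_leq N0 pN) (ltnW _).
    by rewrite -ltz_nat abszE; exact: NmX.
  rewrite (big_rem p) //= q0p [f \in Bad p]inE nz.
  have -> : (p %| Nm f)%Z by rewrite dvdzE.
  by do 2 (apply: leq_trans (leq_addl _ _)); rewrite leq_addr.
have boxE : #|{: box}| = (A ^ m.+1)%N by rewrite card_ffun !card_ord.
have ZeB : (#|Ze| <= 1)%N.
  apply/card_le1_eqP => f g; rewrite !inE => /eqP f0 /eqP g0.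
  by apply: (@box_poly_inj m.+1 A); rewrite f0 g0.
have SmB := smooth_norm_count Pmon Psz A q0 L; rewrite -[X in (#|pred_of_set X| <= _)%N]/Sm in SmB.
pose B : R := (A ^ m.+1)%N%:R.
have A0 : (0 < A)%N by rewrite expn_gt0.
have BadB : \sum_(q <- primes_upto X | (q0 < q)%N) #|Bad q|%:R
   <= (m.+1 * K)%N%:R * B * (\sum_(q <- primes_upto X | (q0 < q)%N && (q %% W == 1 %% W)%N) q%:R^-1
       + q0%:R^-1) :> R.
  apply: (@le_trans _ _ (\sum_(q <- primes_upto X | (q0 < q)%N)
      (m.+1 * K)%N%:R * B * ((q %% W == 1 %% W)%N%:R / q%:R + (q%:R ^+ 2)^-1))).
    rewrite big_seq_cond [leRHS]big_seq_cond; apply: ler_sum => q /andP[].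
    rewrite mem_primes_upto => /andP[pq _] q0q.
    have nqW : ~~ (q %| W)%N.
      apply/negP => /(dvdn_leq W0); rewrite leqNgt; case/negP.
      by apply: leq_ltn_trans q0q; rewrite /q0 addnAC leq_addl.
    have hrt (g : 'F_q) : root (map_poly intr Phi) g -> (q %% W == 1 %% W)%N.
      by move=> h; apply/eqP; exact: root_Cyclotomic_Fp nqW h.
    have := @norm_dvd_count m.+1 Phi isT Pmon Psz Pirr C0 C0P A R q _ pq hrt.
    rewrite -[X in #|pred_of_set X|]/(Bad q) => h; apply: (le_trans h).
    by rewrite /K /B mulnA natrM -!natrM !mulnA.
  rewrite -mulr_sumr; apply: ler_wpM2l; first by rewrite mulr_ge0 // ler0n.
  rewrite big_split /=; apply: lerD.
    rewrite [leRHS]big_mkcondr /=; apply: ler_sum => q _.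
    by case: ifP; rewrite ?mul1r ?mul0r.
  apply: le_trans (sum_inv_sqr_tail R X.+1 _); last by rewrite /q0 addn_gt0 C0' orbT.
  rewrite -big_filter; apply: ler_sum_sub.
  - by rewrite filter_uniq // primes_upto_uniq.
  - by move=> q; rewrite mem_filter mem_primes_upto mem_index_iota ltnS => /andP[-> /andP[_ ->]].
  - by move=> q _; rewrite invr_ge0 exprn_ge0 // ler0n.
have T1 : \sum_(q <- primes_upto X | (q0 < q)%N && (q %% W == 1 %% W)%N) q%:R^-1
   <= \sum_(q <- primes_upto X | (q1 < q)%N && (q %% W == 1 %% W)%N) q%:R^-1 :> R.
  rewrite big_mkcond [leRHS]big_mkcond /=; apply: ler_sum => q _.
  have [h|] := ltnP q0 q; last by case: ifP; rewrite ?invr_ge0 ?ler0n.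
  by rewrite (leq_ltn_trans _ h) // /q0 -addnA leq_addr.
move: BadB cov; set T := \sum_(q <- _ | _ && _) _ in T1 *.
set T' := \sum_(q <- _ | _ && _) _ in T1 hs; set U := \sum_(_ <- _ | _) _ => BadB.
rewrite boxE -(ler_nat R) -/B !natrD natr_sum -/U => cov.
have CE : C%:R = 4 * (m.+1 * K)%N%:R :> R by rewrite /C natrM.
have c0 : 0 < (m.+1 * K)%N%:R :> R by rewrite ltr0n !muln_gt0 expn_gt0.
have B4 : 4 <= B.
  rewrite /B (_ : 4 = (2 ^ 2)%N%:R) // ler_nat /A -expnM leq_exp2l //.
  by rewrite (leq_trans a1) // leq_pmulr.
have SmR : 4 * #|Sm|%:R <= B.
  rewrite /B -natrM ler_nat; apply: (leq_trans (leq_mul (leqnn 4) SmB)).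
  apply: (@leq_trans ((8 * m.+1 * L.+1 ^ q0.+1) * A ^ m)%N).
    rewrite leq_eqVlt; apply/orP; left; apply/eqP.
    by move: (L.+1 ^ _)%N (A ^ m)%N => x y; clear; ring.
  rewrite [leqRHS]expnS leq_mul2r; apply/orP; right; apply: leq_trans ha.
  rewrite leq_mul2l leq_exp2r //; apply/orP; right.
  by rewrite /L; clear; nia.
have q0R : (m.+1 * K)%N%:R * q0%:R^-1 <= 4^-1 :> R.
  rewrite ler_pdivrMr ?ltr0n ?(addn_gt0, C0', orbT) //.
  rewrite mulrC ler_pdivlMr // -natrM ler_nat; apply: leq_trans (leq_addl _ _).
  by rewrite /C mulnC.
have h1 : (m.+1 * K)%N%:R * T < 4^-1 by rewrite CE in hs; nra.
have ZeR : #|Ze|%:R <= 1 :> R by rewrite lern1.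
have : (m.+1 * K)%N%:R * B * (T + q0%:R^-1) < B * (2 * 4^-1).
  have -> : (m.+1 * K)%N%:R * B * (T + q0%:R^-1) = B * ((m.+1 * K)%N%:R * T + (m.+1 * K)%N%:R * q0%:R^-1).
    by ring.
  by rewrite ltr_pM2l; lra.
lra.
Qed.

(** * Estimates of Mertens and Chebyshev *)
(** lg stands for the logarithm to base 2; working from these three properties keeps
    real analysis out of the estimates. *)
Section Log2.
Variables (R : realFieldType) (lg : nat -> R).
Hypothesis lgM : forall a b, (0 < a)%N -> (0 < b)%N -> lg (a * b) = lg a + lg b.
Hypothesis lg2 : lg 2 = 1.
Hypothesis lg_le : forall a b, (0 < a <= b)%N -> lg a <= lg b.

Lemma lg1 : lg 1 = 0.
Proof. by have := @lgM 1 1 isT isT; rewrite muln1 => h; lra. Qed.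

Lemma lg_ge0 n : (0 < n)%N -> 0 <= lg n.
Proof. by move=> n0; rewrite -lg1 lg_le. Qed.

Lemma lgX a k : (0 < a)%N -> lg (a ^ k) = k%:R * lg a.
Proof.
move=> a0; elim: k => [|k IH]; first by rewrite expn0 lg1 mul0r.
by rewrite expnS lgM ?expn_gt0 ?a0 // IH -natr1; ring.
Qed.

Lemma lg_pow2 k : lg (2 ^ k) = k%:R.
Proof. by rewrite lgX // lg2 mulr1. Qed.

Lemma lg_le_pred n : (0 < n)%N -> lg n <= n.-1%:R.
Proof.
move=> n0; rewrite -lg_pow2; apply: lg_le; rewrite n0 /=.
by have := ltn_expl n.-1 (isT : 1 < 2)%N; rewrite -{3}(prednK n0).
Qed.

Lemma lg_prod (s : seq nat) (F : nat -> nat) : (forall p, p \in s -> 0 < F p)%N ->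
  lg (\prod_(p <- s) F p)%N = \sum_(p <- s) lg (F p).
Proof.
elim: s => [|p s IH] h; first by rewrite !big_nil lg1.
rewrite !big_cons lgM; last 2 first.
- by apply: h; rewrite inE eqxx.
- by rewrite big_seq prodn_cond_gt0 // => q qs; apply: h; rewrite inE qs orbT.
by rewrite IH // => q qs; apply: h; rewrite inE qs orbT.
Qed.

Lemma lg_primes n : (0 < n)%N -> lg n = \sum_(p <- primes n) (logn p n)%:R * lg p.
Proof.
move=> n0; rewrite {1}(prod_prime_decomp n0) prime_decompE big_map /=.
rewrite lg_prod => [|p]; last by rewrite mem_primes expn_gt0 => /andP[/prime_gt0 ->].
rewrite big_seq [RHS]big_seq; apply: eq_bigr => p; rewrite mem_primes => /andP[/prime_gt0 p0 _].
by rewrite lgX.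
Qed.

Lemma fact_pow_le m n : (m`! * m ^ n <= (m + n)`!)%N.
Proof.
elim: n => [|n IH]; first by rewrite expn0 muln1 addn0.
rewrite addnS factS expnS mulnCA; apply: leq_mul => //.
by rewrite (leq_trans (leq_addr n m)).
Qed.

(** Stirling's lower bound at powers of 2, by doubling. *)
Lemma lg_fact_pow2 b : (2 ^ b)%:R * (b%:R - 2) <= lg (2 ^ b)`!.
Proof.
suff h : (2 ^ b)%:R * (b%:R - 2) + 2 <= lg (2 ^ b)`! by lra.
elim: b => [|b IH]; first by rewrite expn0 (_ : 1`! = 1%N) // lg1; lra.
apply: (@le_trans _ _ (lg ((2 ^ b)`! * (2 ^ b) ^ (2 ^ b)))); last first.
  apply: lg_le; rewrite muln_gt0 fact_gt0 !expn_gt0 /= expnS mul2n -addnn.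
  exact: fact_pow_le.
rewrite lgM ?fact_gt0 ?expn_gt0 // lgX ?expn_gt0 // lg_pow2 expnS natrM -natr1.
lra.
Qed.

Lemma logn_fact_le p n : prime p -> (logn p n`!)%:R <= n%:R / p.-1%:R :> R.
Proof.
move=> pp; have p1 := prime_gt1 pp.
have pR : 0 < (p.-1%:R : R) by rewrite ltr0n; clear -p1; lia.
have pR' : 0 < (p%:R : R) by rewrite ltr0n prime_gt0.
rewrite logn_fact // natr_sum.
have gen m : \sum_(1 <= k < m.+1) (n %/ p ^ k)%:R <= n%:R / p.-1%:R * (1 - p%:R ^- m) :> R.
  elim: m => [|m IH]; first by rewrite big_geq // expr0 invr1 subrr mulr0.
  rewrite big_nat_recr //=; apply: (le_trans (lerD IH (lexx _))).
  have h : (n %/ p ^ m.+1)%:R <= n%:R * p%:R ^- m.+1 :> R.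
    by rewrite ler_pdivlMr ?exprn_gt0 // -natrX -natrM ler_nat leq_divM.
  apply: (le_trans (lerD (lexx _) h)).
  have pE : p%:R = p.-1%:R + 1 :> R by rewrite natr1 prednK // prime_gt0.
  rewrite exprS invfM; set x := p%:R ^- m.
  rewrite le_eqVlt; apply/orP; left; apply/eqP.
  have p0 : p%:R != 0 :> R by rewrite gt_eqF.
  have p0' : p.-1%:R != 0 :> R by rewrite gt_eqF.
  have -> : (p%:R)^-1 = 1 / (p.-1%:R + 1) :> R by rewrite pE div1r.
  by field; rewrite p0' -pE p0.
apply: (le_trans (gen n)); rewrite ler_piMr //; first by rewrite divr_ge0 // ltW.
by rewrite gerBl invr_ge0 exprn_ge0.
Qed.

(** Chebyshev's argument: compare lg (n`!) with the sum over its prime factors, each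
    occurring at most n / (p - 1) times. *)
Lemma mertens_lower b : b%:R - 2 <= \sum_(p <- primes_upto (2 ^ b)) lg p / p.-1%:R.
Proof.
have n0 : 0 < ((2 ^ b)%:R : R) by rewrite ltr0n expn_gt0.
rewrite -(ler_pM2l n0); apply: (le_trans (lg_fact_pow2 b)).
rewrite lg_primes ?fact_gt0 // mulr_sumr.
have pf p : p \in primes (2 ^ b)`! -> prime p && (p <= 2 ^ b)%N.
  rewrite mem_primes => /and3P[pp f0 pf]; rewrite pp leqNgt /=; apply/negP => h.
  have : (0 < logn p (2 ^ b)`!)%N by rewrite logn_gt0 mem_primes pp f0 pf.
  rewrite logn_fact // big1_seq // => k; rewrite mem_index_iota => /andP[_ /andP[k1 _]].
  rewrite divn_small //; apply: (leq_trans h); rewrite -{1}(expn1 p) leq_pexp2l //.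
  exact: prime_gt0.
apply: (@le_trans _ _ (\sum_(p <- primes (2 ^ b)`!) (2 ^ b)%:R * (lg p / p.-1%:R))).
  rewrite big_seq [leRHS]big_seq; apply: ler_sum => p /pf /andP[pp _].
  have h := logn_fact_le (2 ^ b) pp.
  have lp := lg_ge0 (prime_gt0 pp).
  by apply: (le_trans (ler_wpM2r lp h)); rewrite mulrAC mulrA.
apply: ler_sum_sub.
- exact: primes_uniq.
- by move=> p /pf; rewrite mem_primes_upto.
- move=> p; rewrite mem_primes_upto => /andP[/prime_gt0 p0 _].
  by rewrite mulr_ge0 // divr_ge0 // lg_ge0.
Qed.

Lemma sum_lg_moduli b0 b1 : (b0 < b1)%N ->
  b1%:R - 2 - (2 * b0 * b0.+1)%:R <= \sum_(l <- moduli b0 b1) lg l / l.-1%:R.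
Proof.
move=> b01.
have h := mertens_lower b1.
have p : perm_eq (primes_upto (2 ^ b1)) (primes_upto (2 ^ b0) ++ moduli b0 b1).
  apply: uniq_perm; first exact: primes_upto_uniq.
    rewrite cat_uniq primes_upto_uniq moduli_uniq andbT /=.
    apply/hasPn => l; rewrite mem_moduli mem_primes_upto => /and3P[_ -> /andP[h1 _]].
    by rewrite /= leqNgt h1.
  move=> l; rewrite mem_cat mem_moduli !mem_primes_upto b01 /=; case: (prime l) => //=.
  case: (leqP l (2 ^ b0)) => //= h1; by rewrite (leq_trans h1) // leq_exp2l // ltnW.
rewrite (perm_big _ p) big_cat /= in h.
suff : \sum_(p <- primes_upto (2 ^ b0)) lg p / p.-1%:R <= (2 * b0 * b0.+1)%:R by lra.
apply: (@le_trans _ _ (\sum_(p <- primes_upto (2 ^ b0)) (2 * b0)%:R * p%:R^-1)).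
  rewrite big_seq [leRHS]big_seq; apply: ler_sum => q; rewrite mem_primes_upto => /andP[pq hq].
  have q1 := prime_gt1 pq.
  have qR : 0 < (q%:R : R) by rewrite ltr0n prime_gt0.
  have q1R : 0 < (q.-1%:R : R) by rewrite ltr0n; clear -q1; lia.
  have hl : lg q <= b0%:R by rewrite -lg_pow2 lg_le // prime_gt0.
  rewrite ler_pdivrMr // mulrAC ler_pdivlMr // natrM.
  have hq2 : (q%:R : R) <= 2 * q.-1%:R by rewrite -natrM ler_nat; clear -q1; lia.
  have := ler_pM (lg_ge0 (prime_gt0 pq)) (ltW qR) hl hq2; lra.
rewrite -mulr_sumr [in leRHS]natrM; apply: ler_wpM2l => //.
apply: le_trans (harmonic_pow2_le R b0); apply: ler_sum_sub.
- exact: primes_upto_uniq.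
- by move=> q; rewrite mem_primes_upto mem_iota add1n ltnS => /andP[/prime_gt0 -> ->].
- by move=> q _; rewrite invr_ge0.
Qed.

End Log2.

(** The primes in (n, 2 n] divide the central binomial coefficient. *)
Lemma chebyshev_dyadic b : (b * size (dyadic_primes b) <= 2 * 2 ^ b)%N.
Proof.
set n := (2 ^ b)%N.
have u : uniq (dyadic_primes b) by apply/filter_uniq/iota_uniq.
have d : (\prod_(p <- dyadic_primes b) p %| 'C(n + n, n))%N.
  apply: prod_primes_dvdn => //; apply/allP => p; rewrite mem_dyadic_primes => /and3P[pp h1 h2] //.
  have e := bin_fact (leq_addl n n).
  have pn : ~~ (p %| n`!)%N.
    apply/negP => h; have : (0 < logn p n`!)%N by rewrite logn_gt0 mem_primes pp fact_gt0.
    rewrite logn_fact // big1_seq // => k; rewrite mem_index_iota => /andP[_ /andP[k1 _]].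
    rewrite divn_small //; apply: (leq_trans h1); rewrite -{1}(expn1 p) leq_pexp2l //.
    exact: prime_gt0.
  have : (p %| (n + n)`!)%N.
    by apply: dvdn_fact; rewrite prime_gt0 // addnn -mul2n -expnS.
  by rewrite -e addnK !Euclid_dvdM // (negPf pn) !orbF.
have c : ('C(n + n, n) <= 2 ^ (n + n))%N.
  rewrite -[X in (_ <= X ^ _)%N]/(1 + 1)%N Pascal.
  have nn : (n < (n + n).+1)%N by rewrite ltnS leq_addl.
  by rewrite (bigD1 (Ordinal nn)) //= !exp1n !muln1 leq_addr.
have c0 : (0 < 'C(n + n, n))%N by rewrite bin_gt0 leq_addl.
have := leq_trans (dvdn_leq c0 d) c.
have : (2 ^ (b * size (dyadic_primes b)) <= \prod_(p <- dyadic_primes b) p)%N.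
  have : all (fun p => n <= p)%N (dyadic_primes b).
    by apply/allP => p; rewrite mem_dyadic_primes => /and3P[_ /ltnW].
  elim: (dyadic_primes b) => [|p t IH] /=; first by rewrite muln0 expn0 big_nil.
  by move=> /andP[pn ht]; rewrite mulnS expnD big_cons leq_mul // IH.
move=> h1 h2; have := leq_trans h1 h2.
by rewrite leq_exp2l // addnn -mul2n.
Qed.

Lemma sum_inv_primes_dyadic (R : realFieldType) b1 c : (0 < b1 <= c)%N ->
  \sum_(l <- moduli b1 c) l%:R^-1 <= (2 * (c - b1))%:R / b1%:R :> R.
Proof.
move=> /andP[b0 bc]; have bR : 0 < (b1%:R : R) by rewrite ltr0n.
rewrite /moduli big_flatten /= big_map.
apply: (@le_trans _ _ (\sum_(b1 <= b < c) 2 / b1%:R)).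
  apply: ler_sum_nat => b /andP[hb _].
  have nR : 0 < ((2 ^ b)%:R : R) by rewrite ltr0n expn_gt0.
  apply: (@le_trans _ _ (\sum_(l <- dyadic_primes b) (2 ^ b)%:R^-1)).
    rewrite big_seq [leRHS]big_seq; apply: ler_sum => l; rewrite mem_dyadic_primes => /and3P[_ h _].
    have l0 : 0 < (l%:R : R) by rewrite ltr0n (leq_ltn_trans _ h).
    by rewrite lef_pV2 ?posrE // ler_nat ltnW.
  rewrite big_const_seq count_predT iter_addr_0 -[leLHS]mulr_natl ler_pdivrMr // mulrAC ler_pdivlMr //.
  rewrite -!natrM ler_nat mulnC; apply: leq_trans (chebyshev_dyadic b).
  by rewrite leq_mul2r hb orbT.
by rewrite sumr_const_nat -[leLHS]mulr_natl natrM mulrA [_ * 2]mulrC.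
Qed.

(** * Primes q with q - 1 smooth *)
(** The primes q for which q - 1 has a prime factor in (2^b1, 2^c], the transition
    zone around the square root of 2^i. *)
Definition zone (W v i b1 c : nat) :=
  [seq q <- ap_primes W v i | has (fun l => l %| q.-1)%N (moduli b1 c)].

Definition smooth_primes (W v i b1 : nat) :=
  [seq q <- ap_primes W v i | all (fun p => p <= 2 ^ b1)%N (primes q.-1)].

Lemma ap_primesP W v i q : q \in ap_primes W v i ->
  [/\ prime q, (q %% W == 1 %% W)%N, (2 ^ v < q)%N & (q <= 2 ^ i)%N].
Proof.
rewrite mem_filter mem_iota => /andP[/and3P[h1 h2 pq] /andP[_ h3]]; split=> //.
  by move: h2; rewrite (pdiv_id pq).
by move: h3; rewrite add2n prednK ?expn_gt0 // ltnS.
Qed.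

Lemma ap_primes_dvd W v i q : q \in ap_primes W v i -> (W %| q.-1)%N.
Proof.
move=> /ap_primesP[pq h _ _].
by rewrite -subn1 -eqn_mod_dvd // prime_gt0.
Qed.

(** For each prime l of the zone, q = 1 + W l k with k small, and the sieve bounds
    the number of k for which q is prime; then sum over l with Chebyshev's bound. *)
Lemma zone_size (R : realFieldType) (W v r i b1 c : nat) :
  (0 < W)%N -> (0 < v)%N -> (W <= 2 ^ b1)%N -> (v <= b1)%N -> (0 < b1 <= c)%N -> (c <= i)%N ->
  (size (zone W v i b1 c))%:R <=
    (2 * 2 ^ i)%:R * ((2 * W)%:R / v%:R + (4 ^ v.+1)%:R / 2 ^+ r) * ((2 * (c - b1))%:R / b1%:R)
    + (2 ^ c * 2 ^ (v.+1 * r))%:R :> R.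
Proof.
move=> W0 v0 Wb vb b1c ci.
pose ps := sieving_primes W v.
have K0 : 0 < (2 ^+ r : R) by rewrite exprn_gt0.
have ups : uniq ps by apply/filter_uniq/primes_upto_uniq.
have psP p : p \in ps -> [/\ ~~ (p %| W)%N, prime p & (p <= 2 ^ v)%N].
  by rewrite mem_sieving_primes => /and3P[].
pose X l := (2 ^ i %/ (W * l) + 1)%N.
pose T := flatten [seq [seq (W * l * k + 1)%N | k <- [seq k <- iota 0 (X l) | all (fun p => ~~ (p %| W * l * k + 1))%N ps]]
            | l <- moduli b1 c].
have lP l : l \in moduli b1 c -> [/\ prime l, (2 ^ b1 < l)%N & (l <= 2 ^ c)%N].
  by rewrite mem_moduli => /and3P[_ -> /andP[]].
have sub : {subset zone W v i b1 c <= T}.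
  move=> q; rewrite mem_filter => /andP[/hasP[l lL lq] qA].
  have [pq qW vq qY] := ap_primesP qA.
  have [pl bl lc] := lP _ lL.
  have hW := ap_primes_dvd qA.
  have cop : coprime W l.
    by rewrite coprime_sym prime_coprime // gtnNdvd // (leq_ltn_trans Wb).
  have hd : (W * l %| q.-1)%N by rewrite Gauss_dvd // hW lq.
  have q1 := prime_gt1 pq.
  have e : (W * l * (q.-1 %/ (W * l)) + 1 = q)%N by rewrite mulnC divnK // addn1 prednK // ltnW.
  apply/flatten_mapP; exists l => //; apply/mapP; exists (q.-1 %/ (W * l))%N => //.
  rewrite mem_filter mem_iota e /X /= add0n addn1 ltnS leq_div2r ?andbT; last first.
    by apply: leq_trans qY; rewrite leq_pred.
  apply/allP => p /psP[_ pp hp]; rewrite dvdn_prime2 // ltn_eqF //.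
  exact: leq_ltn_trans vq.
have hsz : (size (zone W v i b1 c) <= size T)%N.
  by apply: uniq_leq_size => //; apply/filter_uniq/filter_uniq/iota_uniq.
apply: (@le_trans _ _ (size T)%:R); first by rewrite ler_nat.
rewrite /T size_flatten /shape sumnE -map_comp big_map natr_sum.
pose V : R := (2 * W)%:R / v%:R.
pose E : R := (4 ^ v.+1)%:R / 2 ^+ r.
have V0 : 0 <= V by rewrite divr_ge0.
have E0 : 0 <= E by rewrite divr_ge0 // ltW.
apply: (@le_trans _ _ (\sum_(l <- moduli b1 c) ((2 * 2 ^ i)%:R * (V + E) * l%:R^-1 + (2 ^ (v.+1 * r))%:R))).
  rewrite big_seq [leRHS]big_seq; apply: ler_sum => l lL; rewrite /= size_map size_filter.
  have [pl bl lc] := lP _ lL; have l0 := prime_gt0 pl.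
  have lR : 0 < (l%:R : R) by rewrite ltr0n.
  have hps : all (fun p => prime p && ~~ (p %| W * l))%N ps.
    apply/allP => p /psP[pW pp hp]; rewrite pp Euclid_dvdM // negb_or pW /= dvdn_prime2 //.
    rewrite ltn_eqF // (leq_ltn_trans hp) //; apply: leq_ltn_trans bl; by rewrite leq_exp2l.
  have := ler_normlW (sieve_AP_core R (X l) r ups hps).
  set cnt := count _ _ => h.
  have hV : \prod_(p <- ps) (1 - p%:R^-1) <= V.
    by rewrite /ps /sieving_primes big_filter; exact: prod_1minus_coprime_le.
  have ha : all (fun p => 0 < p <= 2 ^ v)%N ps.
    by apply/allP => p /psP[_ /prime_gt0 -> ->].
  have hE := prod_1plus2_pow R ups ha.
  have hs : (size ps).+1%:R ^+ r <= (2 ^ (v.+1 * r))%:R :> R.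
    rewrite expnM -natrX ler_nat; have [->|r0] := posnP r; first by rewrite !expn0.
    rewrite leq_exp2r //; apply: (@leq_ltn_trans (2 ^ v)); first exact: size_primes_le_pow.
    by rewrite ltn_exp2l.
  have hX : (X l)%:R <= (2 * 2 ^ i)%:R * l%:R^-1 :> R.
    rewrite ler_pdivlMr // -natrM ler_nat /X addnC mulnDl mul1n mul2n -addnn; apply: leq_add.
      by apply: (leq_trans lc); rewrite leq_exp2l.
    apply: (@leq_trans (2 ^ i %/ (W * l) * (W * l))); last exact: leq_divM.
    by rewrite leq_mul2l leq_pmull // orbT.
  have X0 : 0 <= (X l)%:R :> R by [].
  have g1 := ler_wpM2l X0 hV.
  have g2 : (X l)%:R / 2 ^+ r * \prod_(p <- ps) (1 + 2 / p%:R) <= (X l)%:R * E.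
    by rewrite /E mulrA [leRHS]mulrAC; apply: ler_wpM2l => //; rewrite divr_ge0 // ltW.
  have g3 : (X l)%:R * (V + E) <= (2 * 2 ^ i)%:R * l%:R^-1 * (V + E).
    by apply: ler_wpM2r => //; exact: addr_ge0.
  have -> : (2 * 2 ^ i)%:R * (V + E) * l%:R^-1 = (2 * 2 ^ i)%:R * l%:R^-1 * (V + E) by ring.
  rewrite mulrDr in g3.
  lra.
rewrite big_split /= -mulr_sumr; apply: lerD.
  apply: ler_wpM2l; last exact: sum_inv_primes_dyadic.
  by rewrite mulr_ge0 // addr_ge0.
rewrite big_const_seq count_predT iter_addr_0 -[leLHS]mulr_natl -natrM ler_nat leq_mul2r.
apply/orP; right; rewrite -[X in (_ <= X)%N](size_iota 1); apply: uniq_leq_size (moduli_uniq _ _) _ => l.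
by move=> /lP[/prime_gt0 l0 _ lc]; rewrite mem_iota l0 add1n ltnS.
Qed.

Section Classification.
Variables (R : realFieldType) (lg : nat -> R).
Hypothesis lgM : forall a b, (0 < a)%N -> (0 < b)%N -> lg (a * b) = lg a + lg b.
Hypothesis lg2 : lg 2 = 1.
Hypothesis lg_le : forall a b, (0 < a <= b)%N -> lg a <= lg b.

Lemma lg_sum_primes_le (t : seq nat) n : uniq t -> all prime t -> (0 < n)%N ->
  all (fun p => p %| n)%N t -> \sum_(p <- t) lg p <= lg n.
Proof.
move=> ut pt n0 dt.
have tp p : p \in t -> (0 < p)%N by move/(allP pt)/prime_gt0.
rewrite -(lg_prod lgM (F := id)) //; apply: lg_le; apply/andP; split.
  by rewrite big_seq prodn_cond_gt0.
by apply: dvdn_leq => //; exact: prod_primes_dvdn.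
Qed.

(** The weight w q is the sum of lg l over the prime factors l of q - 1 in
    (2^b0, 2^b1].  On average it is at least b1 - O(b0^2) by hypothesis and by
    Mertens.  Individually it is at most i if q - 1 is smooth, at most i - b1 if
    the largest prime factor of q - 1 is in the zone, and at most i - c if it is
    beyond the zone.  Comparing both evaluations of the total weight gives the
    claim, which is effective when b1 + c exceeds i. *)
Lemma smooth_primes_count (W v i b0 b1 c : nat) (Dbd : R) :
  (b0 < b1)%N -> (b1 <= c)%N -> (c <= i)%N ->
  `|\sum_(n <- ap_primes W v i) disc_weight lg b0 b1 n| <= Dbd ->
  (size (ap_primes W v i))%:R * ((b1 + c)%:R - i%:R - (3 + 2 * b0 * b0.+1)%:R) <=
    Dbd + (size (zone W v i b1 c))%:R * (c - b1)%:R + (size (smooth_primes W v i b1))%:R * i%:R.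
Proof.
move=> b01 b1c ci hD.
set A := ap_primes W v i in hD *.
pose w q : R := \sum_(l <- moduli b0 b1 | (l %| q.-1)%N) lg l.
pose M := \sum_(l <- moduli b0 b1) lg l / l.-1%:R.
have mP l : l \in moduli b0 b1 -> [/\ prime l, (1 < l)%N & (l <= 2 ^ b1)%N].
  by rewrite mem_moduli => /and3P[_ pl /andP[_ h]]; split => //; exact: prime_gt1.
have hM := sum_lg_moduli lgM lg2 lg_le b01; rewrite -/M in hM.
(* the modulus l = q contributes 0 to the discrepancy of q but is counted in M, at a cost of at most 1 *)
have wge q : q \in A -> disc_weight lg b0 b1 q + M - 1 <= w q.
  move=> /ap_primesP[pq _ _ _]; have q1 := prime_gt1 pq.
  have -> : disc_weight lg b0 b1 q = w q - \sum_(l <- moduli b0 b1 | ~~ (l %| q)%N) lg l / l.-1%:R.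
    rewrite /disc_weight /w !(big_mkcond (fun l => _ %| _)%N) (big_mkcond (fun l => ~~ _)) -sumrB.
    rewrite big_seq [RHS]big_seq; apply: eq_bigr => l /mP[pl l1 _].
    have e : (q %% l == 1)%N = (l %| q.-1)%N.
      by rewrite -subn1 -eqn_mod_dvd ?(ltnW q1) // (modn_small l1).
    rewrite /local_disc e; case: (l %| q.-1)%N; case: (l %| q)%N => /=; rewrite ?mul0r ?subr0 ?mulr0 ?mulr1 ?sub0r ?mul1r //.
    - by rewrite mulrBr mulr1.
    - by rewrite mulrN.
  rewrite /M [in X in _ + X - _](bigID (fun l => ~~ (l %| q)%N)) /=.
  have : \sum_(l <- moduli b0 b1 | ~~ ~~ (l %| q)%N) lg l / l.-1%:R <= 1.
    rewrite -big_filter.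
    apply: (@le_trans _ _ (\sum_(l <- [:: q]) lg l / l.-1%:R)).
      apply: ler_sum_sub.
      - exact/filter_uniq/moduli_uniq.
      - by move=> l; rewrite mem_filter negbK inE => /andP[h /mP[pl _ _]]; move: h; rewrite dvdn_prime2.
      - move=> l; rewrite inE => /eqP ->; rewrite divr_ge0 // (lg_ge0 lgM lg_le) //; exact: ltnW.
    have q1R : 0 < (q.-1%:R : R) by rewrite ltr0n; clear -q1; lia.
    by rewrite big_seq1 ler_pdivrMr // mul1r (lg_le_pred lgM lg2 lg_le) // ltnW.
  lra.
have lgi q : q \in A -> lg q.-1 <= i%:R.
  move=> /ap_primesP[/prime_gt1 q1 _ _ qY]; rewrite -(lg_pow2 lgM lg2); apply: lg_le.
  by rewrite -ltnS prednK ?(ltnW q1) // q1 /= (leq_trans (leq_pred q)).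
have wle q : q \in A -> w q <= (i - c)%:R + (has (fun l => l %| q.-1) (moduli b1 c))%N%:R * (c - b1)%:R
     + (all (fun p => p <= 2 ^ b1) (primes q.-1))%N%:R * c%:R.
  move=> qA; have hl := lgi _ qA; have /ap_primesP[/prime_gt1 q1 _ _ qY] := qA.
  have q0 : (0 < q.-1)%N by clear -q1; lia.
  pose t := [seq l <- moduli b0 b1 | (l %| q.-1)%N].
  have ut : uniq t by apply/filter_uniq/moduli_uniq.
  have tP l : l \in t -> [/\ prime l, (l <= 2 ^ b1)%N & (l %| q.-1)%N].
    by rewrite mem_filter => /andP[h /mP[pl _ h2]].
  have pt : all prime t by apply/allP => l /tP[].
  have dt : all (fun p => p %| q.-1)%N t by apply/allP => l /tP[].
  have wE : w q = \sum_(l <- t) lg l by rewrite /w big_filter.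
  have ic : (i - c)%:R = i%:R - c%:R :> R by rewrite natrB.
  have cb : (c - b1)%:R = c%:R - b1%:R :> R by rewrite natrB.
  have [sm|] := boolP (all _ (primes q.-1)).
    have : w q <= i%:R by rewrite wE; exact: le_trans (lg_sum_primes_le ut pt q0 dt) hl.
    have : 0 <= (has (fun l => l %| q.-1) (moduli b1 c))%N%:R * (c - b1)%:R :> R by rewrite mulr_ge0.
    by rewrite ic mul1r; lra.
  move=> /allPn[p]; rewrite mem_primes -ltnNge => /and3P[pp _ pq] bp.
  have h : w q + lg p <= i%:R.
    rewrite wE addrC; have := @lg_sum_primes_le (p :: t) q.-1; rewrite big_cons /= ut pp pt pq dt !andbT.
    move=> h; apply: le_trans (h _ isT q0 isT) hl.
    by apply/negP => /tP[_ h' _]; rewrite leqNgt bp in h'.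
  rewrite mul0r addr0.
  have [zn|zn] := boolP (has _ (moduli b1 c)).
    have : b1%:R <= lg p by rewrite -(lg_pow2 lgM lg2); apply: lg_le; rewrite expn_gt0 /= ltnW.
    by rewrite mul1r ic cb; lra.
  have : c%:R <= lg p.
    rewrite -(lg_pow2 lgM lg2); apply: lg_le; rewrite expn_gt0 /= leqNgt; apply/negP => pc.
    case/hasP: zn; exists p => //; rewrite mem_moduli pp bp (ltnW pc) !andbT.
    by rewrite -(@ltn_exp2l 2) //; exact: ltn_trans bp pc.
  by rewrite mul0r addr0 ic; lra.
have sumw1 : (size A)%:R * (M - 1) - Dbd <= \sum_(q <- A) w q.
  apply: (@le_trans _ _ (\sum_(q <- A) (disc_weight lg b0 b1 q + (M - 1)))); last first.
    rewrite big_seq [leRHS]big_seq; apply: ler_sum => q qA; by rewrite addrA wge.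
  rewrite big_split /= big_const_seq count_predT iter_addr_0 -[X in _ <= _ + X]mulr_natl.
  by move: hD; rewrite ler_norml => /andP[h _]; lra.
have sumw2 : \sum_(q <- A) w q <= (size A)%:R * (i - c)%:R + (size (zone W v i b1 c))%:R * (c - b1)%:R
    + (size (smooth_primes W v i b1))%:R * i%:R.
  apply: (@le_trans _ _ (\sum_(q <- A) ((i - c)%:R + (has (fun l => l %| q.-1) (moduli b1 c))%N%:R * (c - b1)%:R
     + (all (fun p => p <= 2 ^ b1) (primes q.-1))%N%:R * c%:R))).
    by rewrite big_seq [leRHS]big_seq; apply: ler_sum => q; exact: wle.
  have cnt (P : pred nat) (s : seq nat) : \sum_(q <- s) (P q)%:R = (size (filter P s))%:R :> R.
    rewrite size_filter -sum1_count natr_sum [RHS]big_mkcond /=; apply: eq_bigr => q _; by case: (P q).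
  rewrite !big_split /= -!mulr_suml !cnt big_const_seq count_predT iter_addr_0 -[X in X + _ + _]mulr_natl.
  rewrite lerD2l; apply: ler_wpM2l => //; by rewrite ler_nat.
have ic : (i - c)%:R = i%:R - c%:R :> R by rewrite natrB.
rewrite ic in sumw2.
have N0 : 0 <= (size A)%:R :> R by [].
have := ler_wpM2l N0 hM.
rewrite !natrD natrM; move: sumw1 sumw2; clear; rewrite !natrM; lra.
Qed.

End Classification.

(** * Scales with many primes congruent to 1 modulo W *)
(** Otherwise the blocks 2^(10 t) <= i < 2^(10 t + 10) would contribute at most
    2^11 / 2^t each to the sum of the reciprocals, which makes its tails tend to 0.
    R is the field in which that sum is taken. *)
Lemma exists_dense_block (R : realFieldType) W t1 : (0 < W)%N -> exists t i, [/\ (t1 <= t)%N,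
  (2 ^ (10 * t) <= i < 2 ^ (10 * t.+1))%N
  & (2 ^ i <= 2 ^ (11 * t) * size (ap_primes W (2 ^ (4 * t)) i))%N].
Proof.
move=> W0; have [C hC] := sum_inv_primes_ap R W0.
pose t0 := (t1 + C + 13)%N.
have [X hX] := hC (2 ^ (2 ^ (10 * t0)))%N.
pose Ts := iota t0 X.
pose Is t := iota (2 ^ (10 * t)) (2 ^ (10 * t.+1)).
pose good t i := ((i < 2 ^ (10 * t.+1)) && (2 ^ i <= 2 ^ (11 * t) * size (ap_primes W (2 ^ (4 * t)) i)))%N.
have [/hasP[t tT /hasP[i iI /andP[i2 gd]]]|nog] := boolP (has (fun t => has (good t) (Is t)) Ts).
  move: tT iI; rewrite !mem_iota => /andP[t0t _] /andP[i1 _].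
  exists t, i; split=> //; last by rewrite i1 i2.
  by apply: leq_trans t0t; rewrite /t0 -addnA leq_addr.
exfalso; move: hX; apply/negP; rewrite -ltNge.
pose Q t i := [seq q <- ap_primes W (2 ^ (4 * t)) i | (2 ^ i.-1 < q)%N].
pose I' t := [seq i <- Is t | (i < 2 ^ (10 * t.+1))%N].
have sub : {subset [seq q <- primes_upto X | (2 ^ 2 ^ (10 * t0) < q)%N && (q %% W == 1 %% W)%N]
   <= flatten [seq flatten [seq Q t i | i <- I' t] | t <- Ts]}.
  move=> q; rewrite mem_filter mem_primes_upto => /andP[/andP[q0q qW] /andP[pq qX]].
  have q1 := prime_gt1 pq.
  have /andP[u1 u2] := up_log_bounds (isT : 1 < 2)%N q1; set i := up_log 2 q in u1 u2.
  have i0 : (2 ^ (10 * t0) < i)%N by rewrite -(@ltn_exp2l 2) //; apply: leq_trans u2.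
  have ip : (0 < i)%N by apply: leq_trans i0.
  pose t := (trunc_log 2 i %/ 10)%N.
  have := trunc_log_bounds (isT : 1 < 2)%N ip; set l := trunc_log 2 i => /andP[l1 l2].
  have tl : (10 * t <= l)%N by rewrite mulnC leq_trunc_div.
  have tl2 : (l < 10 * t.+1)%N by rewrite mulnC ltn_ceil.
  have i1 : (2 ^ (10 * t) <= i)%N by apply: leq_trans l1; rewrite leq_exp2l.
  have i2 : (i < 2 ^ (10 * t.+1))%N by apply: leq_trans l2 _; rewrite leq_exp2l.
  have t0t : (t0 <= t)%N.
    rewrite -ltnS -(@ltn_pmul2l 10) // -(@ltn_exp2l 2) //; exact: ltn_trans i0 i2.
  have tX : (t < t0 + X)%N.
    apply: ltn_addl.
    have iq : (i <= q)%N.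
      by have := ltn_expl i.-1 (isT : 1 < 2)%N; move: u1 ip; move: (2 ^ _)%N; clear; lia.
    apply: leq_trans (leq_trans iq qX); apply: leq_trans i1.
    by apply: (leq_trans (ltn_expl t (isT : 1 < 2)%N)); rewrite leq_exp2l // leq_pmull.
  apply/flatten_mapP; exists t; first by rewrite mem_iota t0t tX.
  apply/flatten_mapP; exists i.
    by rewrite mem_filter i2 mem_iota i1 /= (leq_trans i2) // leq_addl.
  rewrite mem_filter u1 mem_filter qW pq andbT (pdiv_id pq) /=.
  rewrite mem_iota q1 add2n prednK ?expn_gt0 // ltnS u2 !andbT.
  apply: leq_ltn_trans u1; rewrite leq_exp2l // -ltnS prednK //; apply: leq_trans i1.
  rewrite ltn_exp2l // ltn_pmul2r //; by apply: leq_trans t0t; rewrite /t0 addnS.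
have Qs t i : t \in Ts -> i \in I' t -> \sum_(q <- Q t i) q%:R^-1 <= 2 / 2 ^+ (11 * t) :> R.
  move=> tT; rewrite mem_filter => /andP[i2 iI].
  have ng : (size (ap_primes W (2 ^ (4 * t)) i) * 2 ^ (11 * t) <= 2 ^ i)%N.
    rewrite mulnC leqNgt; apply/negP => /ltnW h; case/negP: nog; apply/hasP; exists t => //.
    by apply/hasP; exists i => //; rewrite /good i2.
  have ip : (0 < i)%N by move: iI; rewrite mem_iota => /andP[h _]; apply: leq_trans h; rewrite expn_gt0.
  apply: (@le_trans _ _ (\sum_(q <- Q t i) (2 ^ i.-1)%N%:R^-1)).
    rewrite big_seq [leRHS]big_seq; apply: ler_sum => q; rewrite mem_filter => /andP[h _].
    by rewrite lef_pV2 ?posrE ?ltr0n ?expn_gt0 //; [rewrite ler_nat ltnW|exact: leq_ltn_trans h].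
  rewrite big_const_seq count_predT iter_addr_0 -[leLHS]mulr_natl.
  rewrite ler_pdivrMr ?ltr0n ?expn_gt0 // mulrAC -natrX ler_pdivlMr ?ltr0n ?expn_gt0 //.
  rewrite -natrM -[2]/(2%:R) -natrM ler_nat -expnS prednK //.
  apply: leq_trans ng; rewrite leq_mul2r; apply/orP; right.
  by rewrite size_filter; apply: count_size.
have It t : t \in Ts -> \sum_(i <- I' t) \sum_(q <- Q t i) q%:R^-1 <= 2 ^+ 11 / 2 ^+ t :> R.
  move=> tT; apply: (@le_trans _ _ (\sum_(i <- I' t) 2 / 2 ^+ (11 * t))).
    by rewrite big_seq [leRHS]big_seq; apply: ler_sum => i; exact: Qs.
  rewrite big_const_seq count_predT iter_addr_0 -[leLHS]mulr_natl.
  have sI : (size (I' t) <= 2 ^ (10 * t.+1))%N.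
    apply: (@leq_trans (size (iota 0 (2 ^ (10 * t.+1))))); last by rewrite size_iota.
    apply: uniq_leq_size; first exact/filter_uniq/iota_uniq.
    by move=> i; rewrite mem_filter mem_iota => /andP[h _].
  rewrite mulrA ler_pdivrMr ?exprn_gt0 // mulrAC ler_pdivlMr ?exprn_gt0 //.
  rewrite -[2]/(2%:R) -!natrX -!natrM ler_nat.
  apply: (leq_trans (leq_mul (leq_mul sI (leqnn 2)) (leqnn _))).
  by rewrite -expnSr -!expnD leq_exp2l //; clear; lia.
have geo N : \sum_(t <- iota t0 N) 2 ^+ 11 / 2 ^+ t <= 2 ^+ 12 / 2 ^+ t0 :> R.
  apply: (@le_trans _ _ (2 ^+ 12 / 2 ^+ t0 - 2 ^+ 12 / 2 ^+ (t0 + N))); last first.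
    by rewrite lerBlDr lerDl divr_ge0 ?exprn_ge0.
  elim: N => [|N IH]; first by rewrite big_nil addn0 subrr.
  rewrite -addn1 iotaD big_cat big_seq1 /=; apply: (le_trans (lerD IH (lexx _))).
  have x0 : 0 < 2 ^+ (t0 + N) :> R by rewrite exprn_gt0.
  rewrite addnA addn1 [2 ^+ (t0 + N).+1]exprS (exprS _ 11) invfM.
  move: (2 ^+ 11) (2 ^+ t0)^-1 (2 ^+ (t0 + N))^-1; clear => a b c; lra.
apply: (@le_lt_trans _ _ (C%:R * (2 ^+ 12 / 2 ^+ t0))).
  apply: ler_wpM2l; rewrite ?ler0n //; apply: le_trans (geo X).
  rewrite -big_filter; apply: (le_trans (ler_sum_sub _ sub _)).
  - by rewrite filter_uniq // primes_upto_uniq.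
  - by move=> q _; rewrite invr_ge0 ler0n.
  - rewrite big_flatten big_map big_seq [leRHS]big_seq; apply: ler_sum => t tT.
    by rewrite big_flatten big_map; exact: It.
rewrite mulrA ltr_pdivrMr ?exprn_gt0 // mul1r -[2]/(2%:R) -!natrX -natrM ltr_nat.
have -> : t0 = (t1.+1 + C + 12)%N by rewrite /t0; clear; lia.
rewrite expnD ltn_pmul2r ?expn_gt0 //.
by apply: (leq_trans (ltn_expl C (isT : 1 < 2)%N)); rewrite leq_exp2l // leq_addl.
Qed.

(** * Choice of the parameters *)
Lemma ler_frac_nat (R : realFieldType) (a b c d : nat) : (0 < b)%N -> (0 < d)%N ->
  (a * d <= c * b)%N -> a%:R / b%:R <= c%:R / d%:R :> R.
Proof.
move=> b0 d0 h; rewrite ler_pdivrMr ?ltr0n // mulrAC ler_pdivlMr ?ltr0n //.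
by rewrite -!natrM ler_nat.
Qed.


(** The bookkeeping of [smooth_primes_lower], with q = s^2: of the gain 48 q N the
    zone takes at most 40 q N. *)
Lemma half_zone_absorbed (R : realFieldType) (N Z q T : R) : 1 <= q -> 0 <= N ->
  2 * Z <= N -> N * (48 * q) <= N + Z * (80 * q) + T -> N <= T.
Proof.
move=> q1 N0 ZN h.
have : 0 <= (N - 2 * Z) * q by apply: mulr_ge0; lra.
have : 0 <= N * (q - 1) by apply: mulr_ge0; lra.
lra.
Qed.

Section Params.
Variables (R : realFieldType) (lg : nat -> R).
Hypothesis lgM : forall a b, (0 < a)%N -> (0 < b)%N -> lg (a * b) = lg a + lg b.
Hypothesis lg2 : lg 2 = 1.
Hypothesis lg_le : forall a b, (0 < a <= b)%N -> lg a <= lg b.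
Variables (W t i : nat).
Hypothesis W0 : (0 < W)%N.
Hypothesis t_ge20 : (20 <= t)%N.
Hypothesis W_small : (W <= 2 ^ (t - 20))%N.
Hypothesis iB : (2 ^ (10 * t) <= i < 2 ^ (10 * t.+1))%N.

Local Notation s := (2 ^ t)%N.
Local Notation v := (2 ^ (4 * t))%N.
Local Notation N1 := (size (ap_primes W v i)).
Hypothesis dense : (2 ^ i <= 2 ^ (11 * t) * N1)%N.

Let b0 := (3 * s)%N.
Let b1 := (i./2 - 3 * s)%N.
Let c := (b1 + 80 * 2 ^ (2 * t))%N.
Let r := (3 * v)%N.

Lemma W_le : (W <= 2 ^ t)%N.
Proof. by apply: leq_trans W_small _; rewrite leq_exp2l // leq_subr. Qed.

(** The scales s = 2^t, s^2, v = s^4, s^8 and i >= s^10 are far apart.  All later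
    comparisons of bounds are comparisons of exponents of 2, that is, linear
    consequences of these inequalities. *)
Lemma scale_gaps : [/\ (100 * t + 100 <= s)%N, (2 ^ (2 * t) = s * s)%N, (v = 2 ^ (2 * t) * 2 ^ (2 * t))%N,
  (1000 * (v * v) <= i)%N & (1000 * s <= 2 ^ (2 * t) /\ 1000 * 2 ^ (2 * t) <= v)%N].
Proof.
have h : (100 * t + 100 <= s)%N.
  move: t_ge20; clear; elim: t => // k IH; rewrite leq_eqVlt => /orP[/eqP <- //|].
  by rewrite ltnS => /IH; rewrite expnS; lia.
have e2 : (2 ^ (2 * t) = s * s)%N by rewrite mul2n -addnn expnD.
have e4 : (v = 2 ^ (2 * t) * 2 ^ (2 * t))%N.
  by rewrite -expnD; congr (2 ^ _)%N; clear; lia.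
have s1 : (1000 <= s)%N by move: h t_ge20; move: s; clear; lia.
have s2 : (1000 <= 2 ^ (2 * t))%N by rewrite e2; move: s1; move: s; clear; nia.
split=> //.
  have /andP[h1 _] := iB; apply: leq_trans h1.
  have -> : (10 * t = 2 * t + (4 * t + 4 * t))%N by clear; lia.
  by rewrite expnD [X in (_ <= _ * X)%N]expnD leq_mul2r s2 orbT.
split; first by rewrite e2; exact: leq_mul.
by rewrite e4; exact: leq_mul.
Qed.

Let Dbd : R := i%:R * ((i.+1 * 2 ^ s.+1 * W)%:R * ((1100 * i * 2 ^ i)%:R / 8 ^+ s)
       + (i.+3 * 2 ^ i)%:R / 2 ^+ s * (3 * i + 2)%:R
       + 16 * (2 ^ i * 4 ^ v.+1)%:R / 2 ^+ r * i.+1%:R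
       + (5 * 2 ^ (v.+1 * r) * 2 ^ b1)%:R).

Lemma i_upper : (i.+3 <= 2 ^ (10 * t + 11))%N.
Proof.
have [h _ _ h2 [h3 h4]] := scale_gaps; have /andP[_ h5] := iB.
have -> : (10 * t + 11 = 10 * t.+1 + 1)%N by clear; lia.
have v0 : (0 < v * v)%N by rewrite muln_gt0 expn_gt0.
rewrite expnD; move: h5 h2 v0; move: (2 ^ (10 * t.+1))%N (v * v)%N => x y.
by clear; lia.
Qed.

(** Each of the four error terms of [prime_disc] saves more than the power of i that
    separates 2^i from the number N1 of primes: 8^s and 2^s beat powers of 2^t,
    the sieve of depth r = 3 v beats 4^v, and i / 2 beats s^8. *)
Lemma disc_bound : Dbd <= N1%:R.
Proof.
have [h1 h2 h3 h4 [h5 h6]] := scale_gaps.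
have il := i_upper.
have i1 : (i <= 2 ^ (10 * t + 11))%N by apply: leq_trans il; clear; lia.
have i2 : (i.+1 <= 2 ^ (10 * t + 11))%N by apply: leq_trans il; clear; lia.
have i3 : (3 * i + 2 <= 2 ^ (10 * t + 13))%N.
  have -> : (10 * t + 13 = (10 * t + 11).+2)%N by clear; lia.
  by rewrite 2!expnS; move: i1 i2; move: (2 ^ (10 * t + 11))%N; clear; lia.
pose Y := (2 ^ i)%N; pose S := (2 ^ (11 * t + 2))%N.
have S0 : (0 < S)%N by rewrite expn_gt0.
apply: (@le_trans _ _ (4 * (Y%:R / S%:R))); last first.
  rewrite mulrA ler_pdivrMr ?ltr0n // -[4]/(4%:R) -natrM -natrM ler_nat /S /Y.
  rewrite expnD; apply: (leq_trans (leq_mul (leqnn 4) dense)).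
  by rewrite leq_eqVlt; apply/orP; left; apply/eqP; clear; ring.
rewrite /Dbd !mulrDr.
have -> : 4 * (Y%:R / S%:R) = Y%:R / S%:R + Y%:R / S%:R + Y%:R / S%:R + Y%:R / S%:R :> R by ring.
apply: lerD; [apply: lerD; [apply: lerD|]|].
- rewrite [8 ^+ s](_ : _ = (2 ^ (3 * s))%N%:R); last by rewrite expnM natrX.
  rewrite !mulrA -!natrM; apply: ler_frac_nat; rewrite ?expn_gt0 //.
  have h1100 : (1100 <= 2 ^ 11)%N by [].
  apply: (leq_trans (leq_mul (leq_mul (leq_mul i1 (leq_mul (leq_mul i2 (leqnn _)) W_le))
     (leq_mul (leq_mul h1100 i1) (leqnn _))) (leqnn S))).
  by rewrite /S /Y -!expnD leq_exp2l //; move: h1; move: s; clear; lia.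
- rewrite [X in X <= _](_ : _ = (i * (i.+3 * 2 ^ i) * (3 * i + 2))%N%:R / (2 ^ s)%N%:R); last first.
    rewrite [in RHS]natrM [in RHS]natrM natrX; ring.
  apply: ler_frac_nat; rewrite ?expn_gt0 //.
  apply: (leq_trans (leq_mul (leq_mul (leq_mul i1 (leq_mul il (leqnn _))) i3) (leqnn S))).
  by rewrite /S /Y -!expnD leq_exp2l //; move: h1; move: s; clear; lia.
- rewrite [X in X <= _](_ : _ = (i * 16 * (2 ^ i * 4 ^ v.+1) * i.+1)%N%:R / (2 ^ r)%N%:R); last first.
    by rewrite [in RHS]natrM [in RHS]natrM [in RHS]natrM natrX; ring.
  apply: ler_frac_nat; rewrite ?expn_gt0 //.
  rewrite -[4%N]/(2 ^ 2)%N -[16%N]/(2 ^ 4)%N -expnM.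
  apply: (leq_trans (leq_mul (leq_mul (leq_mul (leq_mul i1 (leqnn _)) (leqnn _)) i2) (leqnn S))).
  rewrite /S /Y /r -!expnD leq_exp2l //; move: h1 h5 h6; move: v s (2 ^ (2 * t))%N; clear; lia.
rewrite -natrM ler_pdivlMr ?ltr0n // -natrM ler_nat.
have h5' : (5 <= 2 ^ 3)%N by [].
apply: (leq_trans (leq_mul (leq_mul i1 (leq_mul (leq_mul h5' (leqnn _)) (leqnn _))) (leqnn S))).
rewrite /S /Y -!expnD leq_exp2l // /b1 /r.
have -> : (v.+1 * (3 * v) = 3 * (v * v) + 3 * v)%N by move: v; clear; lia.
have hvv : (v <= v * v)%N by rewrite leq_pmulr // expn_gt0.
have := odd_double_half i; rewrite -mul2n.
move: hvv h1 h4 h5 h6; move: (v * v)%N => y; move: v s (2 ^ (2 * t))%N (i./2) (odd i); clear; lia.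
Qed.

Lemma b1_ge : (2 ^ (10 * t) <= 4 * b1)%N.
Proof.
have [h1 h2 h3 h4 [h5 h6]] := scale_gaps; have /andP[h7 _] := iB.
have hvv : (v <= v * v)%N by rewrite leq_pmulr // expn_gt0.
apply: (leq_trans h7); rewrite /b1; have := odd_double_half i; rewrite -mul2n.
have := leq_b1 (odd i).
move: hvv h1 h4 h5 h6; move: (v * v)%N => y; move: v s (2 ^ (2 * t))%N (i./2) (odd i : nat); clear; lia.
Qed.

Lemma b1_c_bounds : [/\ (c + v.+1 * r + (11 * t + 3) <= i)%N, (6 * s <= i)%N, (v <= b1)%N & (b0 + s <= b1)%N].
Proof.
have [h1 h2 h3 h4 [h5 h6]] := scale_gaps; have /andP[h7 _] := iB.
have -> : (v.+1 * r = 3 * (v * v) + 3 * v)%N by rewrite /r; move: v; clear; lia.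
have hvv : (v <= v * v)%N by rewrite leq_pmulr // expn_gt0.
rewrite /c /b1 /b0; have := odd_double_half i; rewrite -mul2n.
have := leq_b1 (odd i).
move: hvv h1 h4 h5 h6; move: (v * v)%N => y; move: v s (2 ^ (2 * t))%N (i./2) (odd i : nat); clear.
move=> a b d e f *; split; lia.
Qed.

(** The zone is so short, of length 80 s^2 against b1 of order s^10, that the sieve
    bound is smaller than N1 by a factor of order W / s. *)
Lemma zone_bound : 2 * (size (zone W v i b1 c))%:R <= N1%:R :> R.
Proof.
have [h1 h2 h3 h4 [h5 h6]] := scale_gaps; have [g1 g2 g3 g4] := b1_c_bounds; have g5 := b1_ge.
have b1p : (0 < b1)%N by apply: leq_trans g3; rewrite expn_gt0.
have v0 : (0 < v)%N by rewrite expn_gt0.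
have cb : (c - b1 = 80 * 2 ^ (2 * t))%N by rewrite /c addKn.
have Wb1 : (W <= 2 ^ b1)%N.
  apply: leq_trans W_le _; rewrite leq_exp2l //; apply: leq_trans (ltnW (ltn_expl t (isT : 1 < 2)%N)) _.
  by apply: leq_trans g4; rewrite leq_addl.
have b1c : (0 < b1 <= c)%N by rewrite b1p /c leq_addr.
have ci : (c <= i)%N by apply: leq_trans g1; rewrite -addnA leq_addr.
have := zone_size R r W0 v0 Wb1 g3 b1c ci; rewrite cb => hz.
pose Y := (2 ^ i)%N; pose S := (2 ^ (11 * t + 3))%N.
have S0 : (0 < S)%N by rewrite expn_gt0.
have N1b : 8 * (Y%:R / S%:R) <= N1%:R :> R.
  rewrite mulrA ler_pdivrMr ?ltr0n // -[8]/(8%:R) -natrM -natrM ler_nat /S /Y.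
  rewrite expnD; apply: (leq_trans (leq_mul (leqnn 8) dense)).
  by rewrite leq_eqVlt; apply/orP; left; apply/eqP; clear; ring.
suff : (size (zone W v i b1 c))%:R <= 3 * (Y%:R / S%:R) :> R.
  have : 0 <= Y%:R / S%:R :> R by rewrite divr_ge0 ?ler0n.
  by lra.
apply: (le_trans hz).
have -> : 3 * (Y%:R / S%:R) = Y%:R / S%:R + Y%:R / S%:R + Y%:R / S%:R :> R by ring.
rewrite mulrDr mulrDl; apply: lerD; [apply: lerD|].
- rewrite [X in X <= _](_ : _ = (2 * 2 ^ i * (2 * W) * (2 * (80 * 2 ^ (2 * t))))%N%:R / (v * b1)%N%:R); last first.
    by rewrite [in RHS]natrM [in RHS]natrM [(v * b1)%:R]natrM invfM; ring.
  apply: ler_frac_nat; rewrite ?muln_gt0 ?expn_gt0 ?b1p //.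
  rewrite -(leq_pmul2l (isT : 0 < 4)%N).
  have h80 : (80 <= 2 ^ 7)%N by [].
  apply: (@leq_trans (Y * (v * 2 ^ (10 * t)))%N); last first.
    by rewrite [leqRHS]mulnCA leq_mul2l [leqRHS]mulnCA leq_mul2l g5 !orbT.
  rewrite -[4%N]/(2 ^ 2)%N.
  apply: (leq_trans (leq_mul (leqnn (2 ^ 2)) (leq_mul (leq_mul (leq_mul (leqnn (2 ^ 1 * 2 ^ i)) (leq_mul (leqnn (2 ^ 1)) W_small)) (leq_mul (leqnn (2 ^ 1)) (leq_mul h80 (leqnn _)))) (leqnn S)))).
  by rewrite /S /Y -!expnD leq_exp2l //; move: t_ge20; clear; lia.
- rewrite [X in X <= _](_ : _ = (2 * 2 ^ i * 4 ^ v.+1 * (2 * (80 * 2 ^ (2 * t))))%N%:R / (2 ^ r * b1)%N%:R); last first.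
    by rewrite [in RHS]natrM [in RHS]natrM [(2 ^ r * b1)%:R]natrM [(2 ^ r)%:R]natrX invfM; ring.
  apply: ler_frac_nat; rewrite ?muln_gt0 ?expn_gt0 ?b1p //.
  have h80 : (80 <= 2 ^ 7)%N by [].
  apply: (@leq_trans (Y * (2 ^ r * 1))%N); last by rewrite leq_mul2l leq_mul2l b1p !orbT.
  rewrite muln1 -[4%N]/(2 ^ 2)%N -expnM.
  apply: (leq_trans (leq_mul (leq_mul (leqnn (2 ^ 1 * 2 ^ i * 2 ^ (2 * v.+1))) (leq_mul (leqnn (2 ^ 1)) (leq_mul h80 (leqnn _)))) (leqnn S))).
  by rewrite /S /Y /r -!expnD leq_exp2l //; move: h1 h5 h6; move: v s (2 ^ (2 * t))%N; clear; lia.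
rewrite ler_pdivlMr ?ltr0n // -natrM ler_nat /S /Y -!expnD leq_exp2l //.
Qed.

(** With c - b1 = 80 s^2 the quantity b1 + c - i of [smooth_primes_count] exceeds
    the losses of order 18 s^2, due to b0 = 3 s, by at least 48 s^2. *)
Lemma smooth_primes_lower : (N1 <= size (smooth_primes W v i b1) * i)%N.
Proof.
have [h1 h2 h3 h4 [h5 h6]] := scale_gaps; have [g1 g2 g3 g4] := b1_c_bounds; have g5 := b1_ge.
have s0 : (0 < s)%N by rewrite expn_gt0.
have v0 : (0 < v)%N by rewrite expn_gt0.
have b01 : (b0 < b1)%N by apply: leq_trans g4; rewrite -addn1 leq_add2l.
have ci : (c <= i)%N by apply: leq_trans g1; rewrite -addnA leq_addr.
have b1c : (b1 <= c)%N by rewrite /c leq_addr.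
have b1i : (2 * b1 + 6 * s <= i)%N.
  rewrite /b1; have := odd_double_half i; rewrite -mul2n; move: g2; clear.
  by move: s (i./2) (odd i : nat); lia.
have i0 : (0 < i)%N by apply: leq_trans ci; apply: leq_trans b1c; apply: leq_ltn_trans b01.
have lgB l : l \in moduli b0 b1 -> 0 <= lg l <= i%:R.
  rewrite mem_moduli => /and3P[_ pl /andP[_ lb]].
  have l0 := prime_gt0 pl; rewrite lg_ge0 //= -(lg_pow2 lgM lg2); apply: lg_le.
  by rewrite l0 (leq_trans lb) // leq_exp2l // (leq_trans b1c).
have Wb0 : (W <= 2 ^ b0)%N.
  apply: leq_trans W_le _; rewrite leq_exp2l //; apply: leq_trans (ltnW (ltn_expl t (isT : 1 < 2)%N)) _.
  by rewrite /b0 leq_pmull.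
have b01i : (b0 + b1 <= i)%N by move: b1i g4 b01; rewrite /b0; clear; lia.
have sv : (6 * s <= v)%N by move: h5 h6; clear; lia.
have hD := @prime_disc R lg i%:R b0 b1 W v s i r (ler0n _ _) lgB W0 Wb0 i0 v0 sv (leqnn _) b01i b1i.
have hD' := le_trans hD disc_bound.
have := smooth_primes_count lgM lg2 lg_le b01 b1c ci hD'.
have hZ := zone_bound.
have -> : (c - b1 = 80 * (s * s))%N by rewrite /c addKn h2.
have hs : (2 * i./2 + 1 >= i)%N.
  have := odd_double_half i; rewrite -mul2n; have := leq_b1 (odd i); clear.
  by move: (i./2) (odd i : nat); lia.
(* 62 s^2 - 12 s - 4 >= 48 s^2 for s >= 100 *)
have hb : ((b1 + c)%:R - i%:R - (3 + 2 * b0 * b0.+1)%:R) >= 48 * (s%:R * s%:R) :> R.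
  rewrite -natrM -[48]/(48%:R) -natrM lerBrDr -natrD lerBrDr -natrD ler_nat.
  have s100 : (100 <= s)%N by apply: leq_trans h1; rewrite leq_addl.
  have hss : (100 * s <= s * s)%N by rewrite leq_mul2r s100 orbT.
  rewrite /c h2; have e : (b1 + 3 * s = i./2)%N by rewrite subnK //; move: b1i g4 i0; rewrite /b0 /b1; clear; lia.
  have -> : (2 * b0 * b0.+1 = 18 * (s * s) + 6 * s)%N by rewrite /b0; clear; ring.
  move: hss e hs s100; move: (s * s)%N s b1 (i./2); clear; lia.
rewrite -(ler_nat R) [(_ * i)%:R]natrM.
set N := N1%:R in hZ *; set Z := (size (zone _ _ _ _ _))%:R in hZ *.
set T := _%:R * i%:R => h.
have N0 : 0 <= N by rewrite ler0n.
have sR : 1 <= s%:R :> R by rewrite ler1n.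
have : N * (48 * (s%:R * s%:R)) <= N + Z * (80 * (s * s))%N%:R + T.
  by apply: le_trans h; apply: ler_wpM2l.
rewrite !natrM; apply: half_zone_absorbed => //.
by have := ler_pM ler01 ler01 sR sR; rewrite mulr1.
Qed.
End Params.

(** * Many primes q with q - 1 dividing one small number *)
Lemma fact_le_expn n : (n`! <= n ^ n)%N.
Proof.
elim: n => // n IH; rewrite factS expnS leq_mul2l /=; apply: (leq_trans IH).
by case: n {IH} => // n; rewrite leq_exp2r.
Qed.

(** A number below 2^i has all its exponents at most i. *)
Lemma smooth_dvd_fact B i n : (0 < n)%N -> (n <= 2 ^ i)%N ->
  all (fun p => p <= B)%N (primes n) -> (n %| B`! ^ i)%N.
Proof.
move=> n0 ni /allP sm; apply/dvdn_partP => // p pn.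
have /and3P[pp _ pdn] : [&& prime p, 0 < n & p %| n]%N by rewrite -mem_primes.
rewrite p_part; apply: dvdn_trans (dvdn_exp2r i (_ : p %| B`!)%N); last first.
  by apply: dvdn_fact; rewrite prime_gt0 // sm.
rewrite dvdn_exp2l // -(@leq_exp2l 2) //; apply: leq_trans ni.
apply: (@leq_trans (p ^ logn p n)); last by rewrite dvdn_leq // pfactor_dvdnn.
by case: (logn p n) => // k; rewrite leq_exp2r // prime_gt1.
Qed.

Section Log.
Variables (R : realFieldType) (lg : nat -> R).
Hypothesis lgM : forall a b, (0 < a)%N -> (0 < b)%N -> lg (a * b) = lg a + lg b.
Hypothesis lg2 : lg 2 = 1.
Hypothesis lg_le : forall a b, (0 < a <= b)%N -> lg a <= lg b.

(** The point is that k m <= size S makes (1 - 1/m)^(size S) at most 2^-k, which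
    beats L 2^e.  Here m is of order 2^(i/2), and at least 4 sqrt q, the primes
    of S have q - 1 smooth for the bound 2^b1 = 2^(i/2 - 3 s), and S has at least
    2^i / i^3 elements.  The logarithm of L is about 2^b1, up to powers of i, so the
    factor 2^(3 s) leaves room for k m <= size S. *)
Theorem many_smooth_shifted_primes W e Q0 : (0 < W)%N ->
  exists (S : seq nat) (L m k : nat), [/\ uniq S, (0 < L)%N && (0 < m)%N,
    (forall q, q \in S -> [/\ prime q, (W %| q.-1)%N, (q.-1 %| L)%N, (Q0 < q)%N & (16 * q <= m ^ 2)%N]),
    (L * 2 ^ e <= 2 ^ k)%N & (k * m <= size S)%N].
Proof.
move=> W0; have [t [i [tt iB dense]]] := exists_dense_block R (W + e + Q0 + 20) W0.
have t20 : (20 <= t)%N by apply: leq_trans tt; rewrite leq_addl.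
have Wt : (W <= 2 ^ (t - 20))%N.
  apply: leq_trans (ltnW (ltn_expl W (isT : 1 < 2)%N)) _; rewrite leq_exp2l //.
  by move: tt; clear; lia.
have [h1 h2 h3 h4 [h5 h6]] := scale_gaps t20 iB.
have [g1 g2 g3 g4] := b1_c_bounds t20 iB.
have il := i_upper t20 iB.
have ct := smooth_primes_lower lgM lg2 lg_le W0 t20 Wt iB dense.
set s := (2 ^ t)%N in h1 h2 h5 g2 g3 g4 ct *; set v := (2 ^ (4 * t))%N in h3 h4 h6 g3 ct dense *.
set b1 := (i./2 - 3 * s)%N in g3 g4 ct *.
pose S := smooth_primes W v i b1; pose k := (b1 * 2 ^ b1 * i + e)%N.
exists S, ((2 ^ b1)`! ^ i)%N, (2 ^ (i./2 + 3))%N, k; split.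
- by rewrite !filter_uniq // iota_uniq.
- by rewrite !expn_gt0 fact_gt0.
- move=> q; rewrite mem_filter => /andP[sm qA].
  have [pq qW vq qi] := ap_primesP qA; have q1 := prime_gt1 pq.
  split=> //; first exact: ap_primes_dvd qA.
  + apply: smooth_dvd_fact => //; first by move: q1; clear; lia.
    by apply: leq_trans qi; exact: leq_pred.
  + apply: ltn_trans vq; apply: leq_ltn_trans (ltn_expl _ (isT : 1 < 2)%N).
    apply: (@leq_trans t); first by move: tt; clear; lia.
    apply: leq_trans (ltnW (ltn_expl t (isT : 1 < 2)%N)) _; rewrite leq_exp2l //; exact: leq_pmull.
  + rewrite -expnM; apply: (@leq_trans (2 ^ 4 * 2 ^ i)); first by rewrite leq_mul2l qi.
    rewrite -expnD leq_exp2l //; have := odd_double_half i; rewrite -mul2n; have := leq_b1 (odd i).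
    by clear; move: (i./2) (odd i : nat); lia.
- rewrite /k expnD leq_mul2r expn_eq0 /= expnM.
  case: (i) => // i'; rewrite leq_exp2r // expnM; exact: fact_le_expn.
rewrite -(@leq_pmul2r (i * 2 ^ (11 * t))); last first.
  by rewrite muln_gt0 expn_gt0 andbT; apply: leq_trans g2; rewrite muln_gt0 expn_gt0.
rewrite [leqRHS]mulnA; apply: (@leq_trans (2 ^ i)); last first.
  by apply: (leq_trans dense); rewrite mulnC leq_mul2r ct orbT.
have i1 : (i <= 2 ^ (10 * t + 11))%N by apply: leq_trans il; clear; lia.
have b1i : (b1 <= 2 ^ (10 * t + 11))%N.
  apply: leq_trans i1; by apply: (leq_trans (leq_subr _ _)); rewrite -{2}(odd_double_half i) -addnn addnCA leq_addr.
have et : (e <= b1 * 2 ^ b1 * i)%N.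
  apply: (@leq_trans i).
    apply: leq_trans g2; move: tt h1; clear; lia.
  rewrite leq_pmull // muln_gt0 expn_gt0 andbT.
  by apply: leq_trans g3; rewrite expn_gt0.
have hk : (k <= 2 ^ (1 + (10 * t + 11 + b1 + (10 * t + 11))))%N.
  rewrite expnD [X in (_ <= X * _)%N]/= mul2n -addnn /k; apply: leq_add.
    by rewrite !(expnD _ _ (10 * t + 11)) expnD; do !apply: leq_mul.
  apply: (leq_trans et).
  by rewrite !(expnD _ _ (10 * t + 11)) expnD; do !apply: leq_mul.
apply: (leq_trans (leq_mul (leq_mul hk (leqnn _)) (leq_mul i1 (leqnn _)))).
rewrite -!expnD leq_exp2l //; move: g2 h1; rewrite /b1.
have := odd_double_half i; rewrite -mul2n; have := leq_b1 (odd i).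
by clear; move: (i./2) (odd i : nat); lia.
Qed.

End Log.

(** * The image of g -> g^a (g - 1) on a finite field *)
Section ImageGap.
Variables (F : finFieldType) (a : nat).
Local Notation n := #|F|.-1.

Lemma expf_pred_card (t : F) : t != 0 -> t ^+ n = 1.
Proof.
move=> t0; apply: (mulfI t0); rewrite mulr1 -exprS prednK; last by apply/card_gt0P; exists 0.
exact: expf_card.
Qed.

Lemma card_nonzero : #|[set t : F | t != 0]| = n.
Proof.
have -> : [set t : F | t != 0] = ~: [set 0] by apply/setP => t; rewrite !inE.
by rewrite cardsC1.
Qed.

Lemma exists_expf_neq1 b : ~~ (n %| b)%N -> exists2 t : F, t != 0 & t ^+ b != 1.
Proof.
move=> nb; apply/exists_inP; apply: contraNT nb => /exists_inPn h.
have n0 : (0 < n)%N by rewrite -card_nonzero; apply/card_gt0P; exists 1; rewrite inE oner_neq0.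
rewrite /dvdn; apply: contraT; rewrite -lt0n => b0.
have lt := ltn_pmod b n0.
suff : (n <= b %% n)%N by rewrite leqNgt lt.
rewrite -{1}card_nonzero cardE; apply: max_unity_roots => //; last exact: enum_uniq.
apply/allP => t; rewrite mem_enum inE => t0; apply/unity_rootP.
have := h t t0; rewrite negbK => /eqP <-.
by rewrite [in RHS](divn_eq b n) exprD mulnC exprM expf_pred_card // expr1n mul1r.
Qed.

Local Notation ker b := [set t : F | (t != 0) && (t ^+ b == 1)].

Lemma ker_half b : ~~ (n %| b)%N -> (2 * #|ker b| <= n)%N.
Proof.
move=> /exists_expf_neq1[t t0 tb].
have inj : injective ( *%R t) by apply: mulfI.
have d : [disjoint ker b & [set t * x | x in ker b]].
  rewrite -setI_eq0; apply/eqP/setP => x; rewrite !inE; apply/negbTE/negP.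
  case/andP=> /andP[_ /eqP xb] /imsetP[y]; rewrite inE => /andP[_ /eqP yb] xE.
  by case/eqP: tb; rewrite -xb xE exprMn yb mulr1.
rewrite -card_nonzero mul2n -addnn -{2}(card_imset (mem (ker b)) inj) -cardsUI.
move: d; rewrite -setI_eq0 => /eqP ->; rewrite cards0 addn0; apply: subset_leq_card.
apply/subsetP => x; rewrite !inE => /orP[/andP[]//|/imsetP[y]].
by rewrite inE => /andP[y0 _] ->; rewrite mulf_neq0.
Qed.

Lemma ker_succI : ker a :&: ker a.+1 = [set 1].
Proof.
apply/setP => t; rewrite !inE; apply/idP/eqP => [|->]; last by rewrite oner_neq0 !expr1n eqxx.
by case/andP=> /andP[_ /eqP h] /andP[_]; rewrite exprS h mulr1 => /eqP.
Qed.

(** The two subgroups of exponents a and a + 1 intersect trivially, so their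
    product set has as many elements as the product of their orders. *)
Lemma ker_succM : (#|ker a| * #|ker a.+1| <= n)%N.
Proof.
rewrite -cardsX -card_nonzero.
have inj : {in setX (ker a) (ker a.+1) &, injective (fun z : F * F => z.1 * z.2)}.
  case=> x y [x' y']; rewrite !in_setX /= => /andP[xA yB] /andP[xA' yB'] e.
  move: xA yB xA' yB'; rewrite !inE => /andP[x0 /eqP xa] /andP[y0 /eqP yb] /andP[x0' /eqP xa'] /andP[y0' /eqP yb'].
  have e' : x / x' = y' / y.
    by apply/eqP; rewrite eqr_div // e mulrC.
  have : x / x' \in ker a :&: ker a.+1.
    have h1 : (x / x') ^+ a = 1 by rewrite exprMn exprVn xa xa' invr1 mulr1.
    have h2 : (x / x') ^+ a.+1 = 1 by rewrite e' exprMn exprVn yb yb' invr1 mulr1.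
    by rewrite !inE h1 h2 !eqxx mulf_neq0 ?invr_eq0.
  rewrite ker_succI inE => /eqP h; have xx : x = x' by rewrite -(divfK x0' x) h mul1r.
  by move: e; rewrite xx => /(mulfI x0') ->.
rewrite -(card_in_imset inj); apply: subset_leq_card; apply/subsetP => z /imsetP[[x y]].
rewrite in_setX !inE /= => /andP[/andP[x0 _] /andP[y0 _]] ->; exact: mulf_neq0.
Qed.

Definition shift_map (g : F) : F := g ^+ a * (g - 1).
(** The elements that are not of the form g^a (g - 1) with g nonzero. *)
Definition missed : {set F} := [set x | ~~ [exists g : F, (g != 0) && (shift_map g == x)]].

(** For t outside both kernels, the equation g^a (g - 1) = (g t)^a (g t - 1) has exactly
    one solution g = (1 - t^a) / (1 - t^(a + 1)), so there are about n / 2 collisions.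
    Since the domain has one element less than the target, the number of missed
    elements is one more than the total excess of the fibres over 1; it is also at
    least the size of the largest fibre, whence collisions <= missed^2. *)
Lemma missed_sqr : ~~ (n %| a)%N -> ~~ (n %| a.+1)%N -> (n <= 2 * #|missed| ^ 2 + 2)%N.
Proof.
move=> na nb.
pose U := [set t : F | t != 0]; pose T := U :\: (ker a :|: ker a.+1).
have cT : (n <= 2 * #|T| + 2)%N.
  have sub : ker a :|: ker a.+1 \subset U.
    by apply/subsetP => x; rewrite !inE => /orP[] /andP[].
  have := cardsUI (ker a) (ker a.+1); rewrite ker_succI cards1 => e.
  have := cardsD U (ker a :|: ker a.+1); rewrite (setIidPr sub) card_nonzero -/T => ->.
  have := subset_leq_card sub; rewrite card_nonzero.
  have := ker_half na; have := ker_half nb; have := ker_succM.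
  have k1 b : (0 < #|ker b|)%N by apply/card_gt0P; exists 1; rewrite inE oner_neq0 expr1n eqxx.
  move: e (k1 a) (k1 a.+1); move: #|ker a| #|ker a.+1| #|_ :|: _| (n) => x y z N.
  clear; nia.
pose Nx (x : F) := #|[set g in U | shift_map g == x]|.
pose M := \max_(x : F) Nx x.
have sumN : (\sum_x Nx x = n)%N.
  rewrite -card_nonzero -sum1_card [RHS](partition_big shift_map xpredT) //=.
  by apply: eq_bigr => x _; rewrite /Nx -sum1_card; apply: eq_bigl => g; rewrite inE.
have missE x : (x \in missed) = (Nx x == 0)%N.
  rewrite inE cards_eq0; apply/idP/eqP => [h|h].
    apply/setP => g; rewrite !inE; apply/negbTE; move/existsPn/(_ g): h; exact.
  by apply/existsPn => g; have /setP/(_ g) := h; rewrite !inE => ->.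
have cmiss : (#|missed| = 1 + \sum_x (Nx x).-1)%N.
  have e : (\sum_x Nx x + #|missed| = \sum_x (1 + (Nx x).-1))%N.
    rewrite -sum1_card [X in (_ + X)%N]big_mkcond -big_split; apply: eq_bigr => x _ /=.
    by rewrite missE; case: (Nx x) => [|k] //=; rewrite addn0.
  move: e; rewrite big_split /= sum1_card sumN.
  have : (0 < #|F|)%N by apply/card_gt0P; exists 0.
  by rewrite [#|xpredT|](_ : _ = #|F|) //; clear; lia.
(* every t outside the two kernels yields a collision between g and g t *)
have pairs : (#|T| <= \sum_x Nx x * (Nx x).-1)%N.
  pose gt (t : F) : F := (1 - t ^+ a) / (1 - t ^+ a.+1).
  have tP t : t \in T -> [/\ t != 0, 1 - t ^+ a != 0 & 1 - t ^+ a.+1 != 0].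
    rewrite !inE => /andP[+ t0]; rewrite t0 /= negb_or => /andP[h1 h2].
    by rewrite !subr_eq0 ![1 == _]eq_sym.
  have gU t : t \in T -> gt t \in U.
    by move=> /tP[t0 h1 h2]; rewrite inE mulf_neq0 // invr_eq0.
  rewrite -sum1_card (partition_big gt (mem U)) //=.
  apply: (@leq_trans (\sum_(g in U) (Nx (shift_map g)).-1)%N).
    apply: leq_sum => g gu; have g0 : g != 0 by rewrite inE in gu.
    rewrite /Nx (cardD1 g) inE gu eqxx /=  sum1dep_card -(card_imset _ (mulfI g0)).
    apply: subset_leq_card; apply/subsetP => _ /imsetP[t tT ->].
    move: tT; rewrite inE => /andP[tT /eqP gE]; have [t0 h1 h2] := tP _ tT.
    rewrite !inE mulf_neq0 //= andbC; apply/andP; split; last first.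
      rewrite -[X in _ != X]mulr1 (inj_eq (mulfI g0)); apply: contra_neq h1 => ->.
      by rewrite expr1n subrr.
    have e : g * (1 - t ^+ a.+1) = 1 - t ^+ a by rewrite -gE divfK.
    rewrite /shift_map exprMn -mulrA; apply/eqP; congr (_ * _).
    move: e; rewrite exprS => e.
    have : g - 1 = g * t * t ^+ a - t ^+ a.
      by apply: (addrI (- (g * (1 - t * t ^+ a)) )); rewrite {2}e; ring.
    by move=> ->; ring.
  rewrite (partition_big shift_map xpredT) //=; apply: leq_sum => x _.
  rewrite (eq_bigr (fun _ => (Nx x).-1)) => [|g /andP[_ /eqP -> //]].
  rewrite sum_nat_const leq_mul2r; apply/orP; right; apply/subset_leq_card/subsetP => g; rewrite !inE.
  by move=> h; move: h; rewrite unfold_in inE.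
have MB : (M <= #|missed|)%N.
  rewrite cmiss; apply/bigmax_leqP => x _; rewrite (bigD1 x) //=.
  by clear; lia.
have : (#|T| <= #|missed| * #|missed|)%N.
  apply: (leq_trans pairs); apply: (@leq_trans (\sum_x M * (Nx x).-1)%N).
    by apply: leq_sum => x _; rewrite leq_mul2r; apply/orP; right; exact: leq_bigmax.
  rewrite -big_distrr /=; apply: leq_mul => //; by rewrite cmiss leq_addl.
move: cT; rewrite -mulnn; move: #|T| #|missed| (n) => x y z; clear; lia.
Qed.

End ImageGap.

(** * Totients not divisible by 4 *)
Local Close Scope ring_scope.

Lemma totient_primepart p n : prime p -> (0 < n)%N -> (p %| n)%N ->
  exists k u, [/\ n = (p ^ k.+1 * u)%N, coprime p u, (0 < u)%N & totient n = (p.-1 * p ^ k * totient u)%N].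
Proof.
move=> pp n0 pn; have k0 : (0 < logn p n)%N by rewrite logn_gt0 mem_primes pp n0.
have [u cop e] := pfactor_coprime pp n0.
exists (logn p n).-1, u; rewrite prednK //.
have u0 : (0 < u)%N by move: n0; rewrite e muln_gt0 => /andP[].
split=> //; first by rewrite mulnC.
rewrite {1}e mulnC totient_coprime ?coprimeXl //.
by rewrite totient_pfactor // .
Qed.

Lemma pow2_of_primes n : (0 < n)%N -> {in primes n, forall p, p == 2} -> n = (2 ^ logn 2 n)%N.
Proof.
move=> n0 h; apply: eqn_from_log; rewrite ?expn_gt0 // => p; rewrite lognX.
rewrite (@logn_prime p 2) //; have [->|p2] := eqVneq p 2; first by rewrite muln1.
by rewrite muln0; apply/eqP; rewrite eqn0Ngt logn_gt0; apply: contra p2 => /h.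
Qed.

(** An odd prime factor r contributes the even factor r - 1; a power of 2 is
    immediate. *)
Lemma even_totient n : (2 < n)%N -> ~~ odd (totient n).
Proof.
move=> n2; have n0 : (0 < n)%N by apply: leq_trans n2.
have [/allP h|/allPn[p pn p2]] := boolP (all (fun p => p == 2) (primes n)).
  have e := pow2_of_primes n0 h.
  move: n2; rewrite e; case: (logn 2 n) => [|[|k]] // _.
  by rewrite totient_pfactor //= mul1n oddX.
move: pn; rewrite mem_primes => /and3P[pp _ pd].
have [k [u [_ _ _ ->]]] := totient_primepart pp n0 pd.
have : odd p by case: (even_prime pp) => // e; rewrite e in p2.
have := prime_gt0 pp; case: p {pp pd p2} => // p _ /= op.
by rewrite !oddM (negPf op).
Qed.

(** If p is an odd prime factor of n, with cofactor u, then p - 1 is even, so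
    totient u is odd and u <= 2. *)
Lemma totient_not4 n : (0 < n)%N -> ~~ (4 %| totient n)%N ->
  exists p a, prime p /\ totient n = (p ^ a * p.-1)%N.
Proof.
move=> n0 n4.
have [/allP h|/allPn[p pn p2]] := boolP (all (fun p => p == 2) (primes n)).
  have e := pow2_of_primes n0 h.
  exists 2, (logn 2 n).-1; split=> //; rewrite {1}e.
  by case: (logn 2 n) => [|k] //; rewrite totient_pfactor // mulnC.
move: pn; rewrite mem_primes => /and3P[pp _ pd].
have [k [u [_ cop u0 e]]] := totient_primepart pp n0 pd.
exists p, k; split=> //; rewrite e mulnC.
have op : odd p by case: (even_prime pp) => // e'; rewrite e' in p2.
have ep : (2 %| p.-1)%N.
  by have := prime_gt0 pp; rewrite dvdn2; case: p op {pp pd p2 cop e} => // p /= ->.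
have [u2|u2] := ltnP 2 u.
  case/negP: n4; rewrite e -[4]/(2 * 2)%N; apply: dvdn_mul; last by rewrite dvdn2 even_totient.
  exact: dvdn_mulr.
have -> : totient u = 1%N by case: u u0 u2 {cop e} => [|[|[|]]].
by rewrite mul1n mulnC.
Qed.

(** * Counting in windows by residues *)

(** By the Chinese remainder theorem, residues modulo the product inject into
    families of residues. *)
Lemma crt_count (A : nat -> pred nat) (ps : seq nat) : uniq ps -> all prime ps ->
  (count (fun r => all (fun p => A p (r %% p)) ps) (iota 0 (\prod_(p <- ps) p))
    <= \prod_(p <- ps) count (A p) (iota 0 p))%N.
Proof.
elim: ps => [|p ps IH]; first by rewrite !big_nil.
move=> /= /andP[pps ups] /andP[pp pps'].
rewrite !big_cons; set P := (\prod_(j <- ps) j)%N; set N := iota 0 (p * P).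
have cop : coprime p P.
  rewrite /P big_seq; apply: (big_ind (coprime p)); rewrite ?coprimen1 //.
    by move=> x y hx hy; rewrite coprimeMr hx.
  move=> q qps; have pq := allP pps' q qps; rewrite prime_coprime // dvdn_prime2 //.
  by apply: contraNneq pps => e; move: qps; rewrite e.
apply: (leq_trans _ (leq_mul (leqnn _) (IH ups pps'))).
pose B := [seq r <- iota 0 P | all (fun p => A p (r %% p)) ps].
pose C := [seq r <- iota 0 p | A p r].
rewrite -!size_filter -/B -/C -(size_allpairs pair) -(size_map (fun r => (r %% p, r %% P))).
have p0 := prime_gt0 pp.
have P0 : (0 < P)%N by rewrite /P big_seq; apply: prodn_cond_gt0 => q /(allP pps') /prime_gt0.
apply: uniq_leq_size.
  rewrite map_inj_in_uniq ?filter_uniq ?iota_uniq // => r r'.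
  rewrite !mem_filter !mem_iota !add0n => /andP[_ /andP[_ h]] /andP[_ /andP[_ h']] [e1 e2].
  have := chinese_remainder cop r r'; rewrite e1 e2 !eqxx.
  by rewrite !modn_small // => /eqP.
move=> z /mapP[r]; rewrite mem_filter mem_iota add0n => /andP[/andP[h1 h2] /andP[_ h3]] ->.
apply/allpairsP; exists (r %% p, r %% P); split=> //=; rewrite mem_filter mem_iota add0n ltn_mod.
  by rewrite h1.
rewrite P0 !andbT; apply/allP => q qps; rewrite modn_dvdm; first exact: (allP h2 q qps).
by rewrite /P (big_rem q) //= dvdn_mulr.
Qed.

Lemma window_count (P : nat) (Pr : pred nat) (s : seq nat) (x H : nat) : (0 < P)%N ->
  uniq s -> all (fun m => x < m <= x + H)%N s -> all (fun m => Pr (m %% P)) s ->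
  (size s <= (H %/ P).+1 * count Pr (iota 0 P))%N.
Proof.
move=> P0 us /allP sx /allP sP.
rewrite -size_filter -[(H %/ P).+1](size_iota 0) -(size_allpairs pair).
rewrite -(size_map (fun m => ((m - x.+1) %/ P, m %% P))).
apply: uniq_leq_size.
  rewrite map_inj_in_uniq // => m m' /sx /andP[h1 _] /sx /andP[h2 _] [e1 e2].
  have e3 : (m - x.+1 = m' - x.+1 %[mod P])%N.
    by apply/eqP; rewrite -(eqn_modDr x.+1) !subnK // e2.
  have : (m - x.+1 = m' - x.+1)%N.
    by rewrite (divn_eq (m - x.+1) P) (divn_eq (m' - x.+1) P) e1 e3.
  by move: h1 h2; clear; lia.
move=> z /mapP[m ms ->]; apply/allpairsP; exists ((m - x.+1) %/ P, m %% P); split=> //; rewrite ?[(_, _).1]/fst ?[(_, _).2]/snd.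
  rewrite mem_iota add0n ltnS leq_div2r //.
  by have /andP[] := sx _ ms; clear; lia.
by rewrite mem_filter (sP _ ms) mem_iota add0n ltn_mod.
Qed.

(** Consecutive values of p^a (p - 1) differ at least by a factor 2, more than a
    window of length H <= x allows. *)
Lemma prime_power_window (p x H : nat) (s : seq nat) : prime p -> (H <= x)%N -> uniq s ->
  all (fun m => x < m <= x + H)%N s -> (forall m, m \in s -> exists a, m = (p ^ a * p.-1)%N) ->
  (size s <= 1)%N.
Proof.
move=> pp Hx us /allP sx h.
have key m m' : m \in s -> m' \in s -> m = m'.
  move=> ms ms'; have [a e] := h _ ms; have [b e'] := h _ ms'.
  have /andP[x1 x2] := sx _ ms; have /andP[y1 y2] := sx _ ms'.
  have p2 := prime_gt1 pp.
  wlog lt : m m' ms ms' a b e e' x1 x2 y1 y2 / (a < b)%N.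
    move=> W; case: (ltngtP a b) => [lt|lt|ab]; last by rewrite e e' ab.
      exact: (W m m' ms ms' a b).
    by symmetry; exact: (W m' m ms' ms b a).
  have : (2 * m <= m')%N.
    rewrite e e' mulnA leq_mul2r; apply/orP; right.
    apply: (@leq_trans (p ^ a.+1)); first by rewrite expnS leq_mul2r p2 orbT.
    by rewrite leq_exp2l.
  by move: x1 y2 Hx; clear; lia.
case: s us key {sx h} => [|m [|m' s]] //= /andP[+ _] key.
by rewrite (key m m') ?inE ?eqxx ?orbT //= .
Qed.

(** * Local conditions on the numbers p^a (p - 1) *)

(** Membership of the residue class of r in the image of g -> g^a (g - 1). *)
Definition in_image (q a : nat) (r : nat) : bool :=
  [exists g : 'F_q, (g != 0)%R && (shift_map a g == r%:R)%R].


Lemma image_count q a m : prime q -> (4 < q)%N -> ~~ (q.-1 %| a)%N -> ~~ (q.-1 %| a.+1)%N ->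
  (16 * q <= m ^ 2)%N -> (m * count (in_image q a) (iota 0 q) + q <= m * q)%N.
Proof.
move=> pq q4 na nb hm.
have h := @missed_sqr 'F_q a; rewrite card_Fp // in h; have {}h := h na nb.
have e : (count (in_image q a) (iota 0 q) + #|missed 'F_q a| = q)%N.
  have -> : #|missed 'F_q a| = count (predC (in_image q a)) (iota 0 q).
    rewrite -[X in iota 0 X](Fp_cast pq) -val_enum_ord count_map cardE /enum_mem size_filter.
    rewrite (eq_filter (a2 := predT)) // filter_predT; apply: eq_count => x /=.
    by rewrite inE /in_image natr_Zp.
  by rewrite count_predC size_iota.
set c := count _ _ in e *; set u := #|_| in e h.
suff : (q <= m * u)%N by move=> h1; rewrite (_ : m * q = m * c + m * u) ?leq_add2l // -mulnDr e.
rewrite -leq_sqr.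
rewrite expnMn; apply: (@leq_trans (16 * q * u ^ 2)); last by rewrite leq_mul2r hm orbT.
move: h q4; rewrite -[(q ^ 2)%N]mulnn; move: (u ^ 2)%N => w; clear; nia.
Qed.

Lemma in_image_mod q a L r : prime q -> (q.-1 %| L)%N -> in_image q (a %% L) r = in_image q a r.
Proof.
move=> pq /dvdnP[d ->]; rewrite /in_image; apply: eq_existsb => g.
have [->|g0] // := eqVneq g 0%R.
congr (_ && (_ == _)); rewrite /shift_map; congr (_ * _)%R.
rewrite [in RHS](divn_eq a (d * q.-1)) exprD mulnA (mulnC (_ * d) q.-1) exprM.
have := expf_pred_card g0; rewrite card_Fp // => h.
by rewrite h expr1n mul1r.
Qed.

Lemma expn_mod1 p a q : prime p -> prime q -> p != q -> (q.-1 %| a)%N -> (p ^ a = 1 %[mod q])%N.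
Proof.
move=> pp pq npq /dvdnP[d ->]; have cop : coprime p q.
  by rewrite prime_coprime // dvdn_prime2.
rewrite mulnC expnM -modnXm; have := Euler_exp_totient cop.
by rewrite totient_prime // => ->; rewrite modnXm exp1n.
Qed.

(** Here p^a = 1 modulo q, so the number is p - 1, and p is not 0 modulo q. *)
Lemma avoid_pred p a q : prime p -> prime q -> p != q -> (q.-1 %| a)%N ->
  (p ^ a * p.-1) %% q != q.-1.
Proof.
move=> pp pq npq qa; apply/eqP => h.
have h1 : (p ^ a * p.-1 + 1 = 0 %[mod q])%N.
  by rewrite -modnDml h addn1 prednK ?prime_gt0 // modnn mod0n.
move: h1; rewrite -modnDml -modnMml (expn_mod1 pp pq npq qa) modnMml mul1n modnDml addn1 prednK ?prime_gt0 //.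
rewrite mod0n => /eqP; rewrite -/(dvdn _ _) dvdn_prime2 // eq_sym => /eqP e.
by rewrite e eqxx in npq.
Qed.

(** Here p^(a + 1) = 1 modulo q, so the number is 1 - p^a, and p^a is not 0. *)
Lemma avoid_one p a q : prime p -> prime q -> p != q -> (q.-1 %| a.+1)%N ->
  (p ^ a * p.-1) %% q != 1.
Proof.
move=> pp pq npq qa; apply/eqP => h.
have e : (p ^ a * p.-1 + p ^ a = p ^ a.+1)%N.
  by rewrite -{2}[(p ^ a)%N]muln1 -mulnDr addn1 prednK ?prime_gt0 // expnSr.
have : (1 + p ^ a = 1 + 0 %[mod q])%N.
  by rewrite -{1}h modnDml e (expn_mod1 pp pq npq qa).
move=> /eqP; rewrite eqn_modDl mod0n => h0.
have : (q %| p ^ a)%N by rewrite /dvdn.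
rewrite Euclid_dvdX // => /andP[]; rewrite dvdn_prime2 // => /eqP e' _.
by rewrite e' eqxx in npq.
Qed.

Lemma half_power (R : realFieldType) m : (0 < m)%N -> ((1 - m%:R^-1) ^+ m <= 2^-1 :> R)%R.
Proof.
move=> m0; have m0R : (0 < m%:R :> R)%R by rewrite ltr0n.
have key : (2 * m.-1 ^ m <= m ^ m)%N.
  case: m m0 {m0R} => // m _ /=.
  have h k : (m ^ k + k * m ^ k.-1 <= (m + 1) ^ k)%N.
    elim: k => [|k IH]; first by rewrite mul0n.
    rewrite [in leqRHS]expnS mulnDl mul1n; apply: (@leq_trans (m * (m ^ k + k * m ^ k.-1) + m ^ k)).
      rewrite expnS mulnDr; case: (k) => [|j] /=; first by rewrite !mul1n muln1 mul0n muln0 addn0.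
      by rewrite !expnS leq_eqVlt; apply/orP; left; apply/eqP; move: (m ^ j)%N => x; clear; ring.
    apply: leq_add; first by rewrite leq_mul2l IH orbT.
    by apply: leq_trans IH; rewrite leq_addr.
  rewrite -[X in (_ <= X ^ _)%N]addn1; apply: leq_trans (h m.+1); rewrite mul2n -addnn leq_add2l expnS leq_mul2r leqnSn orbT //.
have -> : (1 - m%:R^-1 = m.-1%:R / m%:R :> R)%R.
  by rewrite -[in RHS]subn1 natrB // mulrBl divff ?gt_eqF // mul1r.
rewrite exprMn exprVn ler_pdivrMr ?exprn_gt0 // mulrC ler_pdivlMr // mulrC.
by rewrite -!natrX -natrM ler_nat.
Qed.

(** * The numbers p^a (p - 1) are sparse in every window *)

Lemma prodr_nat_div (R : realFieldType) (ps : seq nat) (c : nat -> nat) :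
  ((\prod_(p <- ps) c p)%N%:R / (\prod_(p <- ps) p)%N%:R = \prod_(p <- ps) ((c p)%:R / p%:R) :> R)%R.
Proof. by rewrite big_split /= prodfV -!natr_prod. Qed.

Lemma divn_mul_le (R : realFieldType) (H P c : nat) : (0 < P)%N ->
  (((H %/ P).+1 * c)%N%:R <= H%:R * (c%:R / P%:R) + c%:R :> R)%R.
Proof.
move=> P0; rewrite mulSn natrD addrC lerD2r mulrA ler_pdivlMr ?ltr0n //.
by rewrite -!natrM ler_nat mulnAC leq_mul2r leq_trunc_div orbT.
Qed.

Lemma residue_window (A : nat -> pred nat) (ps s : seq nat) (x H : nat) : uniq ps -> all prime ps ->
  uniq s -> all (fun m => x < m <= x + H)%N s -> all (fun m => all (fun q => A q (m %% q)) ps) s ->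
  (size s <= (H %/ \prod_(q <- ps) q).+1 * \prod_(q <- ps) count (A q) (iota 0 q))%N.
Proof.
move=> ups aps us sx sA; set P := \prod_(q <- ps) q.
have P0 : (0 < P)%N by rewrite /P big_seq prodn_cond_gt0 // => q /(allP aps)/prime_gt0.
apply: leq_trans (leq_mul (leqnn _) (crt_count A ups aps)).
apply: (@window_count P (fun r => all (fun q => A q (r %% q)) ps)) us sx _ => //.
apply/allP => m /(allP sA) h; apply/allP => q qps.
by rewrite modn_dvdm ?(allP h q qps) // /P (big_rem q) //= dvdn_mulr.
Qed.

Lemma count_neq c q : (c < q)%N -> count (fun r => r != c) (iota 0 q) = q.-1.
Proof.
move=> cq; have := count_predC (pred1 c) (iota 0 q).
rewrite size_iota count_uniq_mem ?iota_uniq // mem_iota add0n cq /= => e.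
by rewrite -{2}e.
Qed.

Lemma count_has_le (T : Type) (E : seq nat) (f : nat -> pred T) s :
  (count (fun r => has (f^~ r) E) s <= \sum_(p <- E) count (f p) s)%N.
Proof.
elim: E => [|p E IH]; first by rewrite big_nil /= count_pred0.
rewrite big_cons /=; apply: (@leq_trans (count (f p) s + count (fun r => has (f^~ r) E) s)).
  by rewrite -count_predUI; apply: leq_addr.
by rewrite leq_add2l.
Qed.

Section Sparse.
Variables (R : realFieldType) (lg : nat -> R).
Hypothesis lgM : forall a b, (0 < a)%N -> (0 < b)%N -> (lg (a * b) = lg a + lg b)%R.
Hypothesis lg2 : (lg 2 = 1)%R.
Hypothesis lg_le : forall a b, (0 < a <= b)%N -> (lg a <= lg b)%R.

(** The window is covered by the numbers attached to the finitely many primes p in S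
    or below 2^b, the numbers avoiding -1 modulo all primes up to 2^b, those
    avoiding 1, and for each class of a modulo L the numbers whose residue modulo
    every q in S is in the corresponding image.  With b = 8 N and e = N + 1 the
    densities of the last three kinds add up to at most 1 / N. *)
Theorem prime_power_totients_sparse N : (0 < N)%N -> exists C, forall (x H : nat) (s : seq nat),
  (H <= x)%N -> uniq s -> all (fun m => x < m <= x + H)%N s ->
  (forall m, m \in s -> exists p a, prime p /\ m = (p ^ a * p.-1)%N) ->
  (N * size s <= H + C)%N.
Proof.
(* W is a multiple of q - 1 for every prime q up to 2^b *)
move=> N0; pose b := (8 * N)%N; pose ps := primes_upto (2 ^ b); pose W := ((2 ^ b)`!)%N.
have W0 : (0 < W)%N by rewrite fact_gt0.
have [S [L [m [k [uS /andP[L0 m0] SP Lk kS]]]]] :=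
  many_smooth_shifted_primes lgM lg2 lg_le N.+1 (2 ^ b + 5) W0.
have psP p : p \in ps -> prime p by rewrite mem_primes_upto => /andP[].
have ups : uniq ps := primes_upto_uniq _.
have aps : all prime ps by apply/allP.
have aS : all prime S by apply/allP => q /SP[].
pose P1 := (\prod_(p <- ps) p)%N; pose P2 := (\prod_(q <- S) q)%N.
have P10 : (0 < P1)%N by rewrite /P1 big_seq prodn_cond_gt0 // => q /psP/prime_gt0.
have P20 : (0 < P2)%N by rewrite /P2 big_seq prodn_cond_gt0 // => q /SP[/prime_gt0].
pose c1 := (\prod_(p <- ps) p.-1)%N.
exists (N * (size (ps ++ S) + (c1 + c1) + L * P2))%N => x H s Hx us sx sP.
pose isv p r := has (fun a => r == p ^ a * p.-1)%N (iota 0 r.+1).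
pose sE := [seq r <- s | has (isv^~ r) (ps ++ S)].
pose s1 := [seq r <- s | all (fun q => r %% q != q.-1)%N ps].
pose s2 := [seq r <- s | all (fun q => r %% q != 1)%N ps].
pose s3 a := [seq r <- s | all (fun q => in_image q a (r %% q)) S && 
   all (fun q => ~~ (q.-1 %| a) && ~~ (q.-1 %| a.+1))%N S].
have cover : (size s <= size sE + (size s1 + size s2) + \sum_(a <- iota 0 L) size (s3 a))%N.
  have <- : size (flatten [seq s3 a | a <- iota 0 L]) = (\sum_(a <- iota 0 L) size (s3 a))%N.
    by rewrite size_flatten /shape -map_comp sumnE big_map.
  rewrite -!size_cat; apply: uniq_leq_size => // r rs.
  have [p [a [pp re]]] := sP r rs; rewrite !mem_cat !mem_filter rs !andbT.
  have p1 := prime_gt1 pp.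
  have isvP : isv p r.
    apply/hasP; exists a; last by rewrite re.
    rewrite mem_iota add0n ltnS re; apply: (@leq_trans (p ^ a)); first exact/ltnW/ltn_expl.
    by rewrite leq_pmulr //; move: p1; clear; lia.
  have [pE|pE] := boolP (p \in ps ++ S).
    by rewrite (_ : has _ _) //; apply/hasP; exists p.
  have npq q : q \in ps ++ S -> p != q by move=> h; apply: contraNneq pE => ->.
  have Wq q : q \in ps -> (q.-1 %| W)%N.
    move=> qps; apply: dvdn_fact; have := prime_gt1 (psP q qps).
    by move: qps; rewrite mem_primes_upto => /andP[_]; clear; lia.
  have [/hasP[q qS qa]|h1] := boolP (has (fun q => q.-1 %| a)%N S).
    rewrite [X in _ || (X || _) || _](_ : _ = true) ?orbT //.
    apply/allP => q' qps; rewrite re; apply: avoid_pred => //; first exact: psP.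
      by apply: npq; rewrite mem_cat qps.
    by have [_ Wd _ _ _] := SP q qS; apply: dvdn_trans (Wq _ qps) (dvdn_trans Wd qa).
  have [/hasP[q qS qa]|h2] := boolP (has (fun q => q.-1 %| a.+1)%N S).
    rewrite [X in _ || (_ || X) || _](_ : _ = true) ?orbT //.
    apply/allP => q' qps; rewrite re; apply: avoid_one => //; first exact: psP.
      by apply: npq; rewrite mem_cat qps.
    by have [_ Wd _ _ _] := SP q qS; apply: dvdn_trans (Wq _ qps) (dvdn_trans Wd qa).
  apply/orP; right; apply/flatten_mapP; exists (a %% L); first by rewrite mem_iota add0n ltn_mod.
  rewrite mem_filter rs andbT; apply/andP; split; apply/allP => q qS.
    have [pq _ qL _ _] := SP q qS; rewrite in_image_mod //; apply/existsP; exists (p%:R)%R.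
    have pF : (p%:R != 0 :> 'F_q)%R.
      rewrite -(dvdn_pcharf (pchar_Fp pq)) dvdn_prime2 // eq_sym; apply: npq; by rewrite mem_cat qS orbT.
    rewrite pF /=; apply/eqP; rewrite /shift_map.
    have -> : ((r %% q)%:R = r%:R :> 'F_q)%R.
      by apply: val_inj; rewrite /= !val_Fp_nat // modn_mod.
    by rewrite re natrM natrX -subn1 natrB // ltnW.
  have [pq _ qL _ _] := SP q qS.
  have md c : (q.-1 %| a %% L + c)%N = (q.-1 %| a + c)%N.
    rewrite /dvdn -modnDml modn_dvdm //  modnDml //.
  have := md 0; rewrite !addn0 => ->; have := md 1; rewrite !addn1 => ->.
  by rewrite (hasPn h1) // (hasPn h2).
have usf (f : pred nat) : uniq (filter f s) by apply: filter_uniq.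
have sxf (f : pred nat) : all (fun m => x < m <= x + H)%N (filter f s).
  by apply/allP => r; rewrite mem_filter => /andP[_ /(allP sx)].
have EB : (size sE <= size (ps ++ S))%N.
  rewrite size_filter; apply: (leq_trans (count_has_le _ _ _)).
  rewrite -sum1_size big_seq [leqRHS]big_seq; apply: leq_sum => p pE.
  have pp : prime p by move: pE; rewrite mem_cat => /orP[/psP|/SP[]].
  rewrite -size_filter; apply: (prime_power_window pp Hx (usf _) (sxf _)) => r.
  by rewrite mem_filter => /andP[/hasP[a _ /eqP ->] _]; exists a.
have S1B : (size s1 <= (H %/ P1).+1 * c1)%N.
  have h := @residue_window (fun q r => r != q.-1) ps s1 x H ups aps (usf _) (sxf _) (filter_all _ _).
  apply: (leq_trans h); rewrite leq_mul2l; apply/orP; right.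
  rewrite big_seq /c1 [leqRHS]big_seq; apply: leq_prod => q /psP /prime_gt0 q0.
  by rewrite count_neq // ltn_predL.
have S2B : (size s2 <= (H %/ P1).+1 * c1)%N.
  have h := @residue_window (fun q r => r != 1) ps s2 x H ups aps (usf _) (sxf _) (filter_all _ _).
  apply: (leq_trans h); rewrite leq_mul2l; apply/orP; right.
  rewrite big_seq /c1 [leqRHS]big_seq; apply: leq_prod => q /psP /prime_gt1 q0.
  by rewrite count_neq.
rewrite -(ler_nat R).
have P1R : ((c1%:R / P1%:R) * (8 * N%:R) <= 2 :> R)%R.
  have h : (c1%:R / P1%:R <= 2 / b%:R :> R)%R.
    have := @prod_1minus_coprime_le R 1 b isT; rewrite /b muln_gt0 N0 => /(_ isT); rewrite -/b muln1.
    apply: le_trans; rewrite prodr_nat_div big_seq [leRHS]big_seq_cond.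
    rewrite le_eqVlt; apply/orP; left; apply/eqP; apply: congr_big => // [q|q qps].
      have [qps|] := boolP (q \in ps) => //=.
      by rewrite dvdn1 neq_ltn (prime_gt1 (psP q qps)) orbT.
    have q0 := prime_gt0 (psP q qps).
    rewrite -[in LHS]subn1 natrB // mulrBl divff ?mul1r // gt_eqF // ltr0n //.
  move: h; rewrite ler_pdivlMr ?ltr0n ?muln_gt0 ?N0 //.
  by rewrite /b natrM.
pose mu : R := (1 - m%:R^-1)%R.
have mu01 : (0 <= mu <= 1)%R.
  by rewrite /mu subr_ge0 invf_le1 ?ltr0n // ler1n m0 /= lerBlDr lerDl invr_ge0 ler0n.
have S3B a : ((size (s3 a))%:R <= H%:R * mu ^+ size S + P2%:R :> R)%R.
  have [nd|nd] := boolP (all (fun q => ~~ (q.-1 %| a) && ~~ (q.-1 %| a.+1))%N S); last first.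
    rewrite (_ : s3 a = [::]) /= ?addr_ge0 ?mulr_ge0 ?exprn_ge0 ?ler0n //; first by case/andP: mu01.
    by rewrite /s3 (eq_filter (a2 := pred0)) ?filter_pred0 // => r; rewrite (negPf nd) andbF.
  have sA : all (fun r => all (fun q => in_image q a (r %% q)) S) (s3 a).
    by apply/allP => r; rewrite mem_filter => /andP[/andP[]].
  have h := @residue_window (fun q => in_image q a) S (s3 a) x H uS aS (usf _) (sxf _) sA.
  set c3 := \prod_(q <- S) count _ _ in h; rewrite -/P2 in h.
  have cq q : q \in S -> ((count (in_image q a) (iota 0 q))%:R / q%:R <= mu :> R)%R.
    move=> qS; have [pq _ _ qb q16] := SP q qS; have /andP[n1 n2] := allP nd q qS.
    have q5 : (4 < q)%N by exact: leq_trans (leq_addl (2 ^ b) 5) (ltnW qb).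
    have := image_count pq q5 n1 n2 q16; rewrite -(ler_nat R) natrD !natrM => hh.
    have qR : (0 < q%:R :> R)%R by rewrite ltr0n (leq_trans _ q5).
    have mR : (0 < m%:R :> R)%R by rewrite ltr0n.
    rewrite ler_pdivrMr // -(ler_pM2l mR) /mu mulrA mulrBr mulr1 divff ?gt_eqF //.
    by rewrite mulrBl mul1r lerBrDr.
  have c3P : (c3%:R / P2%:R <= mu ^+ size S :> R)%R.
    rewrite (_ : mu ^+ size S = \prod_(q <- S) mu)%R; last first.
      by rewrite big_const_seq count_predT iter_mulr_1.
    rewrite prodr_nat_div big_seq [leRHS]big_seq; apply: ler_prod => q qS.
    by rewrite cq // divr_ge0 ?ler0n.
  have c3P2 : (c3%:R <= P2%:R :> R)%R.
    have mu1 : (mu ^+ size S <= 1)%R by case/andP: mu01 => ? ?; exact: exprn_ile1.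
    have := le_trans c3P mu1.
    by rewrite ler_pdivrMr ?ltr0n // mul1r.
  apply: (le_trans (_ : _ <= ((H %/ P2).+1 * c3)%N%:R)%R); first by rewrite ler_nat.
  apply: (le_trans (divn_mul_le _ _ _ P20)); apply: lerD => //.
  by apply: ler_wpM2l.
have mu0 : (0 <= mu)%R by case/andP: mu01.
have muS : (L%:R * mu ^+ size S * 2 ^+ N.+1 <= 1 :> R)%R.
  have h1 : (mu ^+ size S <= 2^-1 ^+ k :> R)%R.
    apply: (@le_trans _ _ (mu ^+ (m * k)%N)%R).
      by rewrite mulnC; apply: ler_wiXn2l => //; case/andP: mu01.
    rewrite exprM; apply: lerXn2r; rewrite ?nnegrE ?exprn_ge0 ?invr_ge0 ?ler0n //.
    exact: half_power.
  rewrite mulrAC -[2%R]/(2%:R)%R -natrX -natrM.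
  apply: (@le_trans _ _ ((2 ^ k)%N%:R * 2^-1 ^+ k)%R).
    by apply: ler_pM; rewrite ?ler0n ?exprn_ge0 // ler_nat.
  by rewrite natrX exprVn divff ?expf_neq0 ?pnatr_eq0.
have S3sum : ((\sum_(a <- iota 0 L) size (s3 a))%N%:R <= L%:R * (H%:R * mu ^+ size S + P2%:R) :> R)%R.
  rewrite natr_sum; apply: (le_trans (ler_sum _ (fun a _ => S3B a))).
  by rewrite big_const_seq count_predT size_iota iter_addr_0 -[leLHS]mulr_natl.
have D1 := divn_mul_le R H c1 P10.
have S1R : ((size s1)%:R <= H%:R * (c1%:R / P1%:R) + c1%:R :> R)%R by apply: le_trans D1; rewrite ler_nat.
have S2R : ((size s2)%:R <= H%:R * (c1%:R / P1%:R) + c1%:R :> R)%R by apply: le_trans D1; rewrite ler_nat.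
move: cover EB; rewrite -!(ler_nat R) !natrD => cover EB.
have NR : (N%:R <= 2 ^+ N :> R)%R by rewrite -natrX ler_nat; exact/ltnW/ltn_expl.
have HR : (0 <= H%:R :> R)%R := ler0n _ _.
have N0R : (0 <= N%:R :> R)%R := ler0n _ _.
have bound : ((size s)%:R <= (size (ps ++ S))%:R + (2 * (H%:R * (c1%:R / P1%:R)) + (c1%:R + c1%:R))
    + (H%:R * (L%:R * mu ^+ size S) + L%:R * P2%:R) :> R)%R.
  apply: (le_trans cover).
  have e : (L%:R * (H%:R * mu ^+ size S + P2%:R) = H%:R * (L%:R * mu ^+ size S) + L%:R * P2%:R :> R)%R.
    by rewrite mulrDr mulrCA.
  rewrite e in S3sum.
  move: S1R S2R EB S3sum; lra.
have T1 : (N%:R * (2 * (H%:R * (c1%:R / P1%:R))) <= H%:R * 2^-1 :> R)%R.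
  rewrite (_ : _ * _ = H%:R * (c1%:R / P1%:R * (8 * N%:R) * 4^-1))%R; last by move: (c1%:R / P1%:R)%R => z; field.
  apply: ler_wpM2l => //; move: P1R; lra.
have T2 : (N%:R * (H%:R * (L%:R * mu ^+ size S)) <= H%:R * 2^-1 :> R)%R.
  rewrite mulrCA; apply: ler_wpM2l => //.
  have : (0 <= L%:R * mu ^+ size S :> R)%R by rewrite mulr_ge0 ?ler0n ?exprn_ge0.
  move: muS NR; rewrite exprS; move: (L%:R * _)%R (2 ^+ N)%R => X Y h1 h2 X0.
  have := ler_wpM2r X0 h2; have e : (X * (2 * Y) = 2 * (Y * X))%R by ring.
  by rewrite e in h1; lra.
rewrite natrM; apply: (le_trans (ler_wpM2l N0R bound)).
rewrite !natrM !natrD !mulrDr natrM.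
lra.
Qed.

End Sparse.

(** * Multipliers for the linear forms *)

(** Dickson's conjecture for linear forms with natural coefficients, with the
    absence of a fixed prime divisor spelled out at natural arguments. *)
Definition nat_dickson := forall (s : nat) (A B : 'I_s -> nat), (0 < s)%N -> (forall i, 0 < A i)%N ->
  (forall p, prime p -> exists t, forall i, ~~ (p %| A i * t + B i)%N) ->
  forall T, exists2 t, (T < t)%N & forall i, prime (A i * t + B i).

Section Dickson.
Hypothesis dick : nat_dickson.

(** Dirichlet's theorem is the case of a single form. *)
Lemma dickson_dirichlet A B T : (0 < A)%N -> coprime A B ->
  exists r, [/\ prime r, (T < r)%N & (r = B %[mod A])%N].
Proof.
move=> A0 cop.
have [//|p pp|t tT h] := @dick 1 (fun=> A) (fun=> B) isT _ _ T.
- have [pB|pB] := boolP (p %| B)%N; last by exists 0%N => _; rewrite muln0.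
  exists 1%N => _; rewrite muln1 dvdn_addl //; apply/negP => pA.
  have : (p %| gcdn A B)%N by rewrite dvdn_gcd pA.
  by rewrite (eqP cop) dvdn1 => /eqP e; rewrite e in pp.
exists (A * t + B)%N; split; first exact: h ord0.
  by apply: leq_trans (leq_addr _ _); apply: leq_trans tT _; rewrite leq_pmull.
by rewrite mulnC modnMDl.
Qed.

(** E is the part of 4 Q prime to D; the Chinese remainder theorem prescribes r
    modulo E and modulo D separately. *)
Lemma exists_twisted_prime D Q : odd D -> coprime D 3 -> (0 < Q)%N ->
  exists r, [/\ prime r, (4 %| r.+1)%N, (r = 3 %[mod D])%N &
    forall p, prime p -> (p %| Q)%N -> ~~ (p %| D)%N -> (p %| r.+1)%N].
Proof.
move=> oD D3 Q0; have D0 : (0 < D)%N by case: (D) oD.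
(* the factor 4 forces r = 3 modulo 4, so that (r - 1) / 2 is odd *)
pose E := ((4 * Q)`_(\pi(D)^'))%N.
have Q4 : (0 < 4 * Q)%N by rewrite muln_gt0.
have E0 : (0 < E)%N by apply: part_gt0.
have cED : coprime E D.
  rewrite coprime_sym /E; apply: (@pnat_coprime \pi(D)); last exact: part_pnat.
  exact: pnat_pi.
pose B := chinese E D E.-1 3.
have BE : (B = E.-1 %[mod E])%N by rewrite /B chinese_modl.
have BD : (B = 3 %[mod D])%N by rewrite /B chinese_modr.
have cop : coprime (E * D) B.
  rewrite coprimeMl -![coprime _ B]coprime_modr BE BD !coprime_modr D3 andbT.
  by have := coprimenS E.-1; rewrite prednK // coprime_sym.
have ED0 : (0 < E * D)%N by rewrite muln_gt0 E0.
have [r [pr _ rB]] := dickson_dirichlet 0 ED0 cop.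
have rE : (E %| r.+1)%N.
  have : (r = E.-1 %[mod E])%N.
    by rewrite -BE -(modn_dvdm r (dvdn_mulr D (dvdnn E))) rB modn_dvdm // dvdn_mulr.
  move=> h; rewrite /dvdn -addn1 -modnDml h modnDml addn1 prednK // modnn //.
have rD : (r = 3 %[mod D])%N.
  by rewrite -BD -(modn_dvdm r (dvdn_mull E (dvdnn D))) rB modn_dvdm // dvdn_mull.
have pE p k : prime p -> (p ^ k %| 4 * Q)%N -> ~~ (p %| D)%N -> (p ^ k %| E)%N.
  move=> pp pk pD; rewrite -(@part_pnat_id \pi(D)^' (p ^ k)).
    exact: partn_dvd.
  by rewrite pnatX; apply/orP; left; rewrite pnatE // inE /= mem_primes pp D0.
exists r; split=> //.
  apply: dvdn_trans rE; apply: (@pE 2 2) => //; first exact: dvdn_mulr.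
  by rewrite dvdn2 oD.
move=> p pp pQ pD; apply: dvdn_trans rE; apply: (@pE p 1) => //; exact: dvdn_mull.
Qed.

Local Open Scope ring_scope.

Lemma dvdz_lin (p x y z a b : int) : (p %| x)%Z -> (p %| y)%Z -> (z = a * x + b * y)%R -> (p %| z)%Z.
Proof. by move=> px py ->; rewrite rpredD // dvdz_mull. Qed.

Lemma prime_dvdz2 p k : prime p -> p != 2 -> (p%:Z %| 2%:Z ^+ k)%Z = false.
Proof.
move=> pp p2; apply/negP; rewrite dvdzE abszX /= => h.
by move: h; rewrite Euclid_dvdX // dvdn_prime2 // (negPf p2).
Qed.

Lemma prime_dvdz_double p x : prime p -> p != 2 -> (p%:Z %| 2 * x)%Z -> (p%:Z %| x)%Z.
Proof.
move=> pp p2; have cop : coprimez p%:Z 2.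
  by rewrite coprimezE /= prime_coprime // dvdn_prime2.
by rewrite Gauss_dvdzr.
Qed.

Lemma eqn_mod_dvdz p D r c : (p %| D)%N -> (r = c %[mod D])%N -> (p%:Z %| r%:Z - c%:Z)%Z.
Proof.
move=> pD h; rewrite -eqz_mod_dvd; apply/eqP; rewrite !modz_nat.
by rewrite -(modn_dvdm r pD) h modn_dvdm.
Qed.

(** The form attached to j has value 1 + 2 j / o modulo the primes p <= K, so p must
    divide neither o nor o + 2 j.  With c = r prime and r = -1 modulo p one has
    o = -1, and o + 2 j = 2 j - 1 vanishes only if p divides D = 2 j - 1; for these p
    one takes r = 3 instead, so that o = 1.  This fails for p = 3, that is, when
    j = 2 modulo 3; then c = r^2 is used, with o = r (r - 1) / 2 and D = 2 j + 1.  The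
    congruences modulo the primes p > K serve the compatibility with the
    multipliers already chosen. *)
Lemma choose_multiplier j K Q : (0 < j)%N -> (2 * j + 2 <= K)%N -> (0 < Q)%N -> exists c o,
  [/\ (0 < c)%N, totient c = (2 * o)%N, odd o &
   forall p, prime p -> (p %| Q)%N -> [/\ ~~ (p%:Z %| o%:Z)%Z, ~~ (p%:Z %| (o%:Z + 2 * j%:Z)%R)%Z
     & (K < p)%N -> ((p%:Z %| (o%:Z - 1)%R)%Z \/ (p%:Z %| (o%:Z + 1)%R)%Z)]].
Proof.
move=> j0 jK Q0.
have two p o : odd o -> p = 2 -> [/\ ~~ (p%:Z %| o%:Z)%Z, ~~ (p%:Z %| (o%:Z + 2 * j%:Z)%R)%Z
     & (K < p)%N -> ((p%:Z %| (o%:Z - 1)%R)%Z \/ (p%:Z %| (o%:Z + 1)%R)%Z)].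
  move=> oo ->; have h : ~~ (2%:Z %| o%:Z)%Z by rewrite dvdzE /= dvdn2 oo.
  split=> //; last by move: jK j0; clear; lia.
  apply: contra h => h; apply: (@dvdz_lin _ _ 2 _ 1 (- j%:Z) h) => //; ring.
have r4E r : (4 %| r.+1)%N -> exists u, r = (4 * u + 3)%N.
  by move=> /dvdnP[[|u] e]; [|exists u]; move: e; clear; lia.
have [j3|j3] := boolP (j %% 3 == 2)%N.
  pose D := (2 * j + 1)%N.
  have oD : odd D by rewrite /D addn1 /= oddM.
  have D3' : (3 %| D)%N = false by apply/negP; move: j3; rewrite /D; clear; lia.
  have D3 : coprime D 3 by rewrite coprime_sym prime_coprime // D3'.
  have [r [pr r4 rD rQ]] := exists_twisted_prime oD D3 Q0.
  have [u ru] := r4E r r4.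
  exists (r ^ 2)%N, (r * (2 * u + 1))%N; split.
  - by rewrite expn_gt0 prime_gt0.
  - by rewrite totient_pfactor // expn1 ru; clear; lia.
  - by rewrite oddM addn1 /= oddM ru addn3 /= oddM.
  have oE : (2 * (r * (2 * u + 1))%N%:Z = r%:Z * (r%:Z - 1))%R by rewrite ru; lia.
  move: oE; set o := (r * _)%N => oE p pp pQ.
  have [p2|p2] := eqVneq p 2.
    by apply: two => //; rewrite /o oddM addn1 /= oddM ru addn3 /= oddM.
  have [pD|pD] := boolP (p %| D)%N.
    have hr := eqn_mod_dvdz pD rD.
    have hD : (p%:Z %| 2 * j%:Z + 1)%Z by move: pD; rewrite -[(p %| D)%N]/(p%:Z %| D%:Z)%Z /D PoszD PoszM.
    split; last by move=> Kp; have := dvdn_leq (odd_gt0 oD) pD; move: Kp jK; rewrite /D; clear; lia.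
      apply/negP => po.
      have : (p%:Z %| 6)%Z.
        apply: (dvdz_lin (a := 2) (b := - (r%:Z + 2)) po hr).
        have -> : (2 * o%:Z = r%:Z * (r%:Z - 1))%R by []. ring.
      rewrite dvdzE /= => h6; have : (p %| 2 * 3)%N by [].
      rewrite Euclid_dvdM // !dvdn_prime2 // (negPf p2) /= => /eqP e.
      by rewrite -e pD in D3'.
    apply/negP => po; have := prime_dvdz2 2 pp p2.
    suff -> : (p%:Z %| 2%:Z ^+ 2)%Z by [].
    have h1 : (p%:Z %| 2 * (o%:Z + 2 * j%:Z) - 2 * (2 * j%:Z + 1))%Z.
      by apply: (dvdz_lin (a := 2) (b := - 2) po hD); ring.
    apply: (dvdz_lin (a := 1) (b := - (r%:Z + 2)) h1 hr).
    have -> : (2 * (o%:Z + 2 * j%:Z) - 2 * (2 * j%:Z + 1) = r%:Z * (r%:Z - 1) - 2)%R by rewrite -oE; ring.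
    ring.
  have hr : (p%:Z %| r%:Z + 1)%Z.
    by have := rQ p pp pQ pD; rewrite -[(p %| r.+1)%N]/(p%:Z %| r.+1%:Z)%Z -addn1 PoszD.
  have ho : (p%:Z %| o%:Z - 1)%Z.
    apply: prime_dvdz_double => //; apply: (dvdz_lin (a := r%:Z - 2) (b := 0) hr hr).
    rewrite mulrBr oE; ring.
  split; last by left.
    apply/negP => po; have := prime_dvdz2 0 pp p2.
    suff -> : (p%:Z %| 2%:Z ^+ 0)%Z by [].
    by apply: (dvdz_lin (a := 1) (b := - 1) po ho); ring.
  apply/negP => po; case/negP: pD; rewrite -[(p %| D)%N]/(p%:Z %| D%:Z)%Z /D.
  by apply: (dvdz_lin (a := 1) (b := - 1) po ho); rewrite PoszD PoszM; ring.
pose D := (2 * j - 1)%N.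
have DE : (D%:Z = 2 * j%:Z - 1)%R by rewrite /D; move: j0; clear; lia.
have oD : odd D by rewrite /D; move: j0; clear; case: j => // k _; rewrite mulnS add2n subn1 /= oddM.
have D3' : (3 %| D)%N = false.
  by apply/negP; move: j3 j0; rewrite /D; clear; lia.
have D3 : coprime D 3 by rewrite coprime_sym prime_coprime // D3'.
have [r [pr r4 rD rQ]] := exists_twisted_prime oD D3 Q0.
have [u ru] := r4E r r4.
exists r, (2 * u + 1)%N; split.
- exact: prime_gt0.
- by rewrite totient_prime // ru; clear; lia.
- by rewrite addn1 /= oddM.
have oE : (2 * (2 * u + 1)%N%:Z = r%:Z - 1)%R by rewrite ru; lia.
move: oE; set o := (2 * u + 1)%N => oE p pp pQ.
have [p2|p2] := eqVneq p 2.
  by apply: two => //; rewrite /o addn1 /= oddM.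
have [pD|pD] := boolP (p %| D)%N.
  have hr := eqn_mod_dvdz pD rD.
  have hD : (p%:Z %| 2 * j%:Z - 1)%Z by rewrite -DE.
  split; last by move=> Kp; have := dvdn_leq (odd_gt0 oD) pD; move: Kp jK; rewrite /D; clear; lia.
    apply/negP => po; have := prime_dvdz2 1 pp p2.
    suff -> : (p%:Z %| 2%:Z ^+ 1)%Z by [].
    apply: (dvdz_lin (a := 2) (b := - 1) po hr); rewrite oE; ring.
  apply/negP => po; have := prime_dvdz2 2 pp p2.
  suff -> : (p%:Z %| 2%:Z ^+ 2)%Z by [].
  have h1 : (p%:Z %| 2 * (o%:Z + 2 * j%:Z) - 2 * (2 * j%:Z - 1))%Z.
    by apply: (dvdz_lin (a := 2) (b := - 2) po hD); ring.
  apply: (dvdz_lin (a := 1) (b := - 1) h1 hr).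
  have -> : (2 * (o%:Z + 2 * j%:Z) - 2 * (2 * j%:Z - 1) = r%:Z - 1 + 2)%R by rewrite -oE; ring.
  ring.
have hr : (p%:Z %| r%:Z + 1)%Z.
  by have := rQ p pp pQ pD; rewrite -[(p %| r.+1)%N]/(p%:Z %| r.+1%:Z)%Z -addn1 PoszD.
have ho : (p%:Z %| o%:Z + 1)%Z.
  apply: prime_dvdz_double => //; apply: (dvdz_lin (a := 1) (b := 0) hr hr).
  rewrite mulrDr oE; ring.
split; last by right.
  apply/negP => po; have := prime_dvdz2 0 pp p2.
  suff -> : (p%:Z %| 2%:Z ^+ 0)%Z by [].
  by apply: (dvdz_lin (a := - 1) (b := 1) po ho); ring.
apply/negP => po; case/negP: pD; rewrite -[(p %| D)%N]/(p%:Z %| D%:Z)%Z DE.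
by apply: (dvdz_lin (a := 1) (b := - 1) po ho); ring.
Qed.

End Dickson.

Local Open Scope ring_scope.

(** * Compatible multipliers *)
Section Multipliers.
Hypothesis dick : nat_dickson.
Variables (N K : nat).
Hypothesis NK : (2 * N + 2 <= K)%N.

Definition good_multiplier (j c o : nat) := [/\ (0 < c)%N, totient c = (2 * o)%N, odd o &
  forall p, prime p -> (p <= K)%N -> ~~ (p%:Z %| o%:Z)%Z /\ ~~ (p%:Z %| o%:Z + 2 * j%:Z)%Z].

(** A prime p dividing o i forces X = - i modulo p.  There the j-th form has the
    constant value (o j + 2 j - 2 i) / o j, which must exist and not be 0. *)
Definition compatible (o : nat -> nat) (i j : nat) := forall p, prime p -> (p %| o i)%N ->
  ~~ (p %| o j)%N /\ ~~ (p%:Z %| (o j)%:Z + 2 * j%:Z - 2 * i%:Z)%Z.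

(** The new multiplier is chosen with Q divisible by all old o i and by all numbers
    o i + 2 i - 2 j, which settles its compatibility with the old ones in both
    directions; these numbers are not 0 because o i is odd. *)
Lemma choose_multipliers n : (n <= N)%N -> exists c o : nat -> nat,
  (forall j, (0 < j <= n)%N -> good_multiplier j (c j) (o j)) /\
  (forall i j, (0 < i <= n)%N -> (0 < j <= n)%N -> i != j -> compatible o i j).
Proof.
elim: n => [|n IH] nN.
  by exists id, id; split=> [j|i j]; case/andP=> h1 h2; move: h1; rewrite ltnNge h2.
have [c [o [h1 h2]]] := IH (ltnW nN).
pose j := n.+1.
pose Q := (K`! * \prod_(i < n) (o i.+1 * `|((o i.+1)%:Z + 2 * i.+1%:Z - 2 * j%:Z)%R|))%N.
have oodd i : (0 < i <= n)%N -> odd (o i) by move=> /h1[].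
have Q0 : (0 < Q)%N.
  rewrite muln_gt0 fact_gt0 /=; apply: prodn_gt0 => i.
  have oi : odd (o i.+1) by apply: oodd; rewrite /= ltn_ord.
  rewrite muln_gt0 odd_gt0 //= absz_gt0; apply/eqP => e; move: oi.
  have -> : o i.+1 = (2 * (n - i))%N by move: e (ltn_ord i); rewrite /j; clear; lia.
  by rewrite oddM.
have [|cj [oj [c0 cE ojo hp]]] := @choose_multiplier dick j K Q (ltn0Sn n) _ Q0.
  by move: NK nN; rewrite /j; clear; lia.
have Qi i : (0 < i <= n)%N -> (o i * `|((o i)%:Z + 2 * i%:Z - 2 * j%:Z)%R| %| Q)%N.
  case: i => // i /= ilt; rewrite /Q dvdn_mull // (bigD1 (Ordinal ilt)) //= dvdn_mulr //.
exists (fun i => if i == j then cj else c i), (fun i => if i == j then oj else o i); split.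
  move=> i /andP[i0]; rewrite leq_eqVlt => /orP[/eqP ->|].
    rewrite eqxx; split=> // p pp pK.
    have [|//] := hp p pp; rewrite /Q dvdn_mulr // dvdn_fact // prime_gt0 //.
  by rewrite ltnS => le; rewrite ltn_eqF //; apply: h1; rewrite i0.
have newold i : (0 < i <= n)%N -> forall p, prime p -> (p %| oj)%N ->
   ~~ (p %| o i)%N /\ ~~ (p%:Z %| (o i)%:Z + 2 * i%:Z - 2 * j%:Z)%Z.
  move=> hi p pp pj.
  have nQ : ~~ (p %| Q)%N.
    by apply/negP => pQ; have [/negP h _ _] := hp p pp pQ; apply: h.
  split; apply: contra nQ => h; apply: dvdn_trans (Qi i hi).
    exact: dvdn_mulr.
  by rewrite dvdn_mull //; move: h; rewrite dvdzE.
have oldnew i : (0 < i <= n)%N -> forall p, prime p -> (p %| o i)%N ->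
   ~~ (p %| oj)%N /\ ~~ (p%:Z %| oj%:Z + 2 * j%:Z - 2 * i%:Z)%Z.
  move=> hi p pp pi.
  have [_ _ _ hK] := h1 i hi.
  have Kp : (K < p)%N.
    by rewrite ltnNge; apply/negP => pK; have [/negP h _] := hK p pp pK; apply: h.
  have [h3 _ h4] : [/\ ~~ (p%:Z %| oj%:Z)%Z, ~~ (p%:Z %| oj%:Z + 2 * j%:Z)%Z
     & (K < p)%N -> (p%:Z %| oj%:Z - 1)%Z \/ (p%:Z %| oj%:Z + 1)%Z].
    apply: hp => //; apply: dvdn_trans (Qi i hi); exact: dvdn_mulr.
  split; first exact: h3.
  have small (z : nat) : (0 < z <= K)%N -> (p%:Z %| z%:Z)%Z = false.
    by move=> /andP[z0 zK]; rewrite dvdzE /= gtnNdvd // (leq_ltn_trans zK).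
  have ij : (i <= j)%N by rewrite /j; move: hi; clear; lia.
  apply/negP => h; have [h5|h5] := h4 Kp.
    have hz : (2 * (j - i) + 1)%N%:Z = 1 * (oj%:Z + 2 * j%:Z - 2 * i%:Z) + - 1 * (oj%:Z - 1).
      by move: ij; clear; lia.
    have := dvdz_lin h h5 hz; rewrite small //.
    by move: NK nN; rewrite /j; clear; lia.
  have hz : (2 * (j - i) - 1)%N%:Z = 1 * (oj%:Z + 2 * j%:Z - 2 * i%:Z) + - 1 * (oj%:Z + 1).
    by move: hi; rewrite /j; clear; lia.
  have := dvdz_lin h h5 hz; rewrite small //.
  by move: NK nN hi; rewrite /j; clear; lia.
move=> i k /andP[i0 iN] /andP[k0 kN] ik; rewrite /compatible.
have lt l : (0 < l)%N -> (l <= n.+1)%N -> l != j -> (0 < l <= n)%N.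
  by move=> -> h hl /=; rewrite -ltnS ltn_neqAle hl.
have [ei|ni] := eqVneq i j; have [ek|nk] := eqVneq k j.
- by rewrite ei ek eqxx in ik.
- by move=> p pp pi; rewrite ei; apply: newold => //; apply: lt.
- by move=> p pp pi; rewrite ek; apply: oldnew => //; apply: lt.
- by apply: h2 => //; apply: lt.
Qed.

End Multipliers.

(** * Runs of consecutive multiples of 4 that are totients *)
(** Starting point of the progression of X: it makes every (X + j) / o j an integer. *)
Lemma crt_shift (B : nat) (o : nat -> nat) n : (0 < B)%N ->
  (forall j, (0 < j <= n)%N -> (0 < o j)%N /\ coprime B (o j)) ->
  (forall i j, (0 < i <= n)%N -> (0 < j <= n)%N -> i != j -> coprime (o i) (o j)) ->
  exists X, (B %| X)%N /\ forall j, (0 < j <= n)%N -> (o j %| X + j)%N.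
Proof.
move=> B0; elim: n => [|n IH] h1 h2.
  by exists 0%N; rewrite dvdn0; split=> // j /andP[j0]; rewrite leqNgt j0.
have w j : (0 < j <= n)%N -> (0 < j <= n.+1)%N by move=> /andP[-> /leqW].
have [|i j hi hj|X [BX hX]] := IH.
- by move=> j /w /h1.
- by apply: h2; apply: w.
pose M := (B * \prod_(i < n) o i.+1)%N.
have [o0 cB] := h1 n.+1 (leqnn _).
have cop : coprime M (o n.+1).
  rewrite /M coprimeMl cB /=; apply: (big_ind (fun x => coprime x (o n.+1))).
  - exact: coprime1n.
  - by move=> x y hx hy; rewrite coprimeMl hx.
  move=> i _; apply: h2; rewrite /= ?leqnn // ?eqSS ?ltn_eqF ?ltn_ord //.
  exact: ltnW (ltn_ord i).
pose b := ((o n.+1).-1 * n.+1)%N.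
pose Y := chinese M (o n.+1) X b.
have YM d : (d %| M)%N -> (Y = X %[mod d])%N.
  by move=> dM; rewrite -(modn_dvdm Y dM) /Y chinese_modl // modn_dvdm.
exists Y; split.
  have := YM B (dvdn_mulr _ (dvdnn _)); rewrite /dvdn => ->; exact: BX.
case=> // j /=; rewrite ltnS leq_eqVlt => /orP[/eqP ->|jn].
  have e : (b + n.+1 = o n.+1 * n.+1)%N by rewrite /b -mulSnr prednK.
  by rewrite /dvdn -modnDml /Y chinese_modr // modnDml e modnMr.
have jM : (o j.+1 %| M)%N.
  by rewrite /M dvdn_mull // (bigD1 (Ordinal jn)) //= dvdn_mulr.
by rewrite /dvdn -modnDml (YM _ jM) modnDml; apply: hX.
Qed.

Lemma coprime_by_primes a b : (0 < a)%N -> (forall p, prime p -> (p %| a)%N -> ~~ (p %| b)%N) -> coprime a b.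
Proof.
move=> a0 h; rewrite /coprime; apply: contraT => ne.
have g1 : (1 < gcdn a b)%N by rewrite ltn_neqAle eq_sym ne gcdn_gt0 a0.
have := h _ (pdiv_prime g1) (dvdn_trans (pdiv_dvd _) (dvdn_gcdl _ _)).
by rewrite (dvdn_trans (pdiv_dvd _) (dvdn_gcdr _ _)).
Qed.

Lemma prime_dvdn_fact p n : prime p -> (p %| n`!)%N = (p <= n)%N.
Proof.
move=> pp; apply/idP/idP => [|pn]; last by rewrite dvdn_fact // prime_gt0.
elim: n => [|n IH]; first by rewrite dvdn1 => /eqP e; rewrite e in pp.
by rewrite factS Euclid_dvdM // => /orP[/dvdn_leq -> //|/IH/leqW].
Qed.

Section Run.
Hypothesis dick : nat_dickson.

(** The forms are q_j = 2 (X0 + j + M t) / o_j + 1 with M = K`! times the product of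
    the o_j.  Modulo p <= K all of them are nonzero constants.  Modulo a prime p > K
    dividing some o_i, all but the i-th are nonzero constants.  Modulo any other
    p each has at most one root, and p > N.  Then 4 (X + j) = phi (c_j) (q_j - 1). *)
Theorem totient_run N T : (0 < N)%N -> exists2 X, (T < X)%N &
  forall j, (0 < j <= N)%N -> exists2 n, (0 < n)%N & totient n = (4 * (X + j))%N.
Proof.
move=> N0; pose K := (2 * N + 2)%N.
have [c [o [good comp]]] := choose_multipliers dick (leqnn K) (leqnn N).
pose P := (\prod_(i < N) o i.+1)%N.
have o0 j : (0 < j <= N)%N -> (0 < o j)%N by move=> /good[_ _ /odd_gt0].
have P0 : (0 < P)%N by apply: prodn_gt0 => i; apply: o0; rewrite /= ltn_ord.
have cK j : (0 < j <= N)%N -> coprime K`! (o j).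
  move=> hj; apply: coprime_by_primes; rewrite ?fact_gt0 // => p pp pK.
  have [_ _ _ h] := good j hj; have [|h' _] := h p pp; last exact: h'.
  by rewrite -prime_dvdn_fact.
have cO i j : (0 < i <= N)%N -> (0 < j <= N)%N -> i != j -> coprime (o i) (o j).
  move=> hi hj ij; apply: coprime_by_primes; first exact: o0.
  by move=> p pp pi; have [] := comp i j hi hj ij p pp pi.
have [X0 [KX oX]] := @crt_shift K`! o N (fact_gt0 K) (fun j hj => conj (o0 j hj) (cK j hj)) cO.
pose M := (K`! * P)%N.
have M0 : (0 < M)%N by rewrite muln_gt0 fact_gt0.
pose R j := (M %/ o j)%N; pose S j := ((X0 + j) %/ o j)%N.
have oP j : (0 < j <= N)%N -> (o j %| P)%N.
  by case: j => // j /= jN; rewrite /P (bigD1 (Ordinal jN)) //= dvdn_mulr.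
have RE j : (0 < j <= N)%N -> (R j * o j = M)%N by move=> hj; rewrite divnK // dvdn_mull // oP.
have SE j : (0 < j <= N)%N -> (S j * o j = X0 + j)%N by move=> hj; rewrite divnK // oX.
have R0 j : (0 < j <= N)%N -> (0 < R j)%N.
  by move=> hj; move: M0; rewrite -(RE j hj) muln_gt0 => /andP[].
have key j t : (0 < j <= N)%N -> (o j * (2 * R j * t + (2 * S j + 1)) = 2 * (X0 + j + M * t) + o j)%N.
  by move=> hj; rewrite -(RE j hj) -(SE j hj); ring.
have ord j : (j < N)%N -> (0 < j.+1 <= N)%N by [].
have [i|p pp|t tT ht] := @dick N (fun i => 2 * R i.+1)%N (fun i => 2 * S i.+1 + 1)%N N0 _ _
   (T + \sum_(i < N) c i.+1)%N.
- by rewrite muln_gt0 R0 //= ltn_ord.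
- have [p2|p2] := eqVneq p 2.
    exists 0%N => i; rewrite p2 muln0 add0n dvdn2 addn1 /= oddM //.
  have [pK|Kp] := leqP p K.
    have pF : (p %| K`!)%N by rewrite dvdn_fact // prime_gt0.
    exists 0%N => i; apply/negP; rewrite -[(p %| _)%N]/(p%:Z %| _%:Z)%Z => h.
    have hi := ord i (ltn_ord i).
    have [_ _ _ /(_ p pp pK) [_ /negP]] := good _ hi; apply.
    have pX : (p%:Z %| X0%:Z)%Z by apply: (dvdn_trans pF KX).
    apply: (dvdz_lin (a := (o i.+1)%:Z) (b := - 2) h pX).
    by rewrite -PoszM key // muln0 addn0; lia.
  have [/existsP[i pi]|/existsPn np] := boolP [exists i : 'I_N, (p %| o i.+1)%N].
    have hi := ord i (ltn_ord i).
    (* only the i-th form depends on t modulo p *)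
    have oth j t : j != i -> ~~ (p %| 2 * R j.+1 * t + (2 * S j.+1 + 1))%N.
      move=> ji; have hj := ord j (ltn_ord j).
      have ne : i.+1 != j.+1 by rewrite eqSS eq_sym.
      have [_ ]:= comp _ _ hi hj ne p pp pi; apply: contra.
      rewrite -[(p %| _ )%N]/(p%:Z %| _%:Z)%Z => h.
      have pX : (p%:Z %| (X0 + i.+1)%N%:Z)%Z by apply: (dvdn_trans pi (oX _ hi)).
      have pM : (p%:Z %| M%:Z)%Z by apply: dvdn_trans pi _; rewrite dvdn_mull // oP.
      have h1 := dvdz_lin (a := 1) (b := t%:Z) pX pM erefl.
      apply: (dvdz_lin (a := (o j.+1)%:Z) (b := - 2) h h1).
      rewrite -PoszM key //; lia.
    have pA : ~~ (p %| 2 * R i.+1)%N.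
      rewrite Euclid_dvdM // dvdn_prime2 // (negPf p2) /=.
      have -> : R i.+1 = (K`! * \prod_(j < N | j != i) o j.+1)%N.
        apply/eqP; rewrite -(eqn_pmul2r (o0 _ hi)) RE // /M /P (bigD1 i) //=; apply/eqP; ring.
      rewrite Euclid_dvdM // negb_or; apply/andP; split.
        by rewrite prime_dvdn_fact // -ltnNge.
      rewrite Euclid_dvd_prod // big_has_cond; apply/hasPn => j _ /=; rewrite negb_and.
      have [ji|//] := boolP (j != i); rewrite /=.
      have ne : i.+1 != j.+1 by rewrite eqSS eq_sym.
      by have [] := comp _ _ hi (ord j (ltn_ord j)) ne p pp pi.
    have [pB|pB] := boolP (p %| 2 * S i.+1 + 1)%N.
      exists 1%N => j; have [->|ji] := eqVneq j i; last exact: oth.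
      by rewrite muln1 dvdn_addl.
    exists 0%N => j; have [->|ji] := eqVneq j i; last exact: oth.
    by rewrite muln0.
  have pM : ~~ (p %| M)%N.
    rewrite Euclid_dvdM // prime_dvdn_fact // leqNgt Kp /= Euclid_dvd_prod // big_has.
    by apply/hasPn => i _; exact: np.
  (* each form has at most one root modulo p, so one of N + 1 < p values of t is good *)
  suff [t /forallP h] : exists t : 'I_N.+1, [forall i : 'I_N, ~~ (p %| 2 * R i.+1 * t + (2 * S i.+1 + 1))%N].
    by exists t.
  apply/existsP; apply: contraT => /existsPn h.
  have {}h (t : 'I_N.+1) : {i : 'I_N | (p %| 2 * R i.+1 * t + (2 * S i.+1 + 1))%N}.
    by apply: sigW; have := h t; rewrite negb_forall => /existsP[i]; rewrite negbK; exists i.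
  pose f t := sval (h t).
  suff inj : injective f by have := leq_card f inj; rewrite !card_ord ltnn.
  move=> t t' e.
  have h1 : (p %| 2 * R (f t).+1 * t + (2 * S (f t).+1 + 1))%N := svalP (h t).
  have h2 : (p %| 2 * R (f t).+1 * t' + (2 * S (f t).+1 + 1))%N by rewrite e; exact: svalP (h t').
  have pR : coprime p (2 * R (f t).+1).
    rewrite prime_coprime // Euclid_dvdM // dvdn_prime2 // (negPf p2) /=.
    by apply: contra pM => h3; rewrite -(RE _ (ord _ (ltn_ord (f t)))) dvdn_mulr.
  have small (x : 'I_N.+1) : (x < p)%N.
    apply: leq_trans (ltn_ord x) _; apply: leq_trans (ltnW Kp); rewrite /K; clear; lia.
  have h3 : (p%:Z %| (2 * R (f t).+1)%N%:Z * (t%:Z - t'%:Z))%Z.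
    rewrite -[(p %| _)%N]/(p%:Z %| _%:Z)%Z in h1; rewrite -[(p %| _)%N]/(p%:Z %| _%:Z)%Z in h2.
    by apply: (dvdz_lin (a := 1) (b := - 1) h1 h2); rewrite !PoszD !PoszM; ring.
  rewrite Gauss_dvdzr in h3; last by rewrite coprimezE.
  have := small t; have := small t'; move: h3; rewrite dvdzE /=.
  have [/eqP|ne] := eqVneq (t%:Z - t'%:Z) 0; first by rewrite subr_eq0 => /eqP[] /val_inj.
  by move=> /dvdn_leq; rewrite absz_gt0 ne => /(_ isT); clear; lia.
exists (X0 + M * t)%N.
  apply: (@leq_trans t); first by apply: leq_ltn_trans tT; exact: leq_addr.
  by apply: leq_trans (leq_addl _ _); rewrite leq_pmull.
case=> // j /= jN; pose i := Ordinal jN.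
pose q := (2 * R j.+1 * t + (2 * S j.+1 + 1))%N.
have pq : prime q := ht i.
have hj := ord j jN; have [c0 cE _ _] := good _ hj.
have cq : (c j.+1 < q)%N.
  apply: (@leq_ltn_trans t).
    apply: leq_trans (ltnW tT); apply: leq_trans (leq_addl _ _).
    by rewrite (bigD1 i) //= leq_addr.
  rewrite /q addnA addn1 ltnS; apply: leq_trans (leq_addr _ _).
  by rewrite leq_pmull // muln_gt0 R0.
exists (c j.+1 * q)%N; first by rewrite muln_gt0 c0 prime_gt0.
rewrite totient_coprime; last by rewrite coprime_sym prime_coprime // gtnNdvd.
rewrite cE (totient_prime pq); have := key j.+1 t hj; rewrite -/q.
have : (0 < q)%N by rewrite prime_gt0.
case: (q) => // q' _ /=; rewrite mulnS => e.
have : (o j.+1 * q' = 2 * (X0 + j.+1 + M * t))%N by move: e; clear; lia.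
by clear; nia.
Qed.

End Run.

(** * Totients in a window *)
From mathcomp Require Import finmap.
From mathcomp Require Import all_classical all_reals all_analysis.
Import numFieldNormedType.Exports.
Local Open Scope classical_set_scope.
Local Open Scope ring_scope.

Lemma dickson_nat : dickson_conjecture -> nat_dickson.
Proof.
move=> dick s A B s0 A0 nofix T.
pose F (i : 'I_s) : {poly int} := (A i)%:Z%:P * 'X + (B i)%:Z%:P.
have AZ i : (A i)%:Z != 0 by rewrite eqz_nat -lt0n.
have sF i : size (F i) = 2%N.
  by rewrite size_MXaddC polyC_eq0 (negPf (AZ i)) size_polyC AZ.
have FE i (t : nat) : (F i).[t%:Z] = (A i * t + B i)%N%:Z.
  by rewrite !hornerE PoszD PoszM.
have inf : infinite_set [set t : nat | (0 < t)%N /\ forall i, prime_int (F i).[t%:Z]].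
  apply: dick => // [i|[p [pp h]]].
    rewrite lead_coefE sF /= /F coefD coefMX coefC /= coefC /= addr0.
    by rewrite ltz_nat.
  have [t ht] := nofix p pp.
  have := h t%:Z; rewrite horner_prod.
  rewrite (eq_bigr (fun i => (A i * t + B i)%N%:Z)) => [|i _]; last exact: FE.
  rewrite -(big_morph Posz PoszM erefl) dvdzE /= Euclid_dvd_prod // big_has => /hasP[i _].
  by rewrite (negPf (ht i)).
have [t [Tt ht]] : exists t, (T < t)%N /\ forall i, prime_int (F i).[t%:Z].
  apply: contrapT => no; apply: inf; apply: (@sub_finite_set _ _ `I_T.+1); last exact: finite_II.
  move=> t [_ ht] /=; rewrite ltnS leqNgt; apply/negP => Tt; apply: no; by exists t.
exists t => // i; have [p pp] := ht i; rewrite FE => -[->]; exact: pp.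
Qed.

Section Counting.
Variable R : realType.

Let lg (n : nat) : R := ln n%:R / ln 2%:R.

Lemma ln2_gt0 : 0 < ln 2%:R :> R.
Proof. by apply: ln_gt0; rewrite ltr1n. Qed.

Lemma lgM a b : (0 < a)%N -> (0 < b)%N -> lg (a * b) = lg a + lg b.
Proof. by move=> a0 b0; rewrite /lg natrM lnM ?posrE ?ltr0n // mulrDl. Qed.

Lemma lg2 : lg 2 = 1.
Proof. by rewrite /lg divff // gt_eqF // ln2_gt0. Qed.

Lemma lg_le a b : (0 < a <= b)%N -> lg a <= lg b.
Proof.
move=> /andP[a0 ab]; rewrite /lg ler_pM2r ?invr_gt0 ?ln2_gt0 //.
by rewrite ler_ln ?posrE ?ltr0n ?ler_nat // (leq_trans a0).
Qed.

(** The multiples of 4 in the window, plus the sparse remaining totients. *)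
Lemma totient_window_le N : (0 < N)%N -> exists C : nat, forall (x H : nat) (s : seq nat),
  (H <= x)%N -> uniq s -> all (fun m => x < m <= x + H)%N s ->
  (forall m, m \in s -> exists2 n, (0 < n)%N & totient n = m) ->
  (N * size s <= N * (H %/ 4).+1 + H + C)%N.
Proof.
move=> N0; have [C hC] := prime_power_totients_sparse lgM lg2 lg_le N0.
exists C => x H s Hx us sx sV.
pose s4 := [seq m <- s | (4 %| m)%N]; pose s' := [seq m <- s | ~~ (4 %| m)%N].
have sE : size s = (size s4 + size s')%N by rewrite !size_filter count_predC.
have h4 : (size s4 <= (H %/ 4).+1)%N.
  have := @window_count 4 (fun r => r == 0%N) s4 x H isT (filter_uniq _ us) _ _.
  rewrite /= muln1; apply; apply/allP => m; rewrite mem_filter => /andP[m4 ms] //.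
  exact: (allP sx).
have h' : (N * size s' <= H + C)%N.
  apply: (hC x H s' Hx (filter_uniq _ us)).
    by apply/allP => m; rewrite mem_filter => /andP[_ /(allP sx)].
  move=> m; rewrite mem_filter => /andP[m4 /sV[n n0 nm]].
  by rewrite -nm in m4 *; have [p [a [pp e]]] := totient_not4 n0 m4; exists p, a.
by rewrite sE mulnDr -addnA leq_add // leq_mul2l h4 orbT.
Qed.

Definition totient_window (x H : R) : set int := totient_values `&` [set a : int | x < a%:~R <= x + H].

Lemma totient_window_pos (x H : R) (a : int) : 0 <= x -> totient_window x H a ->
  exists m n : nat, [/\ a = m%:Z, (0 < n)%N, totient n = m, x < m%:R & m%:R <= x + H].
Proof.
move=> x0 [[n /= n0 <-] /andP[h1 h2]]; exists (totient n), n; split=> //.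
Qed.

Lemma totient_window_finite (x H : R) : 0 <= x -> finite_set (totient_window x H).
Proof.
move=> x0; apply: (@sub_finite_set _ _ (Posz @` `I_(Num.truncn (x + H)).+1)); last first.
  exact/finite_image/finite_II.
move=> a /(totient_window_pos x0)[m [n [-> n0 e h1 h2]]]; exists m => //=.
by rewrite ltnS truncn_ge_nat // (le_trans _ h2).
Qed.

(** Replaces the finite set of integers by a duplicate-free list of naturals, the
    form in which the counting lemmas are stated. *)
Lemma window_card_list (x H : R) (s : seq nat) : 0 <= x -> s = [seq absz a | a <- fset_set (totient_window x H)] ->
  [/\ size s = window_card totient_values x H, uniq s & forall m, m \in s ->
     [/\ exists2 n, (0 < n)%N & totient n = m, x < m%:R & m%:R <= x + H]].
Proof.
move=> x0 ->; have fin := totient_window_finite H x0.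
have mem a : a \in enum_fset (fset_set (totient_window x H)) -> totient_window x H a.
  by move=> h; apply/set_mem; rewrite -(in_fset_set fin).
split; first by rewrite size_map.
  rewrite map_inj_in_uniq ?fset_uniq // => a b /mem/(totient_window_pos x0)[m [n [-> _ _ _ _]]].
  by move=> /mem/(totient_window_pos x0)[m' [n' [-> _ _ _ _]]] /= ->.
move=> m /mapP[a /mem/(totient_window_pos x0)[m' [n [-> n0 e h1 h2]]] ->] /=.
by split=> //; exists n.
Qed.

End Counting.

(** * The upper Banach density *)
Section Limit.
Variable R : realType.

(** The real window (x, x + H] lies in a window of natural numbers of length at
    most H + 2. *)
Lemma window_card_upper N : (0 < N)%N -> exists C : nat, forall x H : R, 0 <= H -> H + 2 <= x ->
  N%:R * (window_card totient_values x H)%:R <= N%:R * (H / 4 + 2) + (H + 2) + C%:R.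
Proof.
move=> N0; have [C hC] := totient_window_le R N0; exists C => x H H0 Hx.
have x0 : 0 <= x by lra.
have [sz us sP] := @window_card_list R x H _ x0 erefl; set s := [seq _ | _ <- _] in sz us sP.
(* one unit for rounding x and one for rounding H *)
pose X := Num.truncn x; pose H' := (Num.truncn H).+2.
have /andP[X1 X2] := truncn_itv x0; have /andP[H1 H2] := truncn_itv H0.
rewrite -/X in X1 X2.
have HX : (H' <= X)%N.
  by rewrite /X truncn_ge_nat //; apply: le_trans Hx; rewrite /H' -!natr1; lra.
have sx : all (fun m => X < m <= X + H')%N s.
  apply/allP => m /sP[_ m1 m2]; apply/andP; split.
    by rewrite -(ltr_nat R); apply: le_lt_trans m1.
  rewrite -ltnS -(ltr_nat R) -natr1 natrD /H' -!natr1.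
  move: m2 X2 H2; rewrite -!natr1; lra.
have := hC X H' s HX us sx _; rewrite sz => h.
have {}h : (N * window_card totient_values x H <= N * (H' %/ 4).+1 + H' + C)%N.
  by apply: h => m /sP[].
move: h; rewrite -(ler_nat R) natrM !natrD natrM => h; apply: (le_trans h).
have HR : H'%:R <= H + 2 by rewrite /H' -!natr1; lra.
have D4 : ((H' %/ 4)%N%:R : R) * 4 <= H + 2.
  by rewrite -natrM; apply: le_trans HR; rewrite ler_nat leq_trunc_div.
have : N%:R * (H' %/ 4).+1%:R <= N%:R * (H / 4 + 2).
  by apply: ler_wpM2l => //; rewrite -natr1; lra.
by lra.
Qed.


(** A run of totients 4 (X + j) with X large, seen from x = 4 X. *)
Lemma window_card_lower (hD : dickson_conjecture) (H T : R) : 0 < H -> exists2 x, T < x &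
  (H - 4) / 4 <= (window_card totient_values x H)%:R.
Proof.
move=> H0; have H0' := ltW H0; have dick := dickson_nat hD.
pose h := Num.truncn H; pose N := (h %/ 4)%N.
have /andP[H1 H2] := truncn_itv H0'; rewrite -/h in H1 H2.
have hN : (H - 4) / 4 <= N%:R.
  have : (h.+1 <= N.+1 * 4)%N by rewrite ltn_ceil.
  rewrite -(ler_nat R) natrM -(natr1 N); lra.
have [N0|N0] := posnP N.
  exists (T + 1); first by rewrite ltrDl.
  by apply: (le_trans hN); rewrite N0.
pose T0 := Num.truncn (Num.max T 0).
have [X TX hX] := totient_run dick T0 N0.
have TX' : T < (4 * X)%N%:R.
  have m0 : 0 <= Num.max T 0 by rewrite le_max lexx orbT.
  have /andP[_ h2] := truncn_itv m0; rewrite -/T0 in h2.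
  apply: le_lt_trans (_ : Num.max T 0 < _); first by rewrite le_max lexx.
  apply: (lt_le_trans h2); rewrite ler_nat; apply: (leq_trans TX); exact: leq_pmull.
exists (4 * X)%N%:R => //.
apply: (le_trans hN); rewrite ler_nat /window_card -/(totient_window _ _).
have x0 : 0 <= (4 * X)%N%:R :> R by [].
have fin := totient_window_finite H x0.
rewrite -[N](size_iota 1) -(size_map (fun j => (4 * (X + j))%N%:Z)).
apply: uniq_leq_size.
  rewrite map_inj_uniq ?iota_uniq // => i j /eqP; rewrite eqz_nat eqn_pmul2l // eqn_add2l => /eqP //.
move=> a /mapP[j]; rewrite mem_iota add1n ltnS => hj ->.
rewrite -[X in is_true X]/(_ \in fset_set _) (in_fset_set fin); apply/mem_set.
have [n n0 e] := hX j hj; split; first by exists n; rewrite //= e.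
have /andP[j0 jN] := hj.
rewrite /= mulnDr; apply/andP; split.
  by rewrite -[_%:~R]/(_%:R) ltr_nat -[ltnLHS]addn0 ltn_add2l muln_gt0.
rewrite -[_%:~R]/(_%:R) natrD lerD2l; apply: le_trans H1; rewrite ler_nat.
by apply: (leq_trans (leq_mul (leqnn 4) jN)); rewrite mulnC leq_trunc_div.
Qed.

Lemma window_limsup_le (A : set int) (H b T : R) :
  (forall x, T <= x -> H^-1 * (window_card A x H)%:R <= b) -> (window_limsup A H <= b%:E)%E.
Proof.
move=> h; rewrite /window_limsup limf_esupE.
apply: (@le_trans _ _ (ereal_sup ((fun x : R => (H^-1 * (window_card A x H)%:R)%:E) @` [set x | T <= x]))).
  apply: ereal_inf_lbound; exists [set x | T <= x] => //.
  exact: nbhs_pinfty_ge (num_real T).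
by apply: ub_ereal_sup => _ [x /= Tx <-]; rewrite lee_fin h.
Qed.

Lemma window_limsup_ge (A : set int) (H b : R) :
  (forall T, exists2 x, T < x & b <= H^-1 * (window_card A x H)%:R) -> (b%:E <= window_limsup A H)%E.
Proof.
move=> h; rewrite /window_limsup limf_esupE.
apply: le_ereal_inf_tmp => _ [V [M [_ MV]] <-].
have [x Mx bx] := h M.
apply: (@le_trans _ _ (H^-1 * (window_card A x H)%:R)%:E); first by rewrite lee_fin.
by apply: ereal_sup_ubound; exists x => //; exact: MV.
Qed.

End Limit.

Theorem theorem1p2 (R : realType) (hD : dickson_conjecture) :
  has_upper_banach_density totient_values (1 / 4 : R).
Proof.
pose L (H : R) := window_limsup totient_values H.
have lower (H : R) : 0 < H -> ((1 / 4 - H^-1)%:E <= L H)%E.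
  move=> H0; apply: window_limsup_ge => T.
  have [x Tx hx] := window_card_lower hD T H0; exists x => //.
  have -> : 1 / 4 - H^-1 = H^-1 * ((H - 4) / 4) by field; rewrite gt_eqF.
  by rewrite ler_pM2l // invr_gt0.
have upper N : (0 < N)%N -> exists C : nat, forall H : R, 0 < H ->
    (L H <= (1 / 4 + N%:R^-1 + C%:R / H)%:E)%E.
  move=> N0; have [C hC] := window_card_upper R N0; exists (4 + C)%N => H H0.
  apply: (@window_limsup_le _ _ _ _ (H + 2)) => x Hx.
  have := hC x H (ltW H0) Hx; set w := (window_card _ _ _)%:R => hw.
  have NR : 1 <= N%:R :> R by rewrite ler1n.
  have NR0 : 0 < N%:R :> R by rewrite ltr0n.
  rewrite ler_pdivrMl // -(ler_pM2l NR0); apply: (le_trans hw).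
  have -> : N%:R * (H * (1 / 4 + N%:R^-1 + (4 + C)%:R / H)) = N%:R * (H / 4) + H + N%:R * (4 + C)%:R.
    by field; rewrite !gt_eqF.
  have h : 0 <= (N%:R - 1) * (2 + C%:R) :> R by rewrite mulr_ge0 ?subr_ge0 // addr_ge0.
  by rewrite natrD; lra.
have fin (H : R) : 0 < H -> L H \is a fin_num.
  move=> H0; have [C hC] := upper 1%N isT; apply: fin_real.
  by rewrite (lt_le_trans _ (lower H H0)) ?ltNyr // (le_lt_trans (hC H H0)) ?ltry.
apply/fine_cvgP; split.
  by near=> H; apply: fin; near: H; apply: nbhs_pinfty_gt; exact: num_real.
apply/cvgrPdist_le => e e0.
pose N := (Num.truncn (2 / e)).+1.
have N0 : 0 < N%:R :> R by rewrite ltr0n.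
have Ne : N%:R^-1 <= e / 2.
  rewrite -[e / 2]invrK lef_pV2 ?posrE ?invr_gt0 ?divr_gt0 // invf_div.
  exact/ltW/truncnS_gt.
have [C hC] := upper N isT.
near=> H.
have H0 : 0 < H by near: H; apply: nbhs_pinfty_gt; exact: num_real.
have He : e^-1 <= H by near: H; apply: nbhs_pinfty_ge; exact: num_real.
have HC : 2 * C%:R / e <= H by near: H; apply: nbhs_pinfty_ge; exact: num_real.
have := lower H H0; have := hC H H0; rewrite -(fineK (fin H H0)) !lee_fin /=.
set l := fine _ => h1 h2.
have h3 : H^-1 <= e by rewrite -[e]invrK lef_pV2 ?posrE ?invr_gt0.
have h4 : C%:R / H <= e / 2.
  rewrite ler_pdivrMr // mulrAC ler_pdivlMr //; move: HC; rewrite ler_pdivrMr //.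
  by rewrite mulrC (mulrC H).
rewrite ler_norml; apply/andP; split; lra.
Unshelve. all: by end_near.
Qed.
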